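(* Let $(\mathcal X,Q,\pi)$ be an irreducible reversible finite Markov chain with semigroup $P_t=e^{tL}$, and let $\kappa\in\mathbb R$. Then $\mathrm{Ric}(\mathcal X,Q,\pi)\ge\kappa$ (entropic Ricci curvature bounded below by $\kappa$) if and only if for every $\psi\in\mathbb R^{\mathcal X}$, every $\rho\in\mathcal P(\mathcal X)$ and every $t\ge0$, $$|\nabla P_t\psi|^2_\rho\ \le\ e^{-2\kappa t}\,|\nabla\psi|^2_{P_t\rho}.$$
   Context: Setting. $\mathcal X$ is a finite set and $Q:\mathcal X\times\mathcal X\to[0,\infty)$ is a collection of transition rates with $Q(x,x)=0$, irreducible: any $x,y$ are joined by a sequence $x=x_1,\dots,x_n=y$ with $Q(x_i,x_{i+1})>0$. The generator is $L\psi(x)=\sum_{y}(\psi(y)-\psi(x))Q(x,y)$. $\pi$ is the unique (strictly positive) stationary probability measure, assumed reversible: $Q(x,y)\pi(x)=Q(y,x)\pi(y)$ for all $x,y$. Transport distance. $\mathcal P(\mathcal X)=\{\rho:\mathcal X\to[0,\infty): \sum_x\rho(x)\pi(x)=1\}$ is the set of probability densities. Let $\theta(s,t)=\int_0^1 s^{1-p}t^p\,dp$ (logarithmic mean) and $\hat\rho(x,y)=\theta(\rho(x),\rho(y))$. For $\rho_0,\rho_1\in\mathcal P(\mathcal X)$, $$\mathcal W(\rho_0,\rho_1)^2=\inf\Big\{\tfrac12\int_0^1\sum_{x,y}(\psi_t(x)-\psi_t(y))^2\hat\rho_t(x,y)Q(x,y)\pi(x)\,dt\Big\},$$ the infimum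 being over absolutely continuous curves $\rho:[0,1]\to\mathcal P(\mathcal X)$ with endpoints $\rho_0,\rho_1$ and measurable $\psi:[0,1]\to\mathbb R^{\mathcal X}$ such that for a.e. $t$ and all $x$: $\frac{d}{dt}\rho_t(x)+\sum_y(\psi_t(y)-\psi_t(x))\hat\rho_t(x,y)Q(x,y)=0$. $\mathcal W$ is a metric on $\mathcal P(\mathcal X)$. Curvature. Let $\mathcal H(\rho)=\sum_x\pi(x)\rho(x)\log\rho(x)$ (with $0\log0=0$). A constant speed geodesic is a curve $(\rho_t)_{t\in[0,1]}$ with $\mathcal W(\rho_s,\rho_t)=|s-t|\mathcal W(\rho_0,\rho_1)$. $\mathrm{Ric}(\mathcal X,Q,\pi)\ge\kappa$ means that for every constant speed geodesic $(\rho_t)$ in $(\mathcal P(\mathcal X),\mathcal W)$ and $t\in[0,1]$: $\mathcal H(\rho_t)\le(1-t)\mathcal H(\rho_0)+t\mathcal H(\rho_1)-\frac\kappa2t(1-t)\mathcal W(\rho_0,\rho_1)^2$. Notation: $\nabla\psi(x,y)=\psi(y)-\psi(x)$ and $|\nabla\psi|_\rho^2=\frac12\sum_{x,y}(\nabla\psi(x,y))^2\hat\rho(x,y)Q(x,y)\pi(x)$. *)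

(* Defs.v *)
From HB Require Import structures.
From mathcomp Require Import all_boot all_order all_algebra.
From mathcomp Require Import all_classical all_reals all_analysis.

Set Implicit Arguments.
Unset Strict Implicit.
Unset Printing Implicit Defensive.

Import Order.TTheory GRing.Theory Num.Theory.
Import numFieldNormedType.Exports.

Local Open Scope classical_set_scope.
Local Open Scope ring_scope.

Section MarkovChain.
Context {R : realType} {X : finType}.
Implicit Types (Q : X -> X -> R) (pi rho psi : X -> R).

Definition generator Q psi : X -> R :=
  fun x => \sum_y (psi y - psi x) * Q x y.

(* Positivity and stationarity of [pi] follow from the other fields, and so
   does the uniqueness of the stationary probability measure. *)
Record reversible_chain Q pi : Prop := ReversibleChain {
  rates_ge0 : forall x y, 0 <= Q x y ;
  rates_diag : forall x, Q x x = 0 ;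
  rates_irreducible : forall x y, connect [rel u v | 0 < Q u v] x y ;
  stationary_gt0 : forall x, 0 < pi x ;
  stationary_sum1 : \sum_x pi x = 1 ;
  stationaryP : forall psi, \sum_x pi x * generator Q psi x = 0 ;
  detailed_balance : forall x y, Q x y * pi x = Q y x * pi y }.

(* The semigroup [exp (t L)], as the (always convergent) exponential series of
   the linear operator [L = generator Q]. *)
Definition semigroup Q (t : R) psi : X -> R :=
  fun x => limn (series (fun k => t ^+ k / k`!%:R * iter k (generator Q) psi x)).

Definition density pi rho : Prop :=
  (forall x, 0 <= rho x) /\ \sum_x rho x * pi x = 1.

(* [0 `^ p = 0] for [p != 0], so that [logmean s t = 0] as soon as [s] or [t]
   vanishes. *)
Definition logmean (s t : R) : R :=
  \int[lebesgue_measure]_(p in `[0, 1]) (s `^ (1 - p) * t `^ p).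

Definition rhohat rho (x y : X) : R := logmean (rho x) (rho y).

Definition grad psi (x y : X) : R := psi y - psi x.

Definition gradnorm2 Q pi rho psi : R :=
  2^-1 * \sum_x \sum_y grad psi x y ^+ 2 * rhohat rho x y * Q x y * pi x.

Definition absolutely_continuous01 (f : R -> R) : Prop :=
  forall e : R, 0 < e -> exists2 d : R, 0 < d &
    forall (n : nat) (a b : 'I_n -> R),
      (forall i, [/\ 0 <= a i, a i <= b i & b i <= 1]) ->
      trivIset setT (fun i => `]a i, b i[%classic) ->
      \sum_i (b i - a i) < d ->
      \sum_i `|f (b i) - f (a i)| < e.

(* Curves on [0, 1] are functions on [R] whose values outside [0, 1] are
   irrelevant; the differential equation at the two endpoints is irrelevant as
   well, since it is only required almost everywhere. *)
Definition continuity_eq Q (rho psi : R -> X -> R) : Prop :=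
  {ae (@lebesgue_measure R), forall t : R, t \in `[0, 1] ->
    forall x, derivable (fun s => rho s x) t 1 /\
      derive1 (fun s => rho s x) t +
        \sum_y (psi t y - psi t x) * rhohat (rho t) x y * Q x y = 0}.

Definition admissible Q pi rho0 rho1 (rho psi : R -> X -> R) : Prop :=
  [/\ (forall t : R, t \in `[0, 1] -> density pi (rho t)),
      (forall x, absolutely_continuous01 (fun t => rho t x)),
      rho 0 = rho0 /\ rho 1 = rho1,
      (forall x, measurable_fun (`[0, 1] : set R) (fun t => psi t x)) &
      continuity_eq Q rho psi].

Definition action Q pi (rho psi : R -> X -> R) : \bar R :=
  (\int[lebesgue_measure]_(t in `[0%R, 1%R])
     (gradnorm2 Q pi (rho t) (psi t))%:E)%E.

(* [\bar R]-valued so that the infimum is the genuine one (the infimum of the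
   empty set being [+oo]), without relying on a default value. *)
Definition transport_dist Q pi rho0 rho1 : \bar R :=
  sqrte (ereal_inf [set a | exists rho psi : R -> X -> R,
    admissible Q pi rho0 rho1 rho psi /\ a = action Q pi rho psi]).

(* [ln 0 = 0] *)
Definition entropy pi rho : R := \sum_x pi x * rho x * ln (rho x).

Definition constant_speed_geodesic Q pi (rho : R -> X -> R) : Prop :=
  (forall t : R, t \in `[0, 1] -> density pi (rho t)) /\
  (forall s t : R, s \in `[0, 1] -> t \in `[0, 1] ->
    transport_dist Q pi (rho s) (rho t) =
      (`|s - t|%R%:E * transport_dist Q pi (rho 0%R) (rho 1%R))%E).

Definition entropic_Ric_ge Q pi (kappa : R) : Prop :=
  forall rho : R -> X -> R, constant_speed_geodesic Q pi rho ->
  forall t : R, t \in `[0, 1] ->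
  ((entropy pi (rho t))%:E <=
     ((1 - t) * entropy pi (rho 0) + t * entropy pi (rho 1))%R%:E
     - (kappa / 2 * t * (1 - t))%R%:E
       * transport_dist Q pi (rho 0%R) (rho 1%R) ^+ 2)%E.

End MarkovChain.

(* Main.v *)
Require Import Defs.
From HB Require Import structures.
From mathcomp Require Import all_boot all_order all_algebra.
From mathcomp Require Import all_classical all_reals all_analysis.
From mathcomp Require Import measurable_realfun ring lra.

(* Write K_rho psi for the Onsager operator, so that a curve solves
   rho' = K_rho psi and has action the integral of |grad psi|^2_rho.

   From the gradient estimate to convexity.  If (rho_s) joins rho_0 to rho_1,
   then the curve P_{b s} rho_s has velocity P_{b s} K_rho psi + b L P_{b s} rho_s.
   The gradient estimate is dual to a bound on the first part, and the second
   part is minus b times the gradient of the entropy H, so that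
   W^2(rho_0, P_b rho_1) <= M A - 2 b (H(P_b rho_1) - H(rho_0)) where A is the
   action and M bounds exp(-2 kappa b s).  Along a geodesic cut into small pieces
   this becomes an evolution variational inequality; adding the inequalities for
   the two parts of a geodesic at an intermediate point and letting b -> 0 gives
   the convexity of H.

   From convexity to the gradient estimate.  On densities bounded below a gradient
   estimate holds with some constant, and curves of small action stay among such
   densities; hence close points are joined by geodesics (ultrafilter limits of
   almost minimal curves), and the first argument is available with a crude
   constant.  Convexity of H along geodesics then yields the contraction
   W^2(P_t rho, P_t sigma) <= exp(-2 kappa t) W^2(rho, sigma) for close rho and
   sigma, first infinitesimally.  With sigma = rho + e K_rho P_t psi and e -> 0
   this is the gradient estimate at rho; boundary densities are limits. *)

Set Implicit Arguments.
Unset Strict Implicit.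
Unset Printing Implicit Defensive.

Import Order.TTheory GRing.Theory Num.Theory.
Import numFieldNormedType.Exports.

Local Open Scope classical_set_scope.
Local Open Scope ring_scope.

(** * Absolutely continuous functions *)

(** The obstacle on both sides is the boundary of the set of densities: there [rhohat] vanishes, a
    velocity need not have a potential, and the logarithm in the derivative of the entropy is
    singular. Heat removes it, since [semigroup Q t rho] is strictly positive for [t > 0]; the
    entropy is therefore differentiated only along smoothed curves and at interior times. Neither
    finiteness nor attainment of the distance is known beforehand, so the arguments work with real
    upper bounds on the action of almost optimal curves. What evolves nicely under the heat flow is
    the velocity, not the potential; the potential is recovered afterwards by inverting the Onsager
    operator, in a form that stays measurable in time. In the converse the crude constant does no
    harm because only short end pieces of a geodesic are heated: their share of the length is fixed
    first, the time step afterwards, and the error accumulated over a fixed time is then as small as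
    desired. The factor [exp(-2 kappa t)] comes from the convexity of the entropy alone. *)

Section AbsoluteContinuity.
Context {R : realType}.
Implicit Types (c d : R) (f g F G : R -> R).
Notation mu := (@lebesgue_measure R).

(** On [[0, 1]] this is convertible to [absolutely_continuous01]; general endpoints serve to
    restrict, glue and reparametrize curves. *)
Definition ac_on c d f : Prop :=
  forall e : R, 0 < e -> exists2 r : R, 0 < r &
    forall (n : nat) (a b : 'I_n -> R),
      (forall i, [/\ c <= a i, a i <= b i & b i <= d]) ->
      trivIset setT (fun i => `]a i, b i[%classic) ->
      \sum_i (b i - a i) < r ->
      \sum_i `|f (b i) - f (a i)| < e.

(** The common source of the closure properties: increments of a sum, or of a product of bounded
    functions, are controlled by those of the two operands. *)
Lemma ac_on_dominated2 c d C f g1 g2 : ac_on c d g1 -> ac_on c d g2 ->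
  (forall u v, c <= u -> u <= v -> v <= d ->
    `|f v - f u| <= C * (`|g1 v - g1 u| + `|g2 v - g2 u|)) ->
  ac_on c d f.
Proof.
move=> ac1 ac2 fle e e0.
have C0 : 0 < `|C| + 1 by rewrite ltr_wpDl.
have e'0 : 0 < e / (`|C| + 1) / 2 by rewrite !divr_gt0.
have [r1 r10 h1] := ac1 _ e'0.
have [r2 r20 h2] := ac2 _ e'0.
exists (Num.min r1 r2); first by rewrite lt_min r10 r20.
move=> n a b ab tr; rewrite lt_min => /andP[lt1 lt2].
apply: (@le_lt_trans _ _ ((`|C| + 1) * (\sum_i `|g1 (b i) - g1 (a i)| +
    \sum_i `|g2 (b i) - g2 (a i)|))); last first.
  have := h1 n a b ab tr lt1; have := h2 n a b ab tr lt2 => l2 l1.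
  rewrite mulrC -ltr_pdivlMr//.
  have -> : e / (`|C| + 1) = e / (`|C| + 1) / 2 + e / (`|C| + 1) / 2.
    by field; rewrite gt_eqF.
  exact: ltrD.
rewrite -big_split/= mulr_sumr; apply: ler_sum => i _.
have [ca aib bd] := ab i.
apply: le_trans (fle _ _ ca aib bd) _; apply: ler_wpM2r.
  by rewrite addr_ge0.
by rewrite (le_trans (ler_norm _))// lerDl.
Qed.

Lemma ac_on_dominated c d C f g : ac_on c d g ->
  (forall u v, c <= u -> u <= v -> v <= d ->
    `|f v - f u| <= C * `|g v - g u|) ->
  ac_on c d f.
Proof.
move=> acg fle; apply: (@ac_on_dominated2 c d (`|C|) f g g) => // u v cu uv vd.
apply: (le_trans (fle _ _ cu uv vd)).
apply: (@le_trans _ _ (`|C| * `|g v - g u|)); first by rewrite ler_wpM2r// ler_norm.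
by rewrite ler_wpM2l// lerDl.
Qed.

Lemma ac_on_id c d : ac_on c d id.
Proof.
move=> e e0; exists e => // n a b ab _ lt.
rewrite (eq_bigr (fun i => b i - a i))// => i _.
by rewrite ger0_norm// subr_ge0; have [] := ab i.
Qed.

Lemma ac_on_lipschitz c d C f :
  (forall u v, c <= u -> u <= v -> v <= d -> `|f v - f u| <= C * (v - u)) ->
  ac_on c d f.
Proof.
move=> fle; apply: (@ac_on_dominated c d C f id (@ac_on_id c d)) => u v cu uv vd.
by rewrite (le_trans (fle _ _ cu uv vd))// ger0_norm ?subr_ge0.
Qed.

Lemma ac_on_cst c d (k : R) : ac_on c d (fun=> k).
Proof.
by apply: (@ac_on_lipschitz c d 0) => u v _ uv _; rewrite subrr normr0 mul0r.
Qed.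

Lemma ac_onD c d f g : ac_on c d f -> ac_on c d g ->
  ac_on c d (fun t => f t + g t).
Proof.
move=> acf acg; apply: (ac_on_dominated2 (C := 1) acf acg) => u v _ _ _.
by rewrite mul1r opprD addrACA ler_normD.
Qed.

Lemma ac_onM c d f g A B : ac_on c d f -> ac_on c d g ->
  (forall t, c <= t -> t <= d -> `|f t| <= A) ->
  (forall t, c <= t -> t <= d -> `|g t| <= B) ->
  ac_on c d (fun t => f t * g t).
Proof.
move=> acf acg fA gB.
apply: (ac_on_dominated2 (C := `|A| + `|B|) acf acg) => u v cu uv vd.
have -> : f v * g v - f u * g u = g v * (f v - f u) + f u * (g v - g u) by ring.
rewrite (le_trans (ler_normD _ _))// !normrM mulrDr; apply: lerD.
- apply: ler_wpM2r => //; rewrite (le_trans (gB _ _ vd)) ?(le_trans cu)//.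
  by rewrite (le_trans (ler_norm _))// lerDr.
- apply: ler_wpM2r => //; rewrite (le_trans (fA _ cu (le_trans uv vd)))//.
  by rewrite (le_trans (ler_norm _))// lerDl.
Qed.

Lemma ac_onZ c d f k : ac_on c d f -> ac_on c d (fun t => k * f t).
Proof.
move=> acf; apply: (ac_on_dominated (C := `|k|) acf) => u v _ _ _.
by rewrite -mulrBr normrM.
Qed.

Lemma ac_on_sum (I : Type) (s : seq I) (P : pred I) c d (f : I -> R -> R) :
  (forall i, ac_on c d (f i)) -> ac_on c d (fun t => \sum_(i <- s | P i) f i t).
Proof.
move=> acf; elim: s => [|i s ih].
  by under eq_fun do rewrite big_nil; exact: ac_on_cst.
under eq_fun do rewrite big_cons; case: (P i) => //.
exact: ac_onD (acf i) ih.
Qed.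

Lemma ac_onW c d c' d' f : c <= c' -> d' <= d -> ac_on c d f -> ac_on c' d' f.
Proof.
move=> cc dd acf e e0; have [r r0 h] := acf e e0; exists r => // n a b ab.
apply: h => i; have [ca aib bd] := ab i; split => //.
- exact: le_trans ca.
- exact: le_trans dd.
Qed.

Lemma eq_ac_on c d f g : (forall t, c <= t -> t <= d -> f t = g t) ->
  ac_on c d f -> ac_on c d g.
Proof.
move=> fg acf; apply: (ac_on_dominated (C := 1) acf) => u v cu uv vd.
by rewrite mul1r !fg ?(le_trans cu uv) ?(le_trans uv vd).
Qed.

(** Every interval is cut at [m]. Truncating its ends with [min] and [max] treats all positions at
    once: a missing part becomes a degenerate interval. *)
Lemma ac_on_glue c m d f : ac_on c m f -> ac_on m d f -> ac_on c d f.
Proof.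
move=> acl acr e e0; have e20 : 0 < e / 2 by rewrite divr_gt0.
have [r1 r10 h1] := acl _ e20; have [r2 r20 h2] := acr _ e20.
exists (Num.min r1 r2); first by rewrite lt_min r10 r20.
move=> n a b ab tr; rewrite lt_min => /andP[lt1 lt2].
pose a1 i := Num.min (a i) m; pose b1 i := Num.min (b i) m.
pose a2 i := Num.max (a i) m; pose b2 i := Num.max (b i) m.
have ab' i : a i <= b i by have [] := ab i.
have cle i : c <= a i by have [] := ab i.
have led i : b i <= d by have [] := ab i.
have E (h : R -> R) i : h (b1 i) - h (a1 i) + (h (b2 i) - h (a2 i)) =
    h (b i) - h (a i).
  rewrite /a1 /b1 /a2 /b2.
  case: (leP (a i) m) => am; case: (leP (b i) m) => bm.
  - by rewrite subrr addr0.
  - by rewrite addrC addrA subrK.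
  - by have := lt_le_trans am (ab' i); rewrite ltNge bm.
  - by rewrite subrr add0r.
have le1 i : a1 i <= b1 i by rewrite /a1 /b1 le_min2.
have le2 i : a2 i <= b2 i by rewrite /a2 /b2 le_max2.
have T1 : \sum_i `|f (b1 i) - f (a1 i)| < e / 2.
  have [cm|mc] := leP c m; last first.
    rewrite big1 ?divr_gt0// => i _.
    rewrite /a1 /b1 !min_r ?subrr ?normr0//.
    - exact: le_trans (ltW mc) (cle i).
    - exact: le_trans (le_trans (ltW mc) (cle i)) (ab' i).
  apply: h1.
  - move=> i; split => //; first by rewrite /a1 le_min cle cm.
    by rewrite /b1 ge_min lexx orbT.
  - move=> i j _ _ [x []/=]; rewrite !in_itv/= /a1 /b1.
    move=> /andP[]; rewrite gt_min lt_min => /orP[+|+] /andP[+ xm]; last by rewrite ltNge (ltW xm).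
    move=> ax xb /andP[]; rewrite gt_min lt_min => /orP[+|+] /andP[+ _]; last by rewrite ltNge (ltW xm).
    move=> ax' xb'; apply: (tr i j) => //; exists x.
    by split; rewrite /= in_itv/= ?ax ?ax'.
  - apply: le_lt_trans lt1; apply: ler_sum => i _.
    by rewrite -(E id i) lerDl subr_ge0.
have T2 : \sum_i `|f (b2 i) - f (a2 i)| < e / 2.
  have [md|dm] := leP m d; last first.
    rewrite big1 ?divr_gt0// => i _.
    rewrite /a2 /b2 !max_r ?subrr ?normr0//.
    - exact: le_trans (ab' i) (le_trans (led i) (ltW dm)).
    - exact: le_trans (led i) (ltW dm).
  apply: h2.
  - move=> i; split => //; first by rewrite /a2 le_max lexx orbT.
    by rewrite /b2 ge_max led md.
  - move=> i j _ _ [x []/=]; rewrite !in_itv/= /a2 /b2.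
    move=> /andP[]; rewrite gt_max lt_max => /andP[ax mx] /orP[|xm]; last by move: mx; rewrite ltNge (ltW xm).
    move=> xb /andP[]; rewrite gt_max lt_max => /andP[ax' _] /orP[|xm]; last by move: mx; rewrite ltNge (ltW xm).
    move=> xb'; apply: (tr i j) => //; exists x.
    by split; rewrite /= in_itv/= ?ax ?ax'.
  - apply: le_lt_trans lt2; apply: ler_sum => i _.
    by rewrite -(E id i) lerDr subr_ge0.
have -> : e = e / 2 + e / 2 by field.
apply: le_lt_trans (ltrD T1 T2); rewrite -big_split/=; apply: ler_sum => i _.
by rewrite -E; apply: ler_normD.
Qed.

Lemma ac_on_affine c d c' d' f k m : ac_on c' d' f ->
  (forall t, c <= t -> t <= d -> c' <= k * t + m <= d') ->
  ac_on c d (fun t => f (k * t + m)).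
Proof.
move=> acf kmP.
have [->|k0] := eqVneq k 0.
  by under eq_fun do rewrite mul0r; exact: ac_on_cst.
have nk : 0 < `|k| by rewrite normr_gt0.
move=> e e0; have [r r0 h] := acf e e0; exists (r / `|k|); first by rewrite divr_gt0.
move=> n a b ab tr; rewrite ltr_pdivlMr// mulr_suml => lt.
case: (ltgtP k 0) => [kn|kp|ke]; last by rewrite ke eqxx in k0.
- rewrite (eq_bigr (fun i => `|f (k * a i + m) - f (k * b i + m)|)); last first.
    by move=> i _; rewrite distrC.
  apply: (h n (fun i => k * b i + m) (fun i => k * a i + m)).
  + move=> i; have [ca aib bd] := ab i; split.
    * by have /andP[] := kmP _ (le_trans ca aib) bd.
    * by rewrite lerD2r ler_wnM2l// ltW.
    * by have /andP[] := kmP _ ca (le_trans aib bd).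
  + move=> i j _ _ [x []/=]; rewrite !in_itv/= => /andP[l1 l2] /andP[l3 l4].
    apply: (tr i j) => //; exists ((x - m) / k); split => /=; rewrite in_itv/= ltr_ndivlMr// ltr_ndivrMr//; apply/andP; split; lra.
  + apply: le_lt_trans lt; apply: ler_sum => i _.
    by rewrite ltr0_norm//; lra.
- apply: (h n (fun i => k * a i + m) (fun i => k * b i + m)).
  + move=> i; have [ca aib bd] := ab i; split.
    * by have /andP[] := kmP _ ca (le_trans aib bd).
    * by rewrite lerD2r ler_wpM2l// ltW.
    * by have /andP[] := kmP _ (le_trans ca aib) bd.
  + move=> i j _ _ [x []/=]; rewrite !in_itv/= => /andP[l1 l2] /andP[l3 l4].
    apply: (tr i j) => //; exists ((x - m) / k); split => /=; rewrite in_itv/= ltr_pdivlMr// ltr_pdivrMr//; apply/andP; split; lra.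
  + apply: le_lt_trans lt; apply: ler_sum => i _.
    by rewrite gtr0_norm//; lra.
Qed.

Lemma ac_on_uniform c d f : ac_on c d f -> forall e, 0 < e -> exists2 r, 0 < r &
  forall u v, c <= u -> u <= v -> v <= d -> v - u < r -> `|f v - f u| < e.
Proof.
move=> acf e e0; have [r r0 h] := acf e e0; exists r => // u v cu uv vd vur.
have := h 1%N (fun=> u) (fun=> v); rewrite !big_ord1; apply => //.
by move=> i j _ _ _; rewrite !ord1.
Qed.

Lemma ac_on_continuous c d f : ac_on c d f -> {within `[c, d], continuous f}.
Proof.
move=> acf; apply/subspace_continuousP => x; rewrite /= in_itv/= => /andP[cx xd].
apply/cvgrPdist_lt => e e0; have [r r0 h] := ac_on_uniform acf e0.
rewrite near_withinE; exists r => //= y xy; rewrite /= in_itv/= => /andP[cy yd].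
have [yx|/ltW yx] := leP y x.
- by apply: h => //; rewrite (le_lt_trans _ xy)// ler_norm.
- by rewrite distrC; apply: h => //; rewrite (le_lt_trans _ xy)// distrC ler_norm.
Qed.

End AbsoluteContinuity.

(** * Integrating a differential inequality that holds almost everywhere *)

Section FundamentalTheorem.
Context {R : realType}.
Implicit Types (c d : R) (f g F G : R -> R).
Notation mu := (@lebesgue_measure R).

Lemma derivable_first_order F (t e : R) : derivable F t 1 -> 0 < e ->
  exists2 h, 0 < h &
    forall s, `|s - t| < h -> `|F s - F t - derive1 F t * (s - t)| <= e * `|s - t|.
Proof.
move=> dF e0; have : h^-1 *: (F (h + t) - F t) @[h --> 0^'] --> derive1 F t.
  rewrite derive1E; have := dF; rewrite /derivable /derive.
  by under eq_fun do rewrite [_%:A]mulr1.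
move/cvgrPdist_lt => /(_ e e0); rewrite near_withinE => -[h /= h0 hP].
exists h => // s sth; have [->|st] := eqVneq s t.
  by rewrite !subrr mulr0 subr0 normr0 mulr0.
have st0 : s - t != 0 by rewrite subr_eq0.
have := hP (s - t); rewrite /ball_/= sub0r normrN => /(_ sth st0).
rewrite subrK => /ltW; rewrite -(ler_pM2r (x := `|s - t|)) ?normr_gt0//.
rewrite -normrM => /(le_trans _); apply.
rewrite -normrN le_eqVlt; apply/orP; left; apply/eqP; congr `|_|.
by rewrite /GRing.scale/=; field.
Qed.

Lemma sum_itv_lt_measure (n : nat) (a b : 'I_n -> R) (U : set R) (r : R) :
  measurable U -> (mu U < r%:E)%E -> (forall i, a i <= b i) ->
  trivIset setT (fun i => `]a i, b i[%classic) ->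
  (forall i, `]a i, b i[ `<=` U) -> \sum_i (b i - a i) < r.
Proof.
move=> mU Ur ab tr sU; rewrite -lte_fin; apply: le_lt_trans Ur.
rewrite -sumEFin (eq_bigr (fun i => mu `]a i, b i[)); last first.
  move=> i _; rewrite lebesgue_measure_itv/= lte_fin.
  case: ltP => // ba; have -> : a i = b i by apply/eqP; rewrite eq_le ab ba.
  by rewrite subrr.
rewrite -(measure_bigsetU_ord _ xpredT)//=.
apply: le_measure; rewrite ?inE//; first exact: bigsetU_measurable.
by elim/big_ind: _ => // V W VU WU; rewrite subUset.
Qed.

(* Away from an open set of small measure containing the exceptional set [F]
   grows locally no faster than [G], and on that open set the increments of [F]
   are controlled by absolute continuity; a supremum argument chains the local
   estimates. *)
Lemma ac_on_increment_le c d F G (N : set R) : c <= d -> ac_on c d F ->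
  (forall u v, c <= u -> u <= v -> v <= d -> G u <= G v) ->
  mu.-negligible N ->
  (forall t, c < t -> t < d -> ~ N t ->
    [/\ derivable F t 1, derivable G t 1 & derive1 F t <= derive1 G t]) ->
  F d - F c <= G d - G c.
Proof.
move=> cd acF ndG negN dFG; apply/ler_addgt0Pr => e e0.
have e20 : 0 < e / 2 by rewrite divr_gt0.
have [r r0 acr] := acF _ e20.
pose e1 := e / 2 / (d - c + 1).
have dc1 : 0 < d - c + 1 by rewrite ltr_wpDl// subr_ge0.
have e10 : 0 < e1 by rewrite divr_gt0.
have neg1 (x : R) : mu.-negligible [set x].
  by exists [set x]; split => //; exact: lebesgue_measure_set1.
(* The endpoints join the exceptional set, so that outside [U] the derivatives, given on the open
   interval only, are available. *)
have [A [mA A0 NA]] : mu.-negligible (N `|` ([set c] `|` [set d])).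
  exact: negligibleU negN (negligibleU (neg1 c) (neg1 d)).
have {}A0 : lebesgue_measure (A : set R) = 0%E := A0.
have [|U [oU AU muUA]] := @lebesgue_regularity_outer _ A r mA _ r0.
  have lty (x : \bar R) : x = 0%E -> (x < +oo)%E by move=> ->; exact: ltry.
  exact: lty A0.
have {}muUA : (mu (U `\` A) < r%:E)%E := muUA.
have mU : measurable U by exact: open_measurable.
have muU : (mu U < r%:E)%E.
  apply: le_lt_trans muUA; rewrite -[leRHS]adde0 -A0.
  apply: le_trans (measureU2 _ _ _) => //; last exact: measurableD.
  apply: le_measure; rewrite ?inE//.
    by apply: measurableU => //; exact: measurableD.
  by move=> x Ux; have [Ax|nAx] := pselect (A x); [right|left].
(* [P t] holds when, up to time [t], the excess of [F] over [G] is covered by a slope [e1] and by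
   increments of [F] over finitely many ordered intervals inside [U]. *)
pose P t := exists n (a b : nat -> R), [/\
  (forall i, (i < n)%N -> [/\ c <= a i, a i <= b i, b i <= t & `]a i, b i[ `<=` U]),
  (forall i j, (i < j)%N -> (j < n)%N -> b i <= a j) &
  F t - F c <= G t - G c + e1 * (t - c) + \sum_(i < n) `|F (b i) - F (a i)|].
(* Around each [t], [P] passes from any nearby point on the left to any nearby point on the right:
   by one more interval if [t] is in [U], by the first-order expansions otherwise. *)
have local t : c <= t -> t <= d -> exists2 h, 0 < h & forall u v,
    c <= u -> u <= t -> t <= v -> v <= d -> t - u < h -> v - t < h -> P u -> P v.
  move=> ct td; have [Ut|nUt] := pselect (U t).
    have [h /= h0 hU] : nbhs t U by exact: open_nbhs_nbhs.
    exists h => // u v cu ut tv vd tuh vth [n [a [b [abP bP FP]]]].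
    exists n.+1, (fun i => if i == n then u else a i),
      (fun i => if i == n then v else b i); split.
    - move=> i; rewrite ltnS leq_eqVlt; case: eqP => [_ _|_ /= /abP[]].
        split => //; first exact: le_trans tv.
        move=> x /=; rewrite in_itv/= => /andP[ux xv]; apply: hU => /=.
        rewrite ltr_norml; apply/andP; split; lra.
      by move=> ? ? ? ?; split => //; lra.
    - move=> i j ij; rewrite ltnS leq_eqVlt => /orP[/eqP jn|jn].
        rewrite jn eqxx ifN_eq; last by rewrite -jn ltn_eqF.
        by have [] := abP i _; rewrite -?jn.
      by rewrite !ifN_eq ?ltn_eqF ?(ltn_trans ij)//; exact: bP.
    - rewrite big_ord_recr/= eqxx.
      rewrite (eq_bigr (fun i : 'I_n => `|F (b i) - F (a i)|)); last first.
        by move=> i _; rewrite !ifN_eq// ltn_eqF.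
      have := ndG u v cu (le_trans ut tv) vd.
      have := ler_norm (F v - F u).
      have : e1 * (u - c) <= e1 * (v - c) by rewrite ler_pM2l// lerD2r; lra.
      set S := \sum_(_ < _) _ in FP *; lra.
  have ct' : c < t.
    rewrite lt_neqAle ct andbT; apply/eqP => ctE; apply: nUt; apply/AU/NA.
    by right; left; rewrite ctE.
  have td' : t < d.
    rewrite lt_neqAle td andbT; apply/eqP => ctE; apply: nUt; apply/AU/NA.
    by right; right; rewrite ctE.
  have nNt : ~ N t by move=> Nt; apply: nUt; apply/AU/NA; left.
  have [dF dG FG] := dFG t ct' td' nNt.
  have e120 : 0 < e1 / 2 by rewrite divr_gt0.
  have [h1 h10 hF] := derivable_first_order dF e120.
  have [h2 h20 hG] := derivable_first_order dG e120.
  exists (Num.min h1 h2); first by rewrite lt_min h10.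
  move=> u v cu ut tv vd; rewrite !lt_min => /andP[tu1 tu2] /andP[vt1 vt2].
  move=> [n [a [b [abP bP FP]]]]; exists n, a, b; split => //.
    by move=> i /abP[? ? ? ?]; split => //; lra.
  have utn : `|u - t| = t - u by rewrite ler0_norm ?opprB// subr_le0.
  have vtn : `|v - t| = v - t by rewrite ger0_norm// subr_ge0.
  have := hF u; rewrite utn => /(_ tu1); rewrite ler_norml => /andP[Fu1 Fu2].
  have := hG u; rewrite utn => /(_ tu2); rewrite ler_norml => /andP[Gu1 Gu2].
  have := hF v; rewrite vtn => /(_ vt1); rewrite ler_norml => /andP[Fv1 Fv2].
  have := hG v; rewrite vtn => /(_ vt2); rewrite ler_norml => /andP[Gv1 Gv2].
  have Y1 : derive1 F t * (v - t) <= derive1 G t * (v - t) by rewrite ler_wpM2r// subr_ge0.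
  have Y2 : derive1 F t * (t - u) <= derive1 G t * (t - u) by rewrite ler_wpM2r// subr_ge0.
  set S := \sum_(_ < _) _ in FP *.
  lra.
have Pc : P c.
  by exists 0%N, (fun=> 0), (fun=> 0); split => //; rewrite big_ord0 !subrr mulr0 !addr0.
pose S := [set t | c <= t <= d /\ P t].
have S0 : S !=set0 by exists c; rewrite /S/= lexx cd.
have Sub : ubound S d by move=> t [/andP[]].
have hsS : has_sup S by split => //; exists d.
have cs : c <= sup S by apply: sup_upper_bound => //; rewrite /S/= lexx cd.
have sd : sup S <= d by apply: ge_sup.
have [h h0 hP] := local (sup S) cs sd.
have [u [/andP[cu ud] Pu] us] : exists2 u, S u & sup S - h < u.
  have [u Su us] := sup_adherent h0 hsS; by exists u.
have us' : u <= sup S by apply: sup_upper_bound => //; split => //; rewrite cu.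
have step v : sup S <= v -> v <= d -> v - sup S < h -> P v.
  by move=> sv vd vh; apply: (hP u v) => //; lra.
have Pd : P d.
  have [sdE|sdlt] := leP d (sup S); first by apply: step => //; lra.
  pose v := Num.min d (sup S + h / 2).
  have h20 : 0 < h / 2 by rewrite divr_gt0.
  have sv : sup S < v by rewrite lt_min sdlt ltrDl.
  have vd : v <= d by rewrite ge_min lexx.
  have vh : v - sup S < h.
    rewrite ltrBlDl; apply: (@le_lt_trans _ _ (sup S + h / 2)).
      by rewrite ge_min lexx orbT.
    by rewrite ltrD2l; lra.
  have Pv := step v (ltW sv) vd vh.
  have : v <= sup S.
    by apply: sup_upper_bound => //; split => //; rewrite vd (le_trans cs (ltW sv)).
  by rewrite leNgt sv.
case: Pd => n [a [b [abP bP FP]]].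
have tr : trivIset setT (fun i : 'I_n => `]a i, b i[%classic).
  move=> i j _ _ [x []/=]; rewrite !in_itv/= => /andP[l1 l2] /andP[l3 l4].
  case: (ltngtP (nat_of_ord i) (nat_of_ord j)) => [ij|ji|/ord_inj //].
  - by exfalso; have := bP _ _ ij (ltn_ord j); lra.
  - by exfalso; have := bP _ _ ji (ltn_ord i); lra.
have lt : \sum_(i < n) (b i - a i) < r.
  apply: (sum_itv_lt_measure mU muU _ tr) => i; by have [] := abP i (ltn_ord i).
have := acr n (fun i => a i) (fun i => b i) _ tr lt.
have {}abP : forall i : 'I_n, [/\ c <= a i, a i <= b i & b i <= d].
  by move=> i; have [] := abP i (ltn_ord i).
move=> /(_ abP).
have : e1 * (d - c) <= e / 2.
  have <- : e1 * (d - c + 1) = e / 2 by rewrite /e1 divfK// gt_eqF.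
  by rewrite ler_pM2l// lerDl.
set T := \sum_(_ < _) _ in FP *.
lra.
Qed.

End FundamentalTheorem.

Section FundamentalTheoremIntegral.
Context {R : realType}.
Implicit Types (c d : R) (f g F G : R -> R).
Notation mu := (@lebesgue_measure R).

Lemma ae_imp (P Q : R -> Prop) : (forall t, P t -> Q t) ->
  {ae mu, forall t, P t} -> {ae mu, forall t, Q t}.
Proof. by move=> PQ; apply: (@filterS _ _ (ae_filter_ringOfSetsType mu)). Qed.

Lemma ae_and (P Q : R -> Prop) :
  {ae mu, forall t, P t} -> {ae mu, forall t, Q t} ->
  {ae mu, forall t, P t /\ Q t}.
Proof. exact: (@filterI _ _ (ae_filter_ringOfSetsType mu)). Qed.

Definition primitive c f x : R := (\int[mu]_(t in `[c, x]) f t)%R.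

Lemma lebesgue_measure_itv_lty (b1 b2 : bool) c d :
  (mu [set` Interval (BSide b1 c) (BSide b2 d)] < +oo)%E.
Proof. by rewrite lebesgue_measure_itv; case: ifPn => //= _; rewrite -EFinB ltry. Qed.

Lemma bounded_integrable_itv (b1 b2 : bool) c d f (M : R) :
  let I := [set` Interval (BSide b1 c) (BSide b2 d)] in
  measurable_fun I f -> (forall t, I t -> `|f t| <= M) ->
  mu.-integrable I (EFin \o f).
Proof.
move=> I mf fM; apply: measurable_bounded_integrable => //=.
- exact: measurable_itv.
- exact: lebesgue_measure_itv_lty.
exists M; split; first exact: num_real.
by move=> x Mx t /= It; rewrite (le_trans (fM _ It))// ltW.
Qed.

Lemma integrable_patch c d f : mu.-integrable `[c, d] (EFin \o f) ->
  mu.-integrable setT (EFin \o (f \_ `[c, d])).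
Proof.
move=> fi; have -> : EFin \o (f \_ `[c, d]) = (EFin \o f) \_ `[c, d].
  by rewrite restrict_EFin.
by apply/(integrable_mkcond _ _).1.
Qed.

Lemma primitive_patch c d f x : x <= d ->
  primitive c (f \_ `[c, d]) x = primitive c f x.
Proof.
move=> xd; apply: eq_Rintegral => t; rewrite inE/= in_itv/= => /andP[ct tx].
by rewrite patchE mem_set//= in_itv/= ct (le_trans tx).
Qed.

Lemma primitiveB c d f u v : mu.-integrable `[c, d] (EFin \o f) ->
  c <= u -> u <= v -> v <= d ->
  primitive c f v - primitive c f u = \int[mu]_(t in `]u, v]) f t.
Proof.
move=> fi cu uv vd; apply: Rintegral_itvB; last 2 first.
- by rewrite bnd_simp.
- by rewrite bnd_simp.
by apply: integrableS fi => //; apply: subset_itvl; rewrite bnd_simp.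
Qed.

Lemma primitive_nondecreasing c d f u v : mu.-integrable `[c, d] (EFin \o f) ->
  (forall t, c <= t -> t <= d -> 0 <= f t) ->
  c <= u -> u <= v -> v <= d -> primitive c f u <= primitive c f v.
Proof.
move=> fi f0 cu uv vd; rewrite -subr_ge0 (primitiveB fi)//.
apply: Rintegral_ge0 => t /=; rewrite in_itv/= => /andP[ut tv].
by apply: f0; [rewrite (le_trans cu)// ltW|exact: le_trans vd].
Qed.

Lemma primitive_lipschitz c d f (M u v : R) : measurable_fun `[c, d] f ->
  (forall t, c <= t -> t <= d -> `|f t| <= M) ->
  c <= u -> u <= v -> v <= d ->
  `|primitive c f v - primitive c f u| <= M * (v - u).
Proof.
move=> mf fM cu uv vd.
have fi : mu.-integrable `[c, d] (EFin \o f).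
  apply: (bounded_integrable_itv (M := M)) => // t /=.
  by rewrite in_itv/= => /andP[ct td]; exact: fM.
rewrite (primitiveB fi)//.
have fi' : mu.-integrable `]u, v] (EFin \o f).
  by apply: integrableS fi => //; apply: subset_itv; rewrite bnd_simp.
apply: le_trans (le_normr_Rintegral _ fi') _ => //.
have -> : M * (v - u) = \int[mu]_(t in `]u, v]) cst M t.
  rewrite Rintegral_cst//= lebesgue_measure_itv/= lte_fin; case: ltP => //= vu.
  by have -> : v = u; [apply/eqP; rewrite eq_le vu uv|rewrite subrr].
apply: le_Rintegral => //=.
- exact: integrable_norm fi'.
- exact: (bounded_integrable_itv (M := `|M|)).
- move=> t; rewrite in_itv/= => /andP[ut tv]; apply: fM.
    by rewrite (le_trans cu)// ltW.
  exact: le_trans vd.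
Qed.

(** [FTC1] is applied with integrability on [[c, y]] for every [y], hence the extension of [f] by
    zero outside [[c, d]]. *)
Lemma primitive_derivable c d f : c <= d -> mu.-integrable `[c, d] (EFin \o f) ->
  {ae mu, forall t, c < t -> t < d ->
    derivable (primitive c f) t 1 /\ derive1 (primitive c f) t = f t}.
Proof.
move=> cd fi; pose f' := f \_ `[c, d].
have fi' := integrable_patch fi.
have lf : locally_integrable setT f'.
  by apply: open_integrable_locally => //; exact: openT.
have fi'' y : mu.-integrable [set` Interval (BLeft c) (BRight y)] (EFin \o f').
  by apply: integrableS fi'.
have := FTC1 fi'' lf; apply: ae_imp => t h ct td.
have [|df dfE] := h; first by rewrite /= lte_fin.
have near_eq : \forall x \near t, primitive c f' x = primitive c f x.
  have tcd : t \in `]c, d[ by rewrite in_itv/= ct td.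
  near=> x; apply: primitive_patch; apply: ltW.
  suff : x \in `]c, d[ by rewrite in_itv/= => /andP[].
  by near: x; exact: near_in_itvoo.
split.
- exact: (near_eq_derivable near_eq).
- have -> : f t = f' t by rewrite /f' patchE mem_set//= in_itv/= !ltW.
  by rewrite -dfE !derive1E; apply/esym/near_eq_derive.
Unshelve. all: by end_near. Qed.

Lemma primitivexx c f : primitive c f c = 0.
Proof. by rewrite /primitive set_itv1 Rintegral_set1. Qed.

(* [g2] is allowed to be non-integrable a priori: its integrability is part of
   the conclusion, through truncation. *)
Lemma ac_on_ftc_le c d F g1 g2 : c <= d -> ac_on c d F ->
  mu.-integrable `[c, d] (EFin \o g1) -> measurable_fun `[c, d] g2 ->
  (forall t, c <= t -> t <= d -> 0 <= g1 t) ->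
  (forall t, c <= t -> t <= d -> 0 <= g2 t) ->
  {ae mu, forall t, c < t -> t < d ->
    derivable F t 1 /\ derive1 F t + g2 t <= g1 t} ->
  ((F d - F c)%:E + \int[mu]_(t in `[c, d]) (g2 t)%:E
    <= \int[mu]_(t in `[c, d]) (g1 t)%:E)%E.
Proof.
move=> cd acF ig1 mg2 g10 g20 dF.
(* A bounded [h] has a Lipschitz primitive, so [F] plus that primitive is absolutely continuous; it
   is compared with the primitive of [g1], which is nondecreasing. *)
have bounded (h : R -> R) (M : R) : measurable_fun `[c, d] h ->
    (forall t, c <= t -> t <= d -> `|h t| <= M) ->
    (forall t, c <= t -> t <= d -> h t <= g2 t) ->
    ((F d - F c)%:E + \int[mu]_(t in `[c, d]) (h t)%:E
      <= \int[mu]_(t in `[c, d]) (g1 t)%:E)%E.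
  move=> mh hM hg2.
  have ih : mu.-integrable `[c, d] (EFin \o h).
    apply: (bounded_integrable_itv (M := M)) => // t /=.
    by rewrite in_itv/= => /andP[? ?]; exact: hM.
  have dG := primitive_derivable cd ig1; have dH := primitive_derivable cd ih.
  have : {ae mu, forall t, c < t -> t < d ->
    [/\ derivable (fun x => F x + primitive c h x) t 1,
        derivable (primitive c g1) t 1 &
        derive1 (fun x => F x + primitive c h x) t <= derive1 (primitive c g1) t]}.
    apply: ae_imp (ae_and dF (ae_and dG dH)) => t [dFt [dGt dHt]] ct td.
    have [{}dFt dFg] := dFt ct td; have [{}dGt dGE] := dGt ct td.
    have [{}dHt dHE] := dHt ct td; split => //; first exact: derivableD.
    rewrite dGE derive1E deriveD// -!derive1E dHE.
    by apply: le_trans dFg; rewrite lerD2l; apply: hg2; exact: ltW.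
  move=> [N [mN N0 NP]].
  have acFH : ac_on c d (fun x => F x + primitive c h x).
    apply: ac_onD => //; apply: (@ac_on_lipschitz _ c d M) => u v cu uv vd.
    exact: (primitive_lipschitz mh).
  have := @ac_on_increment_le _ c d _ (primitive c g1) N cd acFH _ _ _.
  rewrite !primitivexx addr0 subr0 => /(_ _ _ _).
  have -> : (\int[mu]_(t in `[c, d]) (h t)%:E = (primitive c h d)%:E)%E.
    by rewrite /primitive /Rintegral fineK//; exact: integrable_fin_num.
  have -> : (\int[mu]_(t in `[c, d]) (g1 t)%:E = (primitive c g1 d)%:E)%E.
    by rewrite /primitive /Rintegral fineK//; exact: integrable_fin_num.
  rewrite -EFinD lee_fin addrAC; apply.
  - by move=> u v cu uv vd; exact: (primitive_nondecreasing ig1).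
  - by exists N; split.
  - move=> t ct td /(contra_not (NP t)); rewrite /setC/= => nn.
    exact: contrapT nn ct td.
pose h n (t : R) : R := Num.min (g2 t) n%:R.
have mh n : measurable_fun `[c, d] (h n) by exact: measurable_minr.
have h_ge0 n t : c <= t -> t <= d -> 0 <= h n t.
  by move=> ct td; rewrite le_min g20//=.
have le_h n : ((F d - F c)%:E + \int[mu]_(t in `[c, d]) (h n t)%:E
    <= \int[mu]_(t in `[c, d]) (g1 t)%:E)%E.
  apply: (bounded _ n%:R) => // t ct td; last by rewrite ge_min lexx.
  by rewrite ger0_norm ?h_ge0// ge_min lexx orbT.
have -> : (\int[mu]_(t in `[c, d]) (g2 t)%:E =
    limn (fun n => \int[mu]_(t in `[c, d]) (h n t)%:E))%E.
  rewrite -monotone_convergence//=.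
  - apply: eq_integral => t; rewrite inE/= in_itv/= => /andP[ct td].
    apply/esym/cvg_lim => //; apply/cvg_EFin; first by near=> n.
    apply: cvg_near_cst.
    near=> n; rewrite /= /h min_l//; near: n; exact: nbhs_infty_ger.
  - by move=> n; apply/measurable_EFinP; exact: mh.
  - by move=> n t; rewrite in_itv/= => /andP[ct td]; rewrite lee_fin h_ge0.
  - move=> t _ n m nm; rewrite lee_fin le_min2// ler_nat//.
rewrite -leeBrDl//; apply: lime_le.
  apply: ereal_nondecreasing_is_cvgn => n m nm; apply: ge0_le_integral => //=.
  - by move=> t; rewrite in_itv/= => /andP[ct td]; rewrite lee_fin h_ge0.
  - by apply/measurable_EFinP; exact: mh.
  - by apply/measurable_EFinP; exact: mh.
  - by move=> t _; rewrite lee_fin le_min2// ler_nat.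
by near=> n; rewrite leeBrDl.
Unshelve. all: by end_near. Qed.

End FundamentalTheoremIntegral.

(** * Lebesgue measure under affine maps *)

Section AffineChangeOfVariables.
Context {R : realType}.
Notation mu := (@lebesgue_measure R).
Variables (k m : R).
Hypothesis k0 : k != 0.

Definition affine_map : measurableTypeR R -> measurableTypeR R :=
  fun x => k * x + m.

Let nk : 0 < `|k|. Proof. by rewrite normr_gt0. Qed.

Lemma measurable_affine_map : measurable_fun setT affine_map.
Proof. by apply: measurable_funD => //; apply: measurable_funM. Qed.

Lemma affine_map_preimage_ocitv (a b : R) :
  mu (affine_map @^-1` `]a, b]) = ((`|k|^-1)%:E * mu `]a, b]%classic)%E.
Proof.
have -> : mu `]a, b]%classic = (if (a < b)%R then (b - a)%R%:E else 0)%E.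
  by rewrite lebesgue_measure_itv /= lte_fin.
case: (ltgtP k 0) => [kn|kp|ke]; last by move: k0; rewrite ke eqxx.
- have -> : affine_map @^-1` `]a, b] = `[(b - m) / k, (a - m) / k[%classic.
    apply/seteqP; split => x; rewrite /affine_map/= !in_itv/= => /andP[h1 h2].
    + by rewrite ler_ndivrMr// ltr_ndivlMr//; apply/andP; split; lra.
    + move: h1 h2; rewrite ler_ndivrMr// ltr_ndivlMr// => h1 h2.
      by apply/andP; split; lra.
  rewrite lebesgue_measure_itv/= lte_fin ltr_ndivrMr// divfK//.
  rewrite ltrD2r ltr0_norm//; case: ifP => ab; last by rewrite mule0.
  by rewrite -EFinM -EFinB; congr (_%:E); field.
- have -> : affine_map @^-1` `]a, b] = `](a - m) / k, (b - m) / k]%classic.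
    apply/seteqP; split => x; rewrite /affine_map/= !in_itv/= => /andP[h1 h2].
    + by rewrite ler_pdivlMr// ltr_pdivrMr//; apply/andP; split; lra.
    + move: h1 h2; rewrite ler_pdivlMr// ltr_pdivrMr// => h1 h2.
      by apply/andP; split; lra.
  rewrite lebesgue_measure_itv/= lte_fin ltr_pdivrMr// divfK//.
  rewrite ltrD2r gtr0_norm//; case: ifP => ab; last by rewrite mule0.
  by rewrite -EFinM -EFinB; congr (_%:E); field.
Qed.

(** Rescaled by [|k|], the image of Lebesgue measure under the affine map agrees with it on
    half-open intervals, which determine it. *)
Lemma lebesgue_measure_affine (A : set (measurableTypeR R)) : measurable A ->
  mu (affine_map @^-1` A) = ((`|k|^-1)%:E * mu A)%E.
Proof.
move=> mA.
pose M' := mscale (NngNum (ltW nk)) (pushforward mu affine_map).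
pose M := M' measurable_affine_map.
have -> : mu A = M A.
  apply: lebesgue_measure_unique => //=.
  move=> _ [[a b] _ <-]; rewrite /M /M' /mscale/= /pushforward.
  by rewrite affine_map_preimage_ocitv muleA -EFinM divff ?gt_eqF// mul1e.
by rewrite /M /M' /mscale/= /pushforward muleA -EFinM mulVf ?gt_eqF// mul1e.
Qed.

Lemma ae_affine (P : R -> Prop) : {ae mu, forall t, P t} ->
  {ae mu, forall t, P (k * t + m)}.
Proof.
move=> [N [mN N0 PN]]; exists (affine_map @^-1` N); split.
- by rewrite -[X in measurable X]setTI; exact: measurable_affine_map.
- by rewrite [LHS]lebesgue_measure_affine// [X in (_ * X)%E]N0 mule0.
- by move=> t /= Pt; apply: PN.
Qed.

Lemma ge0_integral_affine (D : set R) (f : R -> \bar R) :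
  measurable D -> measurable_fun D f -> (forall x, D x -> (0 <= f x)%E) ->
  (\int[mu]_(x in affine_map @^-1` D) f (k * x + m)%R
   = (`|k|^-1)%:E * \int[mu]_(x in D) f x)%E.
Proof.
move=> mD mf f0.
have nk' : 0 <= `|k|^-1 by rewrite invr_ge0 ltW.
transitivity (\int[pushforward mu affine_map]_(x in D) f x)%E.
  rewrite ge0_integral_pushforward//.
  - exact: measurable_affine_map.
  - by move=> x; rewrite inE; exact: f0.
rewrite -(ge0_integral_mscale mu mD (NngNum nk'))//.
apply: eq_measure_integral => //=; first exact: measurable_affine_map.
by move=> A mA AD; rewrite /mscale/= /pushforward lebesgue_measure_affine.
Qed.

End AffineChangeOfVariables.

(** * The logarithmic mean *)

Section LogarithmicMean.
Context {R : realType}.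
Implicit Types (s t : R).
Notation mu := (@lebesgue_measure R).

Lemma powR_interpolation s t (p : R) : 0 < s -> 0 < t ->
  s `^ (1 - p) * t `^ p = expR (ln s + p * (ln t - ln s)).
Proof.
move=> s0 t0; rewrite /powR !gt_eqF//= -expRD; congr expR; ring.
Qed.

Lemma continuous_expR_affine (a b : R) : continuous (fun p : R => expR (a + p * b)).
Proof.
move=> p; apply: continuous_comp; last exact: continuous_expR.
apply: cvgD; first exact: cvg_cst.
by apply: cvgM; [exact: cvg_id|exact: cvg_cst].
Qed.

Lemma integrable_expR_affine (a b : R) :
  mu.-integrable `[0, 1] (EFin \o (fun p : R => expR (a + p * b))).
Proof.
apply: continuous_compact_integrable; first exact: segment_compact.
by apply: continuous_subspaceT; exact: continuous_expR_affine.
Qed.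

Lemma logmean_posE s t : 0 < s -> 0 < t ->
  logmean s t = (\int[mu]_(p in `[0%R, 1%R]) expR (ln s + p * (ln t - ln s)))%R.
Proof.
by move=> s0 t0; apply: eq_Rintegral => p _; rewrite powR_interpolation.
Qed.

Lemma logmean_ge0 s t : 0 <= logmean s t.
Proof. by apply: Rintegral_ge0 => p _; rewrite mulr_ge0// powR_ge0. Qed.

Lemma logmean0l t : logmean 0 t = 0.
Proof.
rewrite /logmean /Rintegral -integral_itv_bndo_bndc.
  rewrite (_ : integral _ _ _ = 0%E)//; apply: integral0_eq => p /=.
  rewrite in_itv/= => /andP[_ p1]; rewrite powR0 ?mul0r//.
  by rewrite subr_eq0 gt_eqF.
apply: (eq_measurable_fun (cst 0%E)) => //= p; rewrite inE/= in_itv/=.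
by move=> /andP[_ p1]; rewrite powR0 ?mul0r// subr_eq0 gt_eqF.
Qed.

Lemma logmean0r s : logmean s 0 = 0.
Proof.
rewrite /logmean /Rintegral -integral_itv_obnd_cbnd.
  rewrite (_ : integral _ _ _ = 0%E)//; apply: integral0_eq => p /=.
  by rewrite in_itv/= => /andP[p0 _]; rewrite powR0 ?mulr0// gt_eqF.
apply: (eq_measurable_fun (cst 0%E)) => //= p; rewrite inE/= in_itv/=.
by move=> /andP[p0 _]; rewrite powR0 ?mulr0// gt_eqF.
Qed.

Lemma ler_logmean s s' t t' : 0 <= s -> 0 <= t -> s <= s' -> t <= t' ->
  logmean s t <= logmean s' t'.
Proof.
rewrite le_eqVlt => /predU1P[<- _ _ _|s0]; first by rewrite logmean0l logmean_ge0.
rewrite le_eqVlt => /predU1P[<- _ _|t0]; first by rewrite logmean0r logmean_ge0.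
move=> ss tt; have s'0 := lt_le_trans s0 ss; have t'0 := lt_le_trans t0 tt.
rewrite !logmean_posE//; apply: le_Rintegral => //=.
- exact: integrable_expR_affine.
- exact: integrable_expR_affine.
- move=> p; rewrite in_itv/= => /andP[p0 p1].
  rewrite -!powR_interpolation// ler_pM ?powR_ge0// ge0_ler_powR ?subr_ge0//;
  by rewrite ?nnegrE ltW.
Qed.

Lemma logmean_refl s : 0 <= s -> logmean s s = s.
Proof.
rewrite le_eqVlt => /predU1P[<-|s0]; first exact: logmean0l.
rewrite logmean_posE// subrr; under eq_Rintegral do rewrite mulr0 addr0 lnK ?posrE//.
by rewrite Rintegral_cst//= lebesgue_measure_itv/= lte01 sube0 mulr1.
Qed.

Lemma logmeanM (c : R) s t : 0 <= c -> 0 <= s -> 0 <= t ->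
  logmean (c * s) (c * t) = c * logmean s t.
Proof.
rewrite le_eqVlt => /predU1P[<- _ _|c0]; first by rewrite !mul0r logmean0l.
rewrite le_eqVlt => /predU1P[<- _|s0]; first by rewrite mulr0 !logmean0l mulr0.
rewrite le_eqVlt => /predU1P[<-|t0]; first by rewrite mulr0 !logmean0r mulr0.
rewrite !logmean_posE ?mulr_gt0// -RintegralZl//; last exact: integrable_expR_affine.
apply: eq_Rintegral => p _; rewrite !lnM ?posrE//.
rewrite -[X in _ = X * _](lnK (x := c)) ?posrE// -expRD; congr expR; ring.
Qed.

Lemma logmean_neq s t : 0 < s -> 0 < t -> s != t ->
  logmean s t = (t - s) / (ln t - ln s).
Proof.
move=> s0 t0 st; rewrite logmean_posE//; set b := ln t - ln s.
have b0 : b != 0.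
  by rewrite subr_eq0; apply: contra_neq st => /ln_inj; rewrite !posrE => ->.
pose F (p : R) := expR (ln s + p * b) / b.
have dF (p : R) : is_derive p 1 F (expR (ln s + p * b)).
  have -> : F = (fun q => b^-1 * expR (ln s + q * b)).
    by apply/funext => q; rewrite /F mulrC.
  apply: is_derive_eq; rewrite /GRing.scale/=; field => //.
rewrite /Rintegral (@continuous_FTC2 _ _ F 0 1)//.
- rewrite -EFinB/= /F mul0r addr0 mul1r [in X in expR X]/b subrKC.
  by rewrite !lnK ?posrE// -mulrBl.
- by apply: continuous_subspaceT; exact: continuous_expR_affine.
- split.
  + by move=> p _; apply: ex_derive.
  + apply: cvg_at_right_filter; apply: differentiable_continuous.
    by apply/derivable1_diffP; apply: ex_derive.
  + apply: cvg_at_left_filter; apply: differentiable_continuous.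
    by apply/derivable1_diffP; apply: ex_derive.
- by move=> p _; rewrite derive1E; apply: derive_val.
Qed.

(** This identity turns [onsager rho (ln rho)] into [- generator Q rho]: it is why the heat flow is
    the gradient flow of the entropy. *)
Lemma logmean_ln s t : 0 < s -> 0 < t -> logmean s t * (ln t - ln s) = t - s.
Proof.
move=> s0 t0; have [->|st] := eqVneq s t; first by rewrite !subrr mulr0.
rewrite logmean_neq// divfK// subr_eq0.
by apply: contra_neq st => /ln_inj; rewrite !posrE => ->.
Qed.

Lemma logmeanC s t : 0 <= s -> 0 <= t -> logmean s t = logmean t s.
Proof.
rewrite le_eqVlt => /predU1P[<- _|s0]; first by rewrite logmean0l logmean0r.
rewrite le_eqVlt => /predU1P[<-|t0]; first by rewrite logmean0l logmean0r.
have [->//|st] := eqVneq s t.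
rewrite !logmean_neq//; last by rewrite eq_sym.
by rewrite -(opprB s t) -(opprB (ln s)) invrN mulrNN.
Qed.

Lemma logmean_ge s t (m : R) : 0 <= m -> m <= s -> m <= t -> m <= logmean s t.
Proof. by move=> m0 ms mt; rewrite -{1}(logmean_refl m0) ler_logmean. Qed.

Lemma logmean_gt0 s t : 0 < s -> 0 < t -> 0 < logmean s t.
Proof.
move=> s0 t0; apply: (@lt_le_trans _ _ (Num.min s t)); first by rewrite lt_min s0.
by apply: logmean_ge; rewrite ?le_min ?ge_min ?lexx ?orbT// ltW//= ltW.
Qed.

(** Rests on [1 / f = f * exp (- ln (f^2))], where the factor [f] makes both sides vanish at the
    zeros of [f]. *)
Lemma measurable_invr d (T : measurableType d) (D : set T) (f : T -> R) :
  measurable_fun D f -> measurable_fun D (fun x => (f x)^-1).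
Proof.
move=> mf; have -> : (fun x => (f x)^-1) = (fun x => f x * expR (- ln (f x ^+ 2))).
  apply/funext => x; have [->|fx] := eqVneq (f x) 0; first by rewrite mul0r invr0.
  by rewrite expRN lnK ?posrE ?exprn_even_gt0// expr2 invfM mulrA divff// mul1r.
apply: measurable_funM => //; apply: measurableT_comp => //.
apply: measurableT_comp => //; apply: measurableT_comp; first exact: measurable_ln.
exact: measurable_funX.
Qed.

(** Measurability is read off the closed formula, case by case, instead of the parameter
    integral. *)
Lemma measurable_logmean d (T : measurableType d) (D : set T) (f g : T -> R) :
  measurable D -> measurable_fun D f -> measurable_fun D g ->
  (forall x, D x -> 0 <= f x) -> (forall x, D x -> 0 <= g x) ->
  measurable_fun D (fun x => logmean (f x) (g x)).
Proof.
move=> mD mf mg f0 g0.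
apply: (eq_measurable_fun (fun x => if f x * g x == 0 then 0 else
    if f x == g x then f x else (g x - f x) / (ln (g x) - ln (f x)))) => [x|].
  rewrite inE => Dx; have := g0 x Dx; have := f0 x Dx.
  rewrite le_eqVlt => /predU1P[<-|fx]; first by rewrite mul0r eqxx logmean0l.
  rewrite le_eqVlt => /predU1P[<-|gx]; first by rewrite mulr0 eqxx logmean0r.
  rewrite gt_eqF ?mulr_gt0//; case: eqVneq => [<-|fg].
    by rewrite logmean_refl// ltW.
  by rewrite logmean_neq.
have mln (h : T -> R) : measurable_fun D h -> measurable_fun D (fun x => ln (h x)).
  by move=> mh; apply: measurableT_comp => //; exact: measurable_ln.
apply: measurable_fun_if => //.
- by apply: measurable_fun_eqr => //; exact: measurable_funM.
- apply: (measurable_funS mD); first exact: subIsetl.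
  apply: measurable_fun_if => //.
  + exact: measurable_fun_eqr.
  + by apply: measurable_funS mf => //; exact: subIsetl.
  + apply: (measurable_funS mD); first exact: subIsetl.
    apply: measurable_funM; first exact: measurable_funB.
    by apply: measurable_invr; apply: measurable_funB; exact: mln.
Qed.

End LogarithmicMean.

(** * The semigroup *)

Section FiniteSums.
Context {R : realType}.

Lemma cvg_fsum (T : Type) (F : set_system T) {FF : Filter F} (I : Type)
    (s : seq I) (P : pred I) (f : I -> T -> R) (l : I -> R) :
  (forall i, f i x @[x --> F] --> l i) ->
  (\sum_(i <- s | P i) f i x) @[x --> F] --> \sum_(i <- s | P i) l i.
Proof.
move=> fl; elim: s => [|i s ih].
  by under eq_fun do rewrite big_nil; rewrite big_nil; exact: cvg_cst.
under eq_fun do rewrite big_cons; rewrite big_cons; case: (P i) => //.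
by apply: cvgD => //; exact: fl.
Qed.

Lemma is_derive_fsum (I : Type) (s : seq I) (f : I -> R -> R) (df : I -> R)
    (t : R) :
  (forall i, is_derive t 1 (f i) (df i)) ->
  is_derive t 1 (fun t => \sum_(i <- s) f i t) (\sum_(i <- s) df i).
Proof.
move=> dfi; elim: s => [|i s ih].
  by under eq_fun do rewrite big_nil; rewrite big_nil; exact: is_derive_cst.
by under eq_fun do rewrite big_cons; rewrite big_cons; exact: is_deriveD.
Qed.

Lemma is_derive_mulr (f g : R -> R) (df dg t : R) :
  is_derive t 1 f df -> is_derive t 1 g dg ->
  is_derive t 1 (fun t => f t * g t) (df * g t + f t * dg).
Proof.
move=> hf hg; apply: (is_derive_eq (is_deriveM hf hg)).
by rewrite /GRing.scale/=; ring.
Qed.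

Lemma is_derive_comp_affine (f : R -> R) (df k m t : R) :
  is_derive (k * t + m) 1 f df -> is_derive t 1 (fun t => f (k * t + m)) (k * df).
Proof.
move=> hf; have hg : is_derive t 1 (fun t => k * t + m) k.
  by apply: is_derive_eq; rewrite /GRing.scale/=; ring.
by rewrite mulrC; exact: (is_derive1_comp (g := fun t => k * t + m)).
Qed.

End FiniteSums.

(** * The exponential of a finite matrix *)

Section OperatorExponential.
Context {R : realType} {X : finType}.
Implicit Types (a : X -> X -> R) (psi phi : X -> R) (t : R).

Definition kernel_op a psi : X -> R := fun x => \sum_y a x y * psi y.

Definition opexp a t psi : X -> R :=
  fun x => limn (series (fun k => t ^+ k / k`!%:R * iter k (kernel_op a) psi x)).

(** At a fixed point [x] the exponential is a scalar power series in [t] with these coefficients, so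
    it can be differentiated term by term as a [pseries]. *)
Let coef a psi x : nat -> R := fun k => iter k (kernel_op a) psi x / k`!%:R.

Let opexpE a t psi x : opexp a t psi x = limn (pseries (coef a psi x) t).
Proof.
rewrite /opexp /pseries; congr (limn (series _)); apply/funext => k.
by rewrite /coef mulrC mulrA mulrAC.
Qed.

Lemma kernel_opD a psi phi (c : R) :
  kernel_op a (fun x => c * psi x + phi x) =
  (fun x => c * kernel_op a psi x + kernel_op a phi x).
Proof.
apply/funext => x; rewrite /kernel_op mulr_sumr -big_split/=.
by apply: eq_bigr => y _; ring.
Qed.

Lemma iter_kernel_opD a psi phi (c : R) k :
  iter k (kernel_op a) (fun x => c * psi x + phi x) =
  (fun x => c * iter k (kernel_op a) psi x + iter k (kernel_op a) phi x).
Proof. by elim: k => //= k ->; rewrite kernel_opD. Qed.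

Lemma iter_kernel_op_le a psi (N : R) k x : (forall x, `|psi x| <= N) ->
  `|iter k (kernel_op a) psi x| <= (\sum_x \sum_y `|a x y|) ^+ k * N.
Proof.
move=> psiN; elim: k x => [|k ih] x; first by rewrite expr0 mul1r.
rewrite iterS /kernel_op (le_trans (ler_norm_sum _ _ _))//.
apply: (@le_trans _ _ (\sum_y `|a x y| * ((\sum_x \sum_y `|a x y|) ^+ k * N))).
  by apply: ler_sum => y _; rewrite normrM ler_wpM2l.
rewrite -mulr_suml exprS -mulrA ler_wpM2r//.
  by rewrite (le_trans _ (ih x)).
rewrite [leRHS](bigD1 x)//= lerDl; apply: sumr_ge0 => z _; exact: sumr_ge0.
Qed.

Let cvg_coef a psi x t : cvgn (pseries (coef a psi x) t).
Proof.
pose N := \sum_x `|psi x|.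
have psiN y : `|psi y| <= N.
  by rewrite /N (bigD1 y)//= lerDl; exact: sumr_ge0.
pose M := \sum_x \sum_y `|a x y|.
have M0 : 0 <= M by apply: sumr_ge0 => z _; exact: sumr_ge0.
apply: normed_cvg; rewrite /normed_series_of/=.
apply: (@series_le_cvg _ _ (fun k => N * exp_coeff (M * `|t|) k)) => [k|k|k|].
- exact: normr_ge0.
- by rewrite mulr_ge0 ?(sumr_ge0)// exp_coeff_ge0// mulr_ge0.
- rewrite /coef /exp_coeff/= normrM normrM normrX normfV (ger0_norm (ler0n _ _)).
  rewrite exprMn mulrAC mulrA ler_wpM2r ?invr_ge0// (mulrC N) mulrAC ler_wpM2r//.
  exact: iter_kernel_op_le.
- exact/is_cvg_seriesZ/is_cvg_series_exp_coeff.
Qed.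

Let diffs_coef a psi x :
  pseries_diffs (coef a psi x) = coef a (kernel_op a psi) x.
Proof.
apply/funext => k; rewrite /pseries_diffs /coef iterSr factS natrM invfM.
by rewrite mulrCA mulrA mulrA mulfK// mulrC.
Qed.

Lemma is_derive_opexp a psi x t :
  is_derive t 1 (fun t => opexp a t psi x) (opexp a t (kernel_op a psi) x).
Proof.
have -> : (fun t => opexp a t psi x) = (fun t => limn (pseries (coef a psi x) t)).
  by apply/funext => u; exact: opexpE.
rewrite opexpE -diffs_coef; apply: (@pseries_snd_diffs _ _ (`|t| + 1)).
- exact: cvg_coef.
- by rewrite diffs_coef; exact: cvg_coef.
- by rewrite !diffs_coef; exact: cvg_coef.
- by rewrite [ltRHS]ger0_norm ?addr_ge0// ltrDl.
Qed.

Lemma opexpD a t psi phi (c : R) :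
  opexp a t (fun x => c * psi x + phi x) =
  (fun x => c * opexp a t psi x + opexp a t phi x).
Proof.
apply/funext => x; rewrite !opexpE.
have -> : pseries (coef a (fun x => c * psi x + phi x) x) t =
    (fun n => c * pseries (coef a psi x) t n + pseries (coef a phi x) t n).
  apply/funext => n; rewrite /pseries /series/= mulr_sumr -big_split/=.
  by apply: eq_bigr => k _; rewrite /coef iter_kernel_opD; ring.
apply/cvg_lim => //; apply: cvgD; last exact: cvg_coef.
by apply: cvgMr; exact: cvg_coef.
Qed.

Lemma opexp_sum a t (I : Type) (s : seq I) (c : I -> R) (f : I -> X -> R) :
  opexp a t (fun x => \sum_(i <- s) c i * f i x) =
  (fun x => \sum_(i <- s) c i * opexp a t (f i) x).
Proof.
have opexp_0 : opexp a t (fun=> 0) = fun=> 0.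
  apply/funext => x; rewrite opexpE.
  have -> : pseries (coef a (fun=> 0) x) t = fun=> 0.
    apply/funext => n; rewrite /pseries /series/= big1// => k _; rewrite /coef.
    suff -> : iter k (kernel_op a) (fun=> 0) = fun=> 0 by rewrite !mul0r.
    elim: k => //= k ->; apply/funext => y; rewrite /kernel_op big1// => z _.
    by rewrite mulr0.
  exact: lim_cst.
elim: s => [|i s ih].
  rewrite (_ : (fun _ => _) = fun=> 0) ?opexp_0; last first.
    by apply/funext => x; rewrite big_nil.
  by apply/funext => x; rewrite big_nil.
rewrite (_ : (fun _ => _) = (fun x => c i * f i x + \sum_(j <- s) c j * f j x)).
  by rewrite opexpD ih; apply/funext => x; rewrite big_cons.
by apply/funext => x; rewrite big_cons.
Qed.

Lemma opexp0 a psi : opexp a 0 psi = psi.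
Proof.
apply/funext => x; rewrite opexpE; apply/cvg_lim => //.
apply: cvg_near_cst; exists 1%N => // n /= n0; rewrite /pseries /series/=.
rewrite -(prednK n0) big_nat_recl// expr0 mulr1 big1.
  by rewrite addr0 /coef/= fact0 divr1.
by move=> i _; rewrite expr0n/= mulr0.
Qed.

Lemma opexp_kernel_op a t psi :
  opexp a t (kernel_op a psi) = kernel_op a (opexp a t psi).
Proof.
apply/funext => x; rewrite opexpE; apply/cvg_lim => //.
have -> : pseries (coef a (kernel_op a psi) x) t =
    (fun n => \sum_y a x y * pseries (coef a psi y) t n).
  apply/funext => n; rewrite /pseries /series/=.
  under [RHS]eq_bigr do rewrite mulr_sumr.
  rewrite exchange_big/=; apply: eq_bigr => k _.
  rewrite /coef -iterSr iterS {1}/kernel_op !mulr_suml; apply: eq_bigr => y _.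
  ring.
apply: cvg_fsum => y; apply: cvgMr; rewrite opexpE; exact: cvg_coef.
Qed.

Let dirac y : X -> R := fun x => (x == y)%:R.

Lemma opexp_expand a t psi :
  opexp a t psi = (fun x => \sum_y psi y * opexp a t (dirac y) x).
Proof.
rewrite -opexp_sum; congr opexp; apply/funext => x.
by rewrite (bigD1 x)//= /dirac eqxx mulr1 big1 ?addr0// => y yx;
  rewrite eq_sym (negbTE yx) mulr0.
Qed.

(** The function [r |-> opexp a (t - r) (u r)] has derivative zero, and its values at [t] and [0]
    are the two sides. Expanding in the Dirac basis makes the derivative a product rule for scalar
    functions. *)
Lemma opexp_unique a (u : R -> X -> R) t :
  (forall (s : R) x, is_derive s 1 (fun s => u s x) (kernel_op a (u s) x)) ->
  u t = opexp a t (u 0).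
Proof.
move=> du; apply/funext => x.
pose g r := opexp a (t - r) (u r) x.
suff : g t = g 0 by rewrite /g subrr opexp0 subr0.
apply: is_derive_0_is_cst => r.
have -> : g = (fun r => \sum_y u r y * opexp a (- 1 * r + t) (dirac y) x).
  by apply/funext => q; rewrite /g opexp_expand mulN1r addrC.
have dirac_sum f z : \sum_y f y * kernel_op a (dirac y) z = kernel_op a f z.
  rewrite /kernel_op; apply: eq_bigr => y _; rewrite mulrC; congr (_ * _).
  by rewrite (bigD1 y)//= /dirac eqxx mulr1 big1 ?addr0// => w wy;
    rewrite (negbTE wy) mulr0.
have dg y : is_derive r 1 (fun r => u r y * opexp a (- 1 * r + t) (dirac y) x)
    (kernel_op a (u r) y * opexp a (- 1 * r + t) (dirac y) x +
     u r y * (- 1 * opexp a (- 1 * r + t) (kernel_op a (dirac y)) x)).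
  apply: is_derive_mulr => //.
  apply: (is_derive_comp_affine (f := fun t => opexp a t (dirac y) x)).
  exact: is_derive_opexp.
apply: (is_derive_eq (is_derive_fsum _ dg)).
rewrite big_split/= -[X in X + _](congr1 (fun f => f x) (opexp_expand _ _ _)).
under [X in _ + X]eq_bigr do rewrite mulN1r mulrN.
rewrite sumrN -[X in _ - X](congr1 (fun f => f x) (opexp_sum _ _ _ _ _)).
rewrite (_ : (fun _ => _) = kernel_op a (u r)) ?subrr//.
by apply/funext => z; exact: dirac_sum.
Qed.

Lemma opexp_add a s t psi : opexp a (s + t) psi = opexp a s (opexp a t psi).
Proof.
have -> : opexp a t psi = (fun s => opexp a (s + t) psi) 0 by rewrite add0r.
apply: (opexp_unique (u := fun s => opexp a (s + t) psi)) => r x.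
rewrite -opexp_kernel_op.
have -> : (fun s => opexp a (s + t) psi x) = (fun s => opexp a (1 * s + t) psi x).
  by apply/funext => q; rewrite mul1r.
rewrite -[X in is_derive _ _ _ X]mul1r.
apply: (is_derive_comp_affine (f := fun t => opexp a t psi x)).
by rewrite mul1r; exact: is_derive_opexp.
Qed.

Lemma opexp_symmetric a (w : X -> R) t psi phi :
  (forall x y, w x * a x y = w y * a y x) ->
  \sum_x w x * phi x * opexp a t psi x = \sum_x w x * opexp a t phi x * psi x.
Proof.
move=> wa; have sym f g : \sum_x w x * f x * kernel_op a g x =
    \sum_x w x * kernel_op a f x * g x.
  rewrite /kernel_op; under eq_bigr do rewrite mulr_sumr.
  under [RHS]eq_bigr do rewrite mulr_sumr mulr_suml.
  rewrite exchange_big/=; apply: eq_bigr => x _; apply: eq_bigr => y _.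
  by have := wa x y => wxy; transitivity (w y * a y x * f y * g x); [ring|
    rewrite -wxy; ring].
have symk k f g : \sum_x w x * f x * iter k (kernel_op a) g x =
    \sum_x w x * iter k (kernel_op a) f x * g x.
  by elim: k f g => // k ih f g; rewrite iterSr ih sym -iterS.
have cl f g : (fun n => \sum_x w x * f x * pseries (coef a g x) t n) @ \oo -->
    \sum_x w x * f x * opexp a t g x.
  by apply: cvg_fsum => x; apply: cvgMr; rewrite opexpE; exact: cvg_coef.
have h : (fun n => \sum_x w x * phi x * pseries (coef a psi x) t n) =
    (fun n => \sum_x w x * psi x * pseries (coef a phi x) t n).
  apply/funext => n; rewrite /pseries /series/=.
  under eq_bigr do rewrite mulr_sumr; under [RHS]eq_bigr do rewrite mulr_sumr.
  rewrite exchange_big/= [RHS]exchange_big/=; apply: eq_bigr => k _.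
  transitivity ((\sum_x w x * phi x * iter k (kernel_op a) psi x) *
      (t ^+ k / k`!%:R)).
    by rewrite mulr_suml; apply: eq_bigr => x _; rewrite /coef; ring.
  rewrite symk mulr_suml; apply: eq_bigr => x _; rewrite /coef; ring.
have := cl phi psi; rewrite h => l1.
have := cvg_unique _ l1 (cl psi phi) => ->//.
by apply: eq_bigr => x _; rewrite mulrAC.
Qed.

(** All terms of the series are nonnegative, so each bounds the sum from below. The term [k = 0]
    gives positivity of the semigroup, a later one strict positivity. *)
Lemma opexp_ge_term a t psi k x : (forall x y, 0 <= a x y) -> 0 <= t ->
  (forall x, 0 <= psi x) ->
  t ^+ k / k`!%:R * iter k (kernel_op a) psi x <= opexp a t psi x.
Proof.
move=> a0 t0 psi0.
have it0 j y : 0 <= iter j (kernel_op a) psi y.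
  elim: j y => // j ih y; rewrite iterS; apply: sumr_ge0 => z _.
  by rewrite mulr_ge0.
rewrite /opexp; apply: limr_ge.
  have := @cvg_coef a psi x t; rewrite /pseries.
  rewrite (_ : (fun i => _) = (fun k => t ^+ k / k`!%:R *
    iter k (kernel_op a) psi x))//.
  by apply/funext => j; rewrite /coef mulrC mulrA mulrAC.
exists k.+1 => // n /= kn; rewrite /series/= (bigD1_seq k) ?iota_uniq//=.
  by rewrite lerDl; apply: sumr_ge0 => j _; rewrite !mulr_ge0 ?exprn_ge0 ?invr_ge0.
by rewrite mem_index_iota.
Qed.

End OperatorExponential.

(** * Positivity, symmetry and regularity of the Markov semigroup *)

Section MarkovSemigroup.
Context {R : realType} {X : finType}.
Variables (Q : X -> X -> R) (pi : X -> R).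
Hypothesis hQ : reversible_chain Q pi.
Implicit Types (psi phi rho : X -> R) (t s : R).

Definition total_rate : R := \sum_x \sum_y Q x y.

Let a x y := Q x y - (x == y)%:R * \sum_z Q x z.
(** The shift of the diagonal makes all entries of the generator matrix nonnegative, at the price of
    a factor [expR (- total_rate * t)] in the exponential. *)
Let b x y := a x y + (x == y)%:R * total_rate.

Let sum_eq (f : X -> R) x (c : R) : \sum_y (x == y)%:R * c * f y = c * f x.
Proof.
rewrite (bigD1 x)//= eqxx mul1r big1 ?addr0// => y yx.
by rewrite eq_sym (negbTE yx) !mul0r.
Qed.

Let generatorE psi : generator Q psi = kernel_op a psi.
Proof.
apply/funext => x; rewrite /generator /kernel_op /a.
under [RHS]eq_bigr do rewrite mulrBl.
rewrite sumrB sum_eq mulr_suml -sumrB; apply: eq_bigr => y _; ring.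
Qed.

Let semigroupE t psi : semigroup Q t psi = opexp a t psi.
Proof.
rewrite /semigroup /opexp; apply/funext => x; congr (limn (series _)).
by apply/funext => k; have -> : generator Q = kernel_op a by apply/funext.
Qed.

Lemma semigroup0 psi : semigroup Q 0 psi = psi.
Proof. by rewrite semigroupE opexp0. Qed.

Lemma semigroup_add s t psi :
  semigroup Q (s + t) psi = semigroup Q s (semigroup Q t psi).
Proof. by rewrite !semigroupE opexp_add. Qed.

Lemma semigroup_lin t (c : R) psi phi :
  semigroup Q t (fun x => c * psi x + phi x) =
  (fun x => c * semigroup Q t psi x + semigroup Q t phi x).
Proof. by rewrite !semigroupE opexpD. Qed.

Lemma semigroup_generator t psi :
  semigroup Q t (generator Q psi) = generator Q (semigroup Q t psi).
Proof. by rewrite !semigroupE !generatorE opexp_kernel_op. Qed.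

Lemma is_derive_semigroup t psi x :
  is_derive t 1 (fun t => semigroup Q t psi x) (generator Q (semigroup Q t psi) x).
Proof.
rewrite -semigroup_generator semigroupE generatorE.
have -> : (fun t => semigroup Q t psi x) = (fun t => opexp a t psi x).
  by apply/funext => u; rewrite semigroupE.
exact: is_derive_opexp.
Qed.

Lemma continuous_semigroup psi x : continuous (fun t => semigroup Q t psi x).
Proof.
move=> t; apply: differentiable_continuous; apply/derivable1_diffP.
by have [] := is_derive_semigroup t psi x.
Qed.

Definition heat_kernel t x y : R := semigroup Q t (fun z => (z == y)%:R) x.

Lemma semigroup_heat_kernel t psi x :
  semigroup Q t psi x = \sum_y psi y * heat_kernel t x y.
Proof.
rewrite semigroupE opexp_expand; apply: eq_bigr => y _.
by rewrite /heat_kernel semigroupE.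
Qed.

Lemma sum_rate_le x : \sum_y Q x y <= total_rate.
Proof.
rewrite /total_rate [leRHS](bigD1 x)//= lerDl; apply: sumr_ge0 => y _.
by apply: sumr_ge0 => z _; exact: (rates_ge0 hQ).
Qed.

Lemma total_rate_ge0 : 0 <= total_rate.
Proof. by apply: sumr_ge0 => x _; apply: sumr_ge0 => y _; exact: (rates_ge0 hQ). Qed.

Let b_ge0 x y : 0 <= b x y.
Proof.
rewrite /b /a; case: eqVneq => [->|_]; last first.
  by rewrite !mul0r subr0 addr0 (rates_ge0 hQ).
rewrite !mul1r (rates_diag hQ) sub0r addrC subr_ge0; exact: sum_rate_le.
Qed.

Let b_ge_rate x y : Q x y <= b x y.
Proof.
rewrite /b /a; case: eqVneq => [->|_]; last by rewrite !mul0r subr0 addr0.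
by rewrite !mul1r -addrA lerDl addrC subr_ge0; exact: sum_rate_le.
Qed.

Let semigroup_shift t psi :
  semigroup Q t psi = (fun x => expR (- total_rate * t) * opexp b t psi x).
Proof.
rewrite semigroupE; pose u t x := expR (- total_rate * t) * opexp b t psi x.
have -> : psi = u 0 by apply/funext => x; rewrite /u mulr0 expR0 mul1r opexp0.
symmetry; transitivity (u t).
  apply/funext => x; congr (_ * _).
  by congr (opexp b t _ x); apply/funext => y; rewrite /u mulr0 expR0 mul1r opexp0.
apply: opexp_unique => s x.
have de : is_derive s 1 (fun s => expR (- total_rate * s)) (- total_rate * expR (- total_rate * s)).
  have -> : (fun s => expR (- total_rate * s)) = (fun s : R => expR (- total_rate * s + 0)).
    by apply/funext => q; rewrite addr0.
  rewrite -[X in expR X]addr0; exact: is_derive_comp_affine.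
apply: (is_derive_eq (is_derive_mulr de (is_derive_opexp b psi x s))).
rewrite opexp_kernel_op /kernel_op.
have -> : \sum_y b x y * opexp b s psi y =
    \sum_y a x y * opexp b s psi y + total_rate * opexp b s psi x.
  rewrite -[X in _ + X]sum_eq -big_split/=; apply: eq_bigr => y _.
  by rewrite /b mulrDl.
rewrite mulrDr mulr_sumr addrC -addrA -[RHS]addr0; congr (_ + _); last by ring.
by apply: eq_bigr => y _; rewrite /u; ring.
Qed.

Lemma semigroup_ge_expR t psi x : 0 <= t -> (forall y, 0 <= psi y) ->
  expR (- total_rate * t) * psi x <= semigroup Q t psi x.
Proof.
move=> t0 psi0; rewrite semigroup_shift ler_wpM2l ?expR_ge0//.
by have := opexp_ge_term 0 x b_ge0 t0 psi0; rewrite expr0 fact0 divr1 mul1r.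
Qed.

Lemma semigroup_ge0 t psi x : 0 <= t -> (forall y, 0 <= psi y) ->
  0 <= semigroup Q t psi x.
Proof.
move=> t0 psi0; apply: le_trans (semigroup_ge_expR x t0 psi0).
by rewrite mulr_ge0// expR_ge0.
Qed.

Lemma semigroup_gt0 t psi y x : 0 < t -> (forall y, 0 <= psi y) -> 0 < psi y ->
  0 < semigroup Q t psi x.
Proof.
move=> t0 psi0 psiy.
have it0 j z : 0 <= iter j (kernel_op b) psi z.
  elim: j z => // j ih z; rewrite iterS; apply: sumr_ge0 => w _.
  by rewrite mulr_ge0.
(* A path of positive rates from [x] to [y], given by irreducibility, makes some iterate positive at
   [x]. *)
have [k kP] : exists k, 0 < iter k (kernel_op b) psi x.
  have /connectP[p] := rates_irreducible hQ x y.
  elim: p x => [x /= _ <-|z p ih x /= /andP[xz /ih{}ih] /ih[k kP]]; first by exists 0%N.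
  exists k.+1; rewrite iterS /kernel_op (bigD1 z)//= ltr_pwDl//.
    by rewrite mulr_gt0// (lt_le_trans xz).
  by apply: sumr_ge0 => w _; rewrite mulr_ge0.
rewrite semigroup_shift mulr_gt0 ?expR_gt0//.
apply: lt_le_trans (opexp_ge_term k x b_ge0 (ltW t0) psi0).
by rewrite mulr_gt0// divr_gt0 ?exprn_gt0// ltr0n fact_gt0.
Qed.

Lemma semigroup_cst t (c : R) : semigroup Q t (fun=> c) = (fun=> c).
Proof.
rewrite semigroupE; apply/esym/(opexp_unique (u := fun=> fun=> c)) => s x.
rewrite -generatorE /generator; apply: (is_derive_eq (is_derive_cst _ _ _)).
by rewrite big1// => y _; rewrite subrr mul0r.
Qed.

Lemma semigroup_ge t psi (m : R) x : 0 <= t -> (forall y, m <= psi y) ->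
  m <= semigroup Q t psi x.
Proof.
move=> t0 psim; rewrite -subr_ge0 -[X in _ - X](congr1 (fun f => f x) (semigroup_cst t m)).
have -> : semigroup Q t psi x - semigroup Q t (fun=> m) x =
    semigroup Q t (fun y => psi y - m) x.
  have -> : (fun y => psi y - m) = (fun y => -1 * (fun=> m) y + psi y).
    by apply/funext => y; ring.
  by rewrite semigroup_lin; ring.
by apply: semigroup_ge0 => // y; rewrite subr_ge0.
Qed.

Lemma semigroup_le t psi (m : R) x : 0 <= t -> (forall y, psi y <= m) ->
  semigroup Q t psi x <= m.
Proof.
move=> t0 psim; rewrite -lerN2.
have -> : - semigroup Q t psi x = semigroup Q t (fun y => - psi y) x.
  have -> : (fun y => - psi y) = (fun y => -1 * psi y + (fun=> 0) y).
    by apply/funext => y; ring.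
  by rewrite semigroup_lin semigroup_cst; ring.
by apply: semigroup_ge => // y; rewrite lerN2.
Qed.

Lemma semigroup_norm_le t psi (m : R) x : 0 <= t -> (forall y, `|psi y| <= m) ->
  `|semigroup Q t psi x| <= m.
Proof.
move=> t0 psim; rewrite ler_norml semigroup_ge ?semigroup_le// => y.
- by rewrite (le_trans (ler_norm _)).
- by have := psim y; rewrite ler_norml => /andP[].
Qed.

Lemma semigroup_sym t psi phi :
  \sum_x phi x * semigroup Q t psi x * pi x =
  \sum_x semigroup Q t phi x * psi x * pi x.
Proof.
rewrite !semigroupE.
under eq_bigr do rewrite mulrC mulrA; under [RHS]eq_bigr do rewrite mulrC mulrA.
apply: opexp_symmetric => x y; rewrite /a; have [->//|xy] := eqVneq x y.
by rewrite !mul0r !subr0 mulrC (detailed_balance hQ) mulrC.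
Qed.

Lemma semigroup_density t rho : 0 <= t -> density pi rho ->
  density pi (semigroup Q t rho).
Proof.
move=> t0 [rho0 rho1]; split => [x|]; first exact: semigroup_ge0.
rewrite -rho1; transitivity (\sum_x 1 * semigroup Q t rho x * pi x).
  by apply: eq_bigr => x _; rewrite mul1r.
rewrite (semigroup_sym t rho (fun=> 1)) semigroup_cst.
by apply: eq_bigr => x _; rewrite mul1r.
Qed.

Lemma generator_le psi (N : R) x : (forall y, `|psi y| <= N) ->
  `|generator Q psi x| <= 2 * N * total_rate.
Proof.
move=> psiN; rewrite /generator (le_trans (ler_norm_sum _ _ _))//.
have N0 : 0 <= N by rewrite (le_trans _ (psiN x)).
apply: (@le_trans _ _ (\sum_y 2 * N * Q x y)); last first.
  by rewrite -mulr_sumr ler_wpM2l ?mulr_ge0//; exact: sum_rate_le.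
apply: ler_sum => y _; rewrite normrM (ger0_norm (rates_ge0 hQ _ _)).
rewrite ler_wpM2r ?(rates_ge0 hQ)// (le_trans (ler_normB _ _))//.
by rewrite mulr2n mulrDl mul1r lerD.
Qed.

Lemma semigroup_lipschitz psi (N : R) s t x : (forall y, `|psi y| <= N) ->
  0 <= s -> s <= t ->
  `|semigroup Q t psi x - semigroup Q s psi x| <= 2 * N * total_rate * (t - s).
Proof.
move=> psiN s0 st.
have [|c cst ->] := MVT_segment st (fun u _ => is_derive_semigroup u psi x).
  by apply: continuous_subspaceT; exact: continuous_semigroup.
rewrite normrM (ger0_norm (_ : 0 <= t - s)) ?subr_ge0// ler_wpM2r ?subr_ge0//.
apply: generator_le => y; apply: semigroup_norm_le => //.
by move: cst; rewrite in_itv/= => /andP[sc _]; exact: le_trans sc.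
Qed.

Lemma density_le rho x : density pi rho -> rho x <= (pi x)^-1.
Proof.
move=> [rho0 rho1]; rewrite -[leRHS]mul1r ler_pdivlMr ?(stationary_gt0 hQ)//.
rewrite -rho1 (bigD1 x)//= lerDl; apply: sumr_ge0 => y _.
by rewrite mulr_ge0// ltW// (stationary_gt0 hQ).
Qed.

Lemma density_gt0_ex rho : density pi rho -> exists x, 0 < rho x.
Proof.
move=> [rho0 rho1]; apply: contrapT => h; have := oner_neq0 R; rewrite -rho1 big1 ?eqxx// => x _.
have -> : rho x = 0; last by rewrite mul0r.
apply/eqP; rewrite eq_le rho0 andbT leNgt; apply/negP => rx; apply: h.
by exists x.
Qed.

Definition density_bound : R := \sum_x (pi x)^-1.

Lemma density_le_bound rho x : density pi rho -> rho x <= density_bound.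
Proof.
move=> dr; rewrite (le_trans (density_le x dr))// /density_bound (bigD1 x)//= lerDl.
by apply: sumr_ge0 => y _; rewrite invr_ge0 ltW// (stationary_gt0 hQ).
Qed.

Lemma density_bound_ge1 : 1 <= density_bound.
Proof.
have d1 : density pi (fun=> 1).
  by split => //; under eq_bigr do rewrite mul1r; exact: (stationary_sum1 hQ).
by have [x _] := density_gt0_ex d1; exact: (density_le_bound x d1).
Qed.

End MarkovSemigroup.

(** * The Onsager form and its potentials *)

Lemma ler_of_sqr_le (R : realFieldType) (A B C c : R) : 0 < c -> 0 <= A ->
  0 <= C -> c * B <= A -> A ^+ 2 <= B * C -> c * A <= C.
Proof.
move=> c0; rewrite le_eqVlt => /orP[/eqP <- C0 _ _|A0 C0 cB AB].
  by rewrite mulr0.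
rewrite -(ler_pM2l A0) mulrCA -expr2.
apply: (@le_trans _ _ (c * (B * C))); first by rewrite ler_pM2l.
by rewrite mulrA ler_wpM2r.
Qed.

Section WeightedGradient.
Context {R : realType} {X : finType}.
Variables (Q : X -> X -> R) (pi : X -> R).
Hypothesis hQ : reversible_chain Q pi.
Implicit Types (psi phi rho sigma v : X -> R).

Definition gradform rho phi psi : R :=
  2^-1 * \sum_x \sum_y grad phi x y * grad psi x y * rhohat rho x y * Q x y * pi x.

(* The continuity equation reads [rho' = onsager rho psi]. *)
Definition onsager rho psi : X -> R :=
  fun x => - \sum_y (psi y - psi x) * rhohat rho x y * Q x y.

Definition dotp phi psi : R := \sum_x phi x * psi x * pi x.

Lemma gradnorm2E rho psi : gradnorm2 Q pi rho psi = gradform rho psi psi.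
Proof.
by congr (_ * _); apply: eq_bigr => x _; apply: eq_bigr => y _; rewrite expr2.
Qed.

Lemma rhohatC rho x y : (forall x, 0 <= rho x) -> rhohat rho x y = rhohat rho y x.
Proof. by move=> rho0; rewrite /rhohat logmeanC. Qed.

Let weight rho x y := rhohat rho x y * Q x y * pi x.

Let weightC rho x y : (forall x, 0 <= rho x) -> weight rho x y = weight rho y x.
Proof.
move=> rho0; rewrite /weight rhohatC// -!mulrA; congr (_ * _).
exact: (detailed_balance hQ).
Qed.

Let weight_ge0 rho x y : 0 <= weight rho x y.
Proof.
by rewrite /weight !mulr_ge0 ?logmean_ge0 ?(rates_ge0 hQ)// ltW// (stationary_gt0 hQ).
Qed.

Let gradformE rho phi psi : gradform rho phi psi =
  2^-1 * \sum_x \sum_y grad phi x y * grad psi x y * weight rho x y.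
Proof.
by congr (_ * _); apply: eq_bigr => x _; apply: eq_bigr => y _; rewrite /weight !mulrA.
Qed.

(** Discrete integration by parts: detailed balance makes the edge weights symmetric, and exchanging
    the two summation indices doubles the sum. *)
Lemma dotp_onsager rho phi psi : (forall x, 0 <= rho x) ->
  dotp phi (onsager rho psi) = gradform rho phi psi.
Proof.
move=> rho0; rewrite gradformE.
pose S := \sum_x \sum_y phi x * (psi y - psi x) * weight rho x y.
have E1 : dotp phi (onsager rho psi) = - S.
  rewrite /dotp /S -sumrN; apply: eq_bigr => x _.
  rewrite /onsager mulrN mulNr mulr_sumr mulr_suml; congr (- _).
  by apply: eq_bigr => y _; rewrite /weight; ring.
have E2 : \sum_x \sum_y phi y * (psi y - psi x) * weight rho x y = - S.
  rewrite exchange_big/= /S -sumrN; apply: eq_bigr => x _; rewrite -sumrN.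
  by apply: eq_bigr => y _; rewrite (weightC y x)//; ring.
rewrite E1; have -> : \sum_x \sum_y grad phi x y * grad psi x y * weight rho x y =
    \sum_x \sum_y phi y * (psi y - psi x) * weight rho x y - S.
  rewrite /S -sumrB; apply: eq_bigr => x _; rewrite -sumrB.
  by apply: eq_bigr => y _; rewrite /grad; ring.
by rewrite E2; field.
Qed.

Lemma gradformC rho phi psi : gradform rho phi psi = gradform rho psi phi.
Proof.
congr (_ * _); apply: eq_bigr => x _; apply: eq_bigr => y _.
by rewrite (mulrC (grad phi x y)).
Qed.

Lemma gradnorm2_ge0 rho psi : 0 <= gradnorm2 Q pi rho psi.
Proof.
rewrite gradnorm2E gradformE mulr_ge0 ?invr_ge0//.
apply: sumr_ge0 => x _; apply: sumr_ge0 => y _.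
by rewrite mulr_ge0 ?weight_ge0// -expr2 sqr_ge0.
Qed.

Lemma gradnorm2_lin rho (c d : R) phi psi :
  gradnorm2 Q pi rho (fun x => c * phi x + d * psi x) =
  c ^+ 2 * gradnorm2 Q pi rho phi + 2 * c * d * gradform rho phi psi +
  d ^+ 2 * gradnorm2 Q pi rho psi.
Proof.
rewrite !gradnorm2E !gradformE.
rewrite !(mulrCA _ 2^-1) -!mulrDr; congr (_ * _).
rewrite !mulr_sumr -!big_split/=; apply: eq_bigr => x _.
rewrite !mulr_sumr -!big_split/=; apply: eq_bigr => y _.
by rewrite /grad; ring.
Qed.

Lemma gradform_CS rho phi psi : gradform rho phi psi ^+ 2 <=
  gradnorm2 Q pi rho phi * gradnorm2 Q pi rho psi.
Proof.
set A := gradnorm2 _ _ _ phi; set C := gradnorm2 _ _ _ psi; set B := gradform _ _ _.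
have q c d : 0 <= c ^+ 2 * A + 2 * c * d * B + d ^+ 2 * C.
  by rewrite -gradnorm2_lin gradnorm2_ge0.
have : 0 <= C by exact: gradnorm2_ge0.
rewrite le_eqVlt => /predU1P[C0|C0].
(* With [C = 0] the quadratic form is affine in [d]; if [B] were nonzero, the chosen [d] would give
   it the value [-1]. *)
- rewrite -C0 mulr0 le_eqVlt; apply/orP; left; rewrite sqrf_eq0; apply/negP => B0.
  have := q 1 (- (A + 1) / (2 * B)); rewrite -C0 mulr0 addr0 expr1n mul1r.
  have -> : A + 2 * 1 * (- (A + 1) / (2 * B)) * B = -1 by field; apply/negP.
  by move=> ?; lra.
- have := q C (- B).
  have -> : C ^+ 2 * A + 2 * C * (- B) * B + (- B) ^+ 2 * C = C * (A * C - B ^+ 2) by ring.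
  by rewrite pmulr_rge0// subr_ge0.
Qed.

(** The logarithmic mean is monotone and homogeneous of degree one, so a pointwise comparison of
    densities passes to the edge weights. *)
Lemma ler_gradnorm2 rho sigma (c : R) psi : 0 <= c -> (forall x, 0 <= sigma x) ->
  (forall x, c * sigma x <= rho x) ->
  c * gradnorm2 Q pi sigma psi <= gradnorm2 Q pi rho psi.
Proof.
move=> c0 s0 cs; rewrite !gradnorm2E !gradformE mulrCA ler_wpM2l ?invr_ge0//.
rewrite mulr_sumr; apply: ler_sum => x _; rewrite mulr_sumr; apply: ler_sum => y _.
have g0 : 0 <= grad psi x y * grad psi x y by rewrite -expr2 sqr_ge0.
rewrite mulrCA; apply: ler_wpM2l => //.
rewrite /weight !mulrA; apply: ler_wpM2r; first exact: ltW (stationary_gt0 hQ x).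
apply: ler_wpM2r; first exact: rates_ge0 hQ x y.
rewrite /rhohat -logmeanM//; apply: ler_logmean; [exact: mulr_ge0|exact: mulr_ge0|
  exact: cs|exact: cs].
Qed.

Lemma gradnorm2_eq0 rho psi : (forall x, 0 < rho x) ->
  gradnorm2 Q pi rho psi = 0 -> forall x y, psi x = psi y.
Proof.
move=> rho0 /eqP; rewrite gradnorm2E gradformE mulf_eq0 invr_eq0 pnatr_eq0/=.
have term0 x y : 0 <= grad psi x y * grad psi x y * weight rho x y.
  by rewrite mulr_ge0 ?weight_ge0// -expr2 sqr_ge0.
rewrite psumr_eq0 => [/allP h|x _]; last exact: sumr_ge0.
have edge x y : 0 < Q x y -> psi x = psi y.
  move=> xy; have := h x (mem_index_enum x); rewrite psumr_eq0// => /allP.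
  move=> /(_ y (mem_index_enum y)); rewrite /weight !mulf_eq0.
  rewrite (gt_eqF xy) (gt_eqF (stationary_gt0 hQ x)) (gt_eqF (logmean_gt0 _ _))//.
  by rewrite !orbF orbb /grad subr_eq0 => /eqP.
move=> x y; have /connectP[p] := rates_irreducible hQ x y.
elim: p x => [x _ -> //|z p ih x /= /andP[xz zp] lp].
by rewrite (edge _ _ xz); exact: ih.
Qed.

Lemma onsager_ln rho : (forall x, 0 < rho x) ->
  onsager rho (fun x => ln (rho x)) = (fun x => - generator Q rho x).
Proof.
move=> rho0; apply/funext => x; congr (- _); apply: eq_bigr => y _.
by rewrite /rhohat (mulrC _ (logmean _ _)) logmean_ln.
Qed.

Lemma onsager_lin rho (c d : R) phi psi :
  onsager rho (fun x => c * phi x + d * psi x) =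
  (fun x => c * onsager rho phi x + d * onsager rho psi x).
Proof.
apply/funext => x; rewrite /onsager !mulrN -opprD; congr (- _).
by rewrite !mulr_sumr -big_split/=; apply: eq_bigr => y _; ring.
Qed.

Lemma onsager_mean0 rho psi : (forall x, 0 <= rho x) ->
  \sum_x onsager rho psi x * pi x = 0.
Proof.
move=> rho0; transitivity (dotp (fun=> 1) (onsager rho psi)).
  by apply: eq_bigr => x _; rewrite mul1r.
rewrite dotp_onsager// gradformE big1 ?mulr0// => x _; rewrite big1// => y _.
by rewrite /grad subrr !mul0r.
Qed.

(** The cost of a given velocity is dual to the gradient norm, hence monotone in the opposite
    direction. Pairing [psi] with the common velocity gives [gradform] at [sigma], and
    Cauchy-Schwarz there concludes. *)
Lemma dual_gradnorm2_le rho sigma (c : R) phi psi : 0 < c ->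
  (forall x, 0 <= sigma x) -> (forall x, c * sigma x <= rho x) ->
  (forall x, onsager rho psi x = onsager sigma phi x) ->
  c * gradnorm2 Q pi rho psi <= gradnorm2 Q pi sigma phi.
Proof.
move=> c0 s0 cs E.
have rho0 x : 0 <= rho x.
  by apply: le_trans (cs x); apply: mulr_ge0 => //; exact: ltW.
have G : gradnorm2 Q pi rho psi = gradform sigma psi phi.
  rewrite gradnorm2E -(dotp_onsager _ _ rho0) -(dotp_onsager _ _ s0).
  by apply: eq_bigr => x _; rewrite E.
apply: (@ler_of_sqr_le _ _ (gradnorm2 Q pi sigma psi) _ _ c0).
- exact: gradnorm2_ge0.
- exact: gradnorm2_ge0.
- exact: (ler_gradnorm2 psi (ltW c0) s0 cs).
- by rewrite G; exact: gradform_CS.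
Qed.

End WeightedGradient.

Section Determinant.
Context {R : realType} d (T : measurableType d) (D : set T).

Lemma measurable_det n (A : T -> 'M[R]_n) :
  (forall i j, measurable_fun D (fun x => A x i j)) ->
  measurable_fun D (fun x => \det (A x)).
Proof.
move=> mA; rewrite /determinant; apply: measurable_sum => s.
apply: measurable_funM => //; apply: measurable_prod => i _; exact: mA.
Qed.

Lemma measurable_adj n (A : T -> 'M[R]_n) i j :
  (forall i j, measurable_fun D (fun x => A x i j)) ->
  measurable_fun D (fun x => (\adj (A x)) i j).
Proof.
move=> mA; under eq_fun do rewrite mxE; rewrite /cofactor.
apply: measurable_funM => //; apply: measurable_det => k l.
by under eq_fun do rewrite !mxE; exact: mA.
Qed.

End Determinant.

(** * Inverting the Onsager operator *)

Section Potential.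
Context {R : realType} {X : finType}.
Variables (Q : X -> X -> R) (pi : X -> R).
Hypothesis hQ : reversible_chain Q pi.
Implicit Types (psi phi rho sigma v : X -> R).

(* Adding the mean makes the weighted Laplacian invertible without changing it
   on mean-zero functions. *)
Definition onsager_kernel rho (x y : X) : R :=
  (x == y)%:R * (\sum_z rhohat rho x z * Q x z) - rhohat rho x y * Q x y + pi y.

Definition onsager_mx rho : 'M[R]_#|X| :=
  \matrix_(i, j) onsager_kernel rho (enum_val i) (enum_val j).

(** Cramer's formula, chosen because it is visibly measurable in [rho] and [v]. Where the matrix is
    singular the inverse of the determinant is [0], and so is the potential. *)
Definition potential rho v : X -> R := fun x =>
  (\det (onsager_mx rho))^-1 *
  \sum_y \adj (onsager_mx rho) (enum_rank x) (enum_rank y) * v y.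

Lemma onsager_kernelE rho psi x :
  \sum_y onsager_kernel rho x y * psi y = onsager Q rho psi x + \sum_y psi y * pi y.
Proof.
under eq_bigr do rewrite /onsager_kernel mulrDl mulrBl.
rewrite big_split/= sumrB; congr (_ + _); last first.
  by apply: eq_bigr => y _; rewrite mulrC.
rewrite (bigD1 x)//= eqxx mul1r [X in _ + X - _]big1 ?addr0; last first.
  by move=> y yx; rewrite eq_sym (negbTE yx) !mul0r.
rewrite mulr_suml -sumrB /onsager -sumrN; apply: eq_bigr => y _; ring.
Qed.

(** Integrating the kernel equation against [pi] shows that the mean vanishes; then so does the
    gradient norm, the vector is constant, and its mean being zero it is zero. The transpose is
    there because [det0P] yields a row vector. *)
Lemma det_onsager_mx_neq0 rho : (forall x, 0 < rho x) ->
  \det (onsager_mx rho) != 0.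
Proof.
move=> rho0; rewrite -det_tr; apply/negP => /det0P[w w0 wM].
pose psi x := w 0 (enum_rank x).
have K0 x : onsager Q rho psi x + \sum_y psi y * pi y = 0.
  transitivity ((w *m (onsager_mx rho)^T) 0 (enum_rank x)); last by rewrite wM mxE.
  rewrite mxE -onsager_kernelE (reindex_onto enum_val enum_rank) => [|y _]; last first.
    by rewrite enum_rankK.
  apply: eq_big => [i|i _]; first by rewrite enum_valK eqxx.
  by rewrite !mxE enum_rankK /psi enum_valK mulrC.
have ge0 x : 0 <= rho x by exact: ltW.
have m0 : \sum_y psi y * pi y = 0.
  have := onsager_mean0 hQ psi ge0.
  have -> : \sum_x onsager Q rho psi x * pi x = - \sum_y psi y * pi y.
    rewrite -[RHS]mulr1 -(stationary_sum1 hQ) mulr_sumr; apply: eq_bigr => x _.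
    by congr (_ * _); apply/eqP; rewrite -addr_eq0 K0.
  by move=> /eqP; rewrite oppr_eq0 => /eqP.
have {}K0 x : onsager Q rho psi x = 0 by rewrite -(K0 x) m0 addr0.
have cst : forall x y, psi x = psi y.
  apply: (gradnorm2_eq0 hQ rho0); rewrite gradnorm2E -(dotp_onsager hQ _ _ ge0).
  by rewrite /dotp big1// => x _; rewrite K0 mulr0 mul0r.
have psi0 x : psi x = 0.
  rewrite -m0 -[LHS]mulr1 -(stationary_sum1 hQ) mulr_sumr.
  by apply: eq_bigr => y _; rewrite (cst x y).
move/eqP: w0; apply; apply/rowP => i; rewrite mxE.
by rewrite -(psi0 (enum_val i)) /psi enum_valK.
Qed.

Lemma onsager_potential rho v : (forall x, 0 < rho x) -> \sum_x v x * pi x = 0 ->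
  forall x, onsager Q rho (potential rho v) x = v x.
Proof.
move=> rho0 v0.
have D0 := det_onsager_mx_neq0 rho0.
have ge0 x : 0 <= rho x by exact: ltW.
have Mv x : \sum_y onsager_kernel rho x y * potential rho v y = v x.
  have := congr1 (fun A : 'M[R]_#|X| => A *m \col_j v (enum_val j)) (mul_mx_adj (onsager_mx rho)).
  rewrite -mulmxA mul_scalar_mx => /(congr1 (fun A : 'cV[R]_#|X| => A (enum_rank x) 0)).
  rewrite !mxE enum_rankK => E.
  rewrite -[RHS](mulKf D0) -E mulr_sumr (reindex_onto enum_val enum_rank)/= => [|y _]; last first.
    by rewrite enum_rankK.
  apply: eq_big => [i|i _]; first by rewrite enum_valK eqxx.
  rewrite !mxE enum_rankK /potential mulrCA; congr (_ * (_ * _)).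
  rewrite (reindex_onto enum_val enum_rank)/= => [|y _]; last by rewrite enum_rankK.
  apply: eq_big => [j|j _]; first by rewrite enum_valK eqxx.
  by rewrite !enum_valK !mxE.
(* The solution inherits mean zero from [v], so the mean added to the Laplacian disappears. *)
have m0 : \sum_y potential rho v y * pi y = 0.
  have : \sum_x (\sum_y onsager_kernel rho x y * potential rho v y) * pi x = 0.
    by under eq_bigr do rewrite Mv.
  under eq_bigr do rewrite onsager_kernelE mulrDl.
  rewrite big_split/= (onsager_mean0 hQ _ ge0) add0r -mulr_sumr (stationary_sum1 hQ).
  by rewrite mulr1.
by move=> x; rewrite -(Mv x) onsager_kernelE m0 addr0.
Qed.

Lemma measurable_potential d (T : measurableType d) (D : set T)
    (rho v : T -> X -> R) x : measurable D ->
  (forall x, measurable_fun D (fun s => rho s x)) ->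
  (forall s x, D s -> 0 <= rho s x) ->
  (forall x, measurable_fun D (fun s => v s x)) ->
  measurable_fun D (fun s => potential (rho s) (v s) x).
Proof.
move=> mD mrho rho0 mv.
have mhat y z : measurable_fun D (fun s => rhohat (rho s) y z).
  by apply: measurable_logmean => // s; exact: rho0.
have mM i j : measurable_fun D (fun s => onsager_mx (rho s) i j).
  under eq_fun do rewrite mxE; rewrite /onsager_kernel.
  apply: measurable_funD => //; apply: measurable_funB; last exact: measurable_funM.
  apply: measurable_funM => //; apply: measurable_sum => z.
  exact: measurable_funM.
apply: measurable_funM; first by apply: measurable_invr; exact: measurable_det.
apply: measurable_sum => y; apply: measurable_funM => //.
exact: measurable_adj.
Qed.

Lemma potential_bound rho : exists C : R, forall v (N : R) x,
  (forall y, `|v y| <= N) -> `|potential rho v x| <= C * N.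
Proof.
pose C0 := `|(\det (onsager_mx rho))^-1|.
pose C1 x := \sum_y `|\adj (onsager_mx rho) (enum_rank x) (enum_rank y)|.
exists (C0 * \sum_x C1 x) => v N x vN.
have N0 : 0 <= N by rewrite (le_trans _ (vN x)).
rewrite /potential normrM -mulrA ler_wpM2l//.
apply: (@le_trans _ _ (C1 x * N)); last first.
  rewrite ler_wpM2r// (bigD1 x)//= lerDl; apply: sumr_ge0 => y _; exact: sumr_ge0.
rewrite /C1 mulr_suml (le_trans (ler_norm_sum _ _ _))//; apply: ler_sum => y _.
by rewrite normrM ler_wpM2l.
Qed.

End Potential.

(** * Curves and the transport distance *)

Section Curves.
Context {R : realType} {X : finType}.
Variables (Q : X -> X -> R) (pi : X -> R).
Hypothesis hQ : reversible_chain Q pi.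
Notation mu := (@lebesgue_measure R).
Implicit Types (rho psi : R -> X -> R) (r : X -> R) (c d : R).

(** The equation is imposed at interior times only: derivatives are two-sided and would look outside
    [[c, d]], which matters when curves are glued. *)
Definition curve_on c d rho psi : Prop :=
  [/\ (forall t, c <= t -> t <= d -> density pi (rho t)),
      (forall x, ac_on c d (fun t => rho t x)),
      (forall x, measurable_fun `[c, d] (fun t => psi t x)) &
      {ae mu, forall t, c < t -> t < d -> forall x,
        is_derive t 1 (fun s => rho s x) (onsager Q (rho t) (psi t) x)}].

Definition action_on c d rho psi : \bar R :=
  (\int[mu]_(t in `[c, d]) (gradnorm2 Q pi (rho t) (psi t))%:E)%E.

Definition joinable (r0 r1 : X -> R) (A : R) : Prop := exists rho psi,
  [/\ curve_on 0 1 rho psi, rho 0 = r0, rho 1 = r1 &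
      (action_on 0 1 rho psi <= A%:E)%E].

Lemma ae_neq (c : R) : {ae mu, forall t : R, t != c}.
Proof.
exists [set c]; split => //; first exact: lebesgue_measure_set1.
by move=> t /= /negP; rewrite negbK => /eqP.
Qed.

Lemma curve_on_admissible rho psi : curve_on 0 1 rho psi ->
  admissible Q pi (rho 0) (rho 1) rho psi.
Proof.
move=> [rhoP ac mpsi ce]; split => //.
  by move=> t; rewrite in_itv/= => /andP[]; exact: rhoP.
apply: ae_imp (ae_and ce (ae_and (ae_neq 0) (ae_neq 1))) => t [h [t0 t1]].
rewrite in_itv/= !le_eqVlt eq_sym (negbTE t0) (negbTE t1)/= => /andP[t00 t11] x.
have [dr drE] := h t00 t11 x; split=> //.
by rewrite derive1E drE /onsager addNr.
Qed.

Lemma admissible_curve_on rho psi (r0 r1 : X -> R) : admissible Q pi r0 r1 rho psi ->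
  curve_on 0 1 rho psi.
Proof.
move=> [rhoP ac _ mpsi ce]; split => //.
  by move=> t t0 t1; apply: rhoP; rewrite in_itv/= t0 t1.
apply: ae_imp ce => t h t0 t1 x.
have [|dr drE] := h _ x; first by rewrite in_itv/= !ltW.
apply: DeriveDef => //; rewrite -derive1E; apply/eqP.
by rewrite -subr_eq0 opprK drE.
Qed.

Lemma measurable_curve c d rho psi x : curve_on c d rho psi ->
  measurable_fun `[c, d] (fun t => rho t x).
Proof.
move=> [_ ac _ _]; apply: subspace_continuous_measurable_fun => //.
exact/ac_on_continuous/ac.
Qed.

Lemma measurable_gradnorm2 (disp : measure_display) (T : measurableType disp) (D : set T)
    (rho psi : T -> X -> R) : measurable D ->
  (forall x, measurable_fun D (fun s => rho s x)) ->
  (forall s x, D s -> 0 <= rho s x) ->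
  (forall x, measurable_fun D (fun s => psi s x)) ->
  measurable_fun D (fun s => gradnorm2 Q pi (rho s) (psi s)).
Proof.
move=> mD mrho rho0 mpsi; rewrite /gradnorm2; apply: measurable_funM => //.
apply: measurable_sum => x; apply: measurable_sum => y.
do 2 (apply: measurable_funM => //); apply: measurable_funM.
  by apply: measurable_funX; exact: measurable_funB.
by apply: measurable_logmean => // s Ds; exact: rho0.
Qed.

Lemma measurable_curve_gradnorm2 c d rho psi : curve_on c d rho psi ->
  measurable_fun `[c, d] (fun t => gradnorm2 Q pi (rho t) (psi t)).
Proof.
move=> cv; apply: measurable_gradnorm2 => //.
- by move=> x; exact: measurable_curve cv.
- case: cv => rhoP _ _ _ t x /=; rewrite in_itv/= => /andP[ct td].
  by have [] := rhoP t ct td.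
- by case: cv.
Qed.

Lemma curve_onW c d c' d' rho psi : c <= c' -> d' <= d ->
  curve_on c d rho psi -> curve_on c' d' rho psi.
Proof.
move=> cc dd [rhoP ac mpsi ce]; split.
- by move=> t ct td; apply: rhoP; [exact: le_trans ct|exact: le_trans dd].
- by move=> x; apply: ac_onW (ac x).
- move=> x; apply: measurable_funS (mpsi x) => //.
  by apply: subset_itv; rewrite bnd_simp.
- apply: ae_imp ce => t h ct td; apply: h; [exact: le_lt_trans ct|exact: lt_le_trans dd].
Qed.

Lemma onsagerZ r (k : R) (phi : X -> R) x :
  onsager Q r (fun y => k * phi y) x = k * onsager Q r phi x.
Proof.
rewrite /onsager mulrN mulr_sumr; congr (- _); apply: eq_bigr => y _; ring.
Qed.

Lemma gradnorm2Z r (k : R) (phi : X -> R) :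
  gradnorm2 Q pi r (fun y => k * phi y) = k ^+ 2 * gradnorm2 Q pi r phi.
Proof.
rewrite /gradnorm2 mulrCA; congr (_ * _); rewrite mulr_sumr; apply: eq_bigr => x _.
by rewrite mulr_sumr; apply: eq_bigr => y _; rewrite /grad; ring.
Qed.

Lemma affine_itv (k m c d c' d' : R) : k != 0 -> c <= d ->
  (0 < k -> c' = k * c + m /\ d' = k * d + m) ->
  (k < 0 -> c' = k * d + m /\ d' = k * c + m) ->
  forall t, ((c' <= k * t + m <= d') = (c <= t <= d)) *
            ((c' < k * t + m < d') = (c < t < d)).
Proof.
move=> k0 cd kp kn t; case: (ltgtP k 0) => [k0'|k0'|ke]; last by rewrite ke eqxx in k0.
- have [-> ->] := kn k0'.
  by split; rewrite ?lerD2r ?ltrD2r ?(ler_nM2l k0') ?(ltr_nM2l k0') andbC.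
- have [-> ->] := kp k0'.
  by split; rewrite ?lerD2r ?ltrD2r ?(ler_pM2l k0') ?(ltr_pM2l k0').
Qed.

Lemma ge0_integral_affine_itv (k m c d c' d' : R) (f : R -> R) :
  k != 0 -> c <= d ->
  (0 < k -> c' = k * c + m /\ d' = k * d + m) ->
  (k < 0 -> c' = k * d + m /\ d' = k * c + m) ->
  measurable_fun `[c', d'] f -> (forall t, 0 <= f t) ->
  (\int[mu]_(t in `[c, d]) (k ^+ 2 * f (k * t + m))%:E =
   `|k|%:E * \int[mu]_(t in `[c', d']) (f t)%:E)%E.
Proof.
move=> k0 cd kp kn mf f0; have itvE := affine_itv k0 cd kp kn.
have preE : affine_map k m @^-1` `[c', d'] = `[c, d]%classic.
  by apply/seteqP; split => t /=; rewrite !in_itv/= (itvE t).1.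
under eq_integral do rewrite EFinM.
rewrite ge0_integralZl//.
- rewrite -preE (ge0_integral_affine m k0 (f := fun t => (f t)%:E))//.
  + rewrite muleA -EFinM -[k ^+ 2]real_normK ?num_real// expr2.
    by rewrite -mulrA divff ?mulr1// normr_eq0.
  + exact/measurable_EFinP.
  + by move=> t _; rewrite lee_fin.
- apply/measurable_EFinP.
  apply: (@measurable_comp _ _ _ _ _ _ `[c', d']) mf _ => //.
    by move=> _ [t /= + <-]; rewrite !in_itv/= => tcd; rewrite (itvE t).1.
  by apply: measurable_funTS; exact: measurable_affine_map.
- by move=> t _; rewrite lee_fin.
- by rewrite lee_fin sqr_ge0.
Qed.

(** The potential is multiplied by [k], so the action density by [k ^+ 2], and the change of
    variables gives back [1 / |k|]. A negative [k] reverses time. *)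
Lemma curve_on_affine (k m c d c' d' : R) rho psi : k != 0 -> c <= d ->
  (0 < k -> c' = k * c + m /\ d' = k * d + m) ->
  (k < 0 -> c' = k * d + m /\ d' = k * c + m) ->
  curve_on c' d' rho psi ->
  curve_on c d (fun t => rho (k * t + m)) (fun t x => k * psi (k * t + m) x) /\
  action_on c d (fun t => rho (k * t + m)) (fun t x => k * psi (k * t + m) x) =
    (`|k|%:E * action_on c' d' rho psi)%E.
Proof.
move=> k0 cd kp kn cv; have itvE := affine_itv k0 cd kp kn.
have mg := measurable_curve_gradnorm2 cv.
have preE : affine_map k m @^-1` `[c', d'] = `[c, d]%classic.
  by apply/seteqP; split => t /=; rewrite !in_itv/= (itvE t).1.
case: cv => [rhoP ac mpsi ce]; split; [split|].
- move=> t ct td; have := (itvE t).1; rewrite ct td/= => /andP[? ?]; exact: rhoP.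
- move=> x; apply: ac_on_affine (ac x) _ => t ct td.
  by rewrite (itvE t).1 ct td.
- move=> x; apply: measurable_funM => //.
  apply: (@measurable_comp _ _ _ _ _ _ `[c', d']) (mpsi x) _ => //.
    move=> _ [t /= + <-]; rewrite !in_itv/= => tcd.
    by rewrite (itvE t).1.
  by apply: measurable_funTS; exact: measurable_affine_map.
- apply: ae_imp (ae_affine m k0 ce) => t h ct td x.
  have := (itvE t).2; rewrite ct td/= => /andP[ct' td'].
  rewrite onsagerZ; apply: (is_derive_comp_affine (f := fun s => rho s x)).
  exact: h.
- rewrite /action_on; under eq_integral do rewrite gradnorm2Z.
  apply: (ge0_integral_affine_itv (f := fun t => gradnorm2 Q pi (rho t) (psi t)) k0 cd kp kn mg).
  by move=> t; exact: gradnorm2_ge0.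
Qed.

Lemma joinable_sub c d rho psi (A : R) : c < d -> curve_on c d rho psi ->
  (action_on c d rho psi <= A%:E)%E -> joinable (rho c) (rho d) ((d - c) * A).
Proof.
move=> cd cv cA; have dc0 : d - c != 0 by rewrite subr_eq0 gt_eqF.
have dcp : 0 < d - c by rewrite subr_gt0.
have [|H|cv' aE] := curve_on_affine (m := c) (c := 0) (d := 1) dc0 ler01 _ _ cv.
- by rewrite mulr0 add0r mulr1 subrK.
- by move: H; rewrite ltNge (ltW dcp).
- exists (fun t => rho ((d - c) * t + c)),
    (fun t x => (d - c) * psi ((d - c) * t + c) x); split.
  + exact: cv'.
  + by rewrite mulr0 add0r.
  + by rewrite mulr1 subrK.
  + by rewrite aE gtr0_norm// EFinM lee_pmul2l// lte_fin.
Qed.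

Lemma joinable_sym (r0 r1 : X -> R) (A : R) : joinable r0 r1 A -> joinable r1 r0 A.
Proof.
move=> [rho [psi [cv <- <- aA]]].
have n10 : (-1 : R) != 0 by rewrite oppr_eq0 oner_eq0.
have [H||cv' aE] := curve_on_affine (m := 1) (c := 0) (d := 1) n10 ler01 _ _ cv.
- by move: H; rewrite ltNge lerN10.
- by rewrite mulr1 mulr0 add0r addNr.
- exists (fun t => rho (-1 * t + 1)), (fun t x => -1 * psi (-1 * t + 1) x).
  split; first exact: cv'.
  + by rewrite mulr0 add0r.
  + by rewrite mulr1 addNr.
  + by rewrite aE normrN1 mul1e.
Qed.

Lemma joinable_refl (r0 : X -> R) : density pi r0 -> joinable r0 r0 0.
Proof.
move=> dr; exists (fun=> r0), (fun=> fun=> 0); split; [|by []|by []|].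
- split; [by []| |by []|].
  + by move=> x; exact: ac_on_cst.
  + apply: (@aeW _ _ _ mu) => t _ _ x; rewrite /onsager big1 ?oppr0.
      exact: is_derive_cst.
    by move=> y _; rewrite addr0 !mul0r.
- rewrite /action_on integral0_eq// => t _; rewrite gradnorm2E /gradform big1 ?mulr0//.
  by move=> x _; rewrite big1// => y _; rewrite /grad subrr !mul0r.
Qed.

Lemma joinable_weaken (r0 r1 : X -> R) (A B : R) : A <= B ->
  joinable r0 r1 A -> joinable r0 r1 B.
Proof.
move=> AB [rho [psi [cv r0E r1E aA]]]; exists rho, psi; split; [exact: cv|exact: r0E|exact: r1E|].
by apply: le_trans aA _; rewrite lee_fin.
Qed.

Lemma joinable_ge0 (r0 r1 : X -> R) (A : R) : joinable r0 r1 A -> 0 <= A.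
Proof.
move=> [rho [psi [_ _ _ aA]]]; rewrite -lee_fin; apply: le_trans aA.
by apply: integral_ge0 => t _; rewrite lee_fin gradnorm2_ge0.
Qed.

Lemma action_on_obnd c d rho psi : curve_on c d rho psi ->
  (action_on c d rho psi =
   \int[mu]_(t in `]c, d]) (gradnorm2 Q pi (rho t) (psi t))%:E)%E.
Proof.
move=> cv; apply/esym/integral_itv_obnd_cbnd; apply/measurable_EFinP.
by apply/measurable_fun_itv_obnd_cbndP; exact: measurable_curve_gradnorm2 cv.
Qed.

Lemma curve_on_glue c m d rho psi : c <= m -> m <= d ->
  curve_on c m rho psi -> curve_on m d rho psi ->
  curve_on c d rho psi /\
  (action_on c d rho psi = action_on c m rho psi + action_on m d rho psi)%E.
Proof.
move=> cm md cl cr.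
have cdE : `[c, d]%classic = `[c, m]%classic `|` `]m, d]%classic.
  by rewrite (@itv_bndbnd_setU _ _ _ (BRight m)) ?bnd_simp.
have mgl := measurable_curve_gradnorm2 cl.
have mgr := measurable_curve_gradnorm2 cr.
have mgr' : measurable_fun `]m, d] (fun t => gradnorm2 Q pi (rho t) (psi t)).
  exact/measurable_fun_itv_obnd_cbndP.
case: cl cr => [rhoP ac mpsi ce] [rhoP' ac' mpsi' ce']; split.
- split.
  + by move=> t ct td; have [tm|/ltW mt] := leP t m; [exact: rhoP|exact: rhoP'].
  + by move=> x; exact: ac_on_glue (ac x) (ac' x).
  + move=> x; rewrite cdE; apply/measurable_funU => //; split; first exact: mpsi.
    apply/measurable_fun_itv_obnd_cbndP; exact: mpsi'.
  + apply: ae_imp (ae_and ce (ae_and ce' (ae_neq m))) => t [h [h' tm]] ct td x.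
    case: (ltgtP t m) tm => // tm _; [exact: h|exact: h'].
- rewrite /action_on cdE ge0_integral_setU//=.
  + by congr (_ + _)%E; apply: integral_itv_obnd_cbnd; exact/measurable_EFinP.
  + apply/measurable_funU => //; split; exact/measurable_EFinP.
  + by move=> t _; rewrite lee_fin gradnorm2_ge0.
  + apply/disj_setPRL => t /=; rewrite !in_itv/= => /andP[mt _] /andP[_].
    by rewrite leNgt mt.
Qed.

(** The first curve runs during [[0, l]] and the second during [[l, 1]]; squeezing unit time to
    length [l] divides the action by [l]. *)
Lemma joinable_trans (r0 r1 r2 : X -> R) (A B l : R) : 0 < l -> l < 1 ->
  joinable r0 r1 A -> joinable r1 r2 B -> joinable r0 r2 (A / l + B / (1 - l)).
Proof.
move=> l0 l1 [u [f [cu u0 u1 uA]]] [v [g [cv v0 v1 vB]]].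
have l1' : 0 < 1 - l by rewrite subr_gt0.
have il0 : 0 < l^-1 by rewrite invr_gt0.
have il1 : 0 < (1 - l)^-1 by rewrite invr_gt0.
have [|H|cu' uE] := curve_on_affine (m := 0) (c := 0) (d := l) (lt0r_neq0 il0) (ltW l0) _ _ cu.
- by rewrite mulr0 mulVf ?gt_eqF// !addr0.
- by move: H; rewrite ltNge (ltW il0).
have [|H|cv' vE] := curve_on_affine (m := - l / (1 - l)) (c := l) (d := 1) (lt0r_neq0 il1) (ltW l1) _ _ cv.
- move=> _; split; first by rewrite mulrC mulNr subrr.
  by rewrite mulr1 mulNr -[X in X - _]mul1r -mulrBl divff// gt_eqF.
- by move: H; rewrite ltNge (ltW il1).
pose rho t := if t <= l then u (l^-1 * t + 0) else v ((1 - l)^-1 * t + - l / (1 - l)).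
pose psi t x := if t <= l then l^-1 * f (l^-1 * t + 0) x
  else (1 - l)^-1 * g ((1 - l)^-1 * t + - l / (1 - l)) x.
have rhoL t : t <= l -> rho t = u (l^-1 * t + 0) by rewrite /rho => ->.
have psiL t : t <= l -> psi t = (fun x => l^-1 * f (l^-1 * t + 0) x).
  by move=> tl; apply/funext => x; rewrite /psi tl.
have rhoR t : l <= t -> rho t = v ((1 - l)^-1 * t + - l / (1 - l)).
  rewrite /rho le_eqVlt => /predU1P[<-|]; last by rewrite ltNge => /negbTE ->.
  by rewrite lexx addr0 mulVf ?gt_eqF// u1 mulrC mulNr subrr v0.
have psiR t : l < t -> psi t = (fun x => (1 - l)^-1 * g ((1 - l)^-1 * t + - l / (1 - l)) x).
  by rewrite ltNge => /negbTE lt; apply/funext => x; rewrite /psi lt.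
have {}cu : curve_on 0 l rho psi.
  case: cu' => rhoP ac mpsi ce; split.
  - by move=> t t0 tl; rewrite rhoL//; exact: rhoP.
  - by move=> x; apply: eq_ac_on (ac x) => t t0 tl; rewrite rhoL.
  - move=> x; apply: eq_measurable_fun (mpsi x) => t; rewrite inE/= in_itv/=.
    by move=> /andP[_ tl]; rewrite psiL.
  - apply: ae_imp ce => t h t0 tl x; rewrite rhoL ?psiL ?ltW//.
    apply: near_eq_is_derive (h t0 tl x).
    by near=> s; rewrite rhoL// ltW//; near: s; exact: lt_nbhsl.
have {}cv : curve_on l 1 rho psi.
  case: cv' => rhoP ac mpsi ce; split.
  - by move=> t t0 tl; rewrite rhoR//; exact: rhoP.
  - by move=> x; apply: eq_ac_on (ac x) => t t0 tl; rewrite rhoR.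
  - move=> x; apply/measurable_fun_itv_obnd_cbndP.
    apply: (eq_measurable_fun (fun t => (1 - l)^-1 * g ((1 - l)^-1 * t + - l / (1 - l)) x)).
      by move=> t; rewrite inE/= in_itv/= => /andP[tl _]; rewrite psiR.
    by apply: measurable_funS (mpsi x) => //; apply: subset_itvr; rewrite bnd_simp.
  - apply: ae_imp ce => t h t0 tl x; rewrite rhoR ?psiR ?ltW//.
    apply: near_eq_is_derive (h t0 tl x).
    by near=> s; rewrite rhoR// ltW//; near: s; exact: lt_nbhsr.
have [c01 aE] := curve_on_glue (ltW l0) (ltW l1) cu cv.
exists rho, psi; split; first exact: c01.
- by rewrite rhoL ?ltW// mulr0 addr0.
- by rewrite rhoR ?ltW// mulr1 mulNr -[X in X - _]mul1r -mulrBl divff// gt_eqF.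
rewrite aE EFinD; apply: leeD.
- have -> : action_on 0 l rho psi =
      action_on 0 l (fun t => u (l^-1 * t + 0)) (fun t x => l^-1 * f (l^-1 * t + 0) x).
    apply: eq_integral => t; rewrite inE/= in_itv/= => /andP[_ tl].
    by rewrite rhoL ?psiL.
  rewrite uE gtr0_norm// mulrC EFinM; apply: lee_wpmul2l => //.
  by rewrite lee_fin ltW.
- have -> : action_on l 1 rho psi =
      action_on l 1 (fun t => v ((1 - l)^-1 * t + - l / (1 - l)))
      (fun t x => (1 - l)^-1 * g ((1 - l)^-1 * t + - l / (1 - l)) x).
    rewrite (action_on_obnd cv) (action_on_obnd cv').
    apply: eq_integral => t; rewrite inE/= in_itv/= => /andP[tl _].
    by rewrite rhoR ?psiR ?ltW.
  rewrite vE gtr0_norm// mulrC EFinM; apply: lee_wpmul2l => //.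
  by rewrite lee_fin ltW.
Unshelve. all: by end_near. Qed.

End Curves.

(** * The squared distance through real upper bounds *)

Section TransportDistance.
Context {R : realType} {X : finType}.
Variables (Q : X -> X -> R) (pi : X -> R).
Hypothesis hQ : reversible_chain Q pi.
Implicit Types (r : X -> R) (a b w : R).

(* [W(r0, r1)^2 <= A], as approximate attainment; it also makes sense while the
   finiteness of the distance is still unknown. *)
Definition sqdist_le (r0 r1 : X -> R) (A : R) : Prop :=
  forall e : R, 0 < e -> joinable Q pi r0 r1 (A + e).

Let sqdist (r0 r1 : X -> R) : \bar R :=
  ereal_inf [set A | exists rho psi : R -> X -> R,
    admissible Q pi r0 r1 rho psi /\ A = action Q pi rho psi].

Let transport_distE (r0 r1 : X -> R) :
  transport_dist Q pi r0 r1 = sqrte (sqdist r0 r1).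
Proof. by []. Qed.

Let sqdist_ge0 (r0 r1 : X -> R) : (0 <= sqdist r0 r1)%E.
Proof.
apply: le_ereal_inf_tmp => _ [rho [psi [_ ->]]]; apply: integral_ge0 => t _.
by rewrite lee_fin gradnorm2_ge0.
Qed.

Let joinable_sqdist (r0 r1 : X -> R) A :
  joinable Q pi r0 r1 A -> (sqdist r0 r1 <= A%:E)%E.
Proof.
move=> [rho [psi [cv r0E r1E aA]]]; apply: ge_ereal_inf.
exists (action Q pi rho psi); last exact: aA.
exists rho, psi; split; last by [].
by rewrite -r0E -r1E; exact: curve_on_admissible.
Qed.

Let sqdist_joinable (r0 r1 : X -> R) (A : R) :
  (sqdist r0 r1 < A%:E)%E -> joinable Q pi r0 r1 A.
Proof.
move=> /ereal_inf_lt[_ [rho [psi [adm ->]]] /ltW aA]; exists rho, psi.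
have cv := admissible_curve_on adm; case: adm => _ _ [r0E r1E] _ _.
by split; [exact: cv|exact: r0E|exact: r1E|exact: aA].
Qed.

Let sqdist_leP (r0 r1 : X -> R) A :
  sqdist_le r0 r1 A <-> (sqdist r0 r1 <= A%:E)%E.
Proof.
split=> [h|h e e0].
- by apply/lee_addgt0Pr => e e0; rewrite -EFinD; apply: joinable_sqdist; exact: h.
- by apply: sqdist_joinable; apply: le_lt_trans h _; rewrite lte_fin ltrDl.
Qed.

(** The bridge to real numbers: the square of a finite distance is the least [A] with [sqdist_le].
    Later sections use the infimum in this form. *)
Lemma transport_dist_finP (r0 r1 : X -> R) w :
  transport_dist Q pi r0 r1 = w%:E <->
  [/\ 0 <= w, sqdist_le r0 r1 (w ^+ 2) &
      forall A, sqdist_le r0 r1 A -> w ^+ 2 <= A].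
Proof.
rewrite transport_distE; split=> [wE|[w0 /sqdist_leP le1 ge1]].
- have w0 : 0 <= w by rewrite -lee_fin -wE sqrte_ge0.
  have sE : sqdist r0 r1 = (w ^+ 2)%:E.
    by rewrite -(sqr_sqrte (sqdist_ge0 r0 r1)) wE.
  split; first exact: w0.
    by apply/sqdist_leP; rewrite sE.
  by move=> A /sqdist_leP; rewrite sE lee_fin.
- have -> : sqdist r0 r1 = (w ^+ 2)%:E.
    have fin : sqdist r0 r1 \is a fin_num.
      by rewrite ge0_fin_numE// (le_lt_trans le1)// ltry.
    apply/eqP; rewrite eq_le le1/= -(fineK fin) lee_fin; apply: ge1.
    by apply/sqdist_leP; rewrite fineK.
  by rewrite /= sqrtr_sqr ger0_norm.
Qed.

Lemma joinable_sqdist_le (r0 r1 : X -> R) A : joinable Q pi r0 r1 A -> sqdist_le r0 r1 A.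
Proof. by move=> /joinable_sqdist/sqdist_leP. Qed.

Lemma transport_dist_fin (r0 r1 : X -> R) A : joinable Q pi r0 r1 A ->
  exists w, transport_dist Q pi r0 r1 = w%:E.
Proof.
move=> /joinable_sqdist h; exists (fine (transport_dist Q pi r0 r1)).
rewrite fineK// transport_distE sqrte_fin_num ?sqdist_ge0//.
by rewrite ge0_fin_numE ?sqdist_ge0// (le_lt_trans h)// ltry.
Qed.

Lemma sqdist_le_ge0 (r0 r1 : X -> R) A : sqdist_le r0 r1 A -> 0 <= A.
Proof.
move=> h; apply/ler_addgt0Pr => e e0; apply: (@joinable_ge0 _ _ _ _ hQ r0 r1).
exact: h.
Qed.

Lemma sqdist_le_sym (r0 r1 : X -> R) A : sqdist_le r0 r1 A -> sqdist_le r1 r0 A.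
Proof. by move=> h e e0; apply: (joinable_sym hQ); exact: h. Qed.

Lemma sqdist_le_weaken (r0 r1 : X -> R) A B : A <= B ->
  sqdist_le r0 r1 A -> sqdist_le r0 r1 B.
Proof.
by move=> AB h e e0; apply: joinable_weaken (h e e0); rewrite lerD2r.
Qed.

Lemma sqdist_le_closed (r0 r1 : X -> R) A :
  (forall e, 0 < e -> sqdist_le r0 r1 (A + e)) -> sqdist_le r0 r1 A.
Proof.
move=> h e e0; have e20 : 0 < e / 2 by rewrite divr_gt0.
by have := h _ e20 _ e20; rewrite -addrA -splitr.
Qed.

Lemma sqdist_le_trans (r0 r1 r2 : X -> R) A B l : 0 < l -> l < 1 ->
  sqdist_le r0 r1 A -> sqdist_le r1 r2 B -> sqdist_le r0 r2 (A / l + B / (1 - l)).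
Proof.
move=> l0 l1 hA hB e e0; have l10 : 0 < 1 - l by rewrite subr_gt0.
have e1 : 0 < e / 2 * l by rewrite mulr_gt0// divr_gt0.
have e2 : 0 < e / 2 * (1 - l) by rewrite mulr_gt0// divr_gt0.
have := joinable_trans hQ l0 l1 (hA _ e1) (hB _ e2).
rewrite !mulrDl !mulfK ?gt_eqF// => h; apply: joinable_weaken h.
by rewrite addrACA -splitr.
Qed.

Lemma sqdist_le_triangle (r0 r1 r2 : X -> R) a b : 0 <= a -> 0 <= b ->
  sqdist_le r0 r1 (a ^+ 2) -> sqdist_le r1 r2 (b ^+ 2) ->
  sqdist_le r0 r2 ((a + b) ^+ 2).
Proof.
move=> a0 b0 hA hB; apply: sqdist_le_closed => e e0.
(* The optimal weight is [a / (a + b)]. Enlarging [a] and [b] by [d] keeps it strictly between [0]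
   and [1], and [d] is so small that the square grows by at most [e]. *)
pose d := Num.min 1 (e / (4 * (a + b) + 4)).
have ab0 : 0 < 4 * (a + b) + 4 by lra.
have d0 : 0 < d by rewrite lt_min ltr01 divr_gt0.
have d1 : d <= 1 by rewrite ge_min lexx.
have de : d * (4 * (a + b) + 4) <= e.
  by rewrite -ler_pdivlMr// ge_min lexx orbT.
have [ad bd] : 0 < a + d /\ 0 < b + d by split; lra.
have sum0 : 0 < a + d + (b + d) by lra.
have l0 : 0 < (a + d) / (a + d + (b + d)) by rewrite divr_gt0.
have l1 : (a + d) / (a + d + (b + d)) < 1 by rewrite ltr_pdivrMr// mul1r; lra.
have hA' : sqdist_le r0 r1 ((a + d) ^+ 2).
  have le_d : a <= a + d by rewrite lerDl ltW.
  by apply: sqdist_le_weaken hA; rewrite !expr2; exact: ler_pM.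
have hB' : sqdist_le r1 r2 ((b + d) ^+ 2).
  have le_d : b <= b + d by rewrite lerDl ltW.
  by apply: sqdist_le_weaken hB; rewrite !expr2; exact: ler_pM.
apply: sqdist_le_weaken (sqdist_le_trans l0 l1 hA' hB').
have -> : (a + d) ^+ 2 / ((a + d) / (a + d + (b + d))) +
    (b + d) ^+ 2 / (1 - (a + d) / (a + d + (b + d))) = (a + d + (b + d)) ^+ 2.
  have -> : 1 - (a + d) / (a + d + (b + d)) = (b + d) / (a + d + (b + d)).
    by field; rewrite gt_eqF.
  by field; rewrite !gt_eqF.
have dd : d * d <= d by rewrite ler_piMl// ltW.
have -> : (a + d + (b + d)) ^+ 2 = (a + b) ^+ 2 + (d * (4 * (a + b)) + 4 * (d * d)) by ring.
by rewrite lerD2l; apply: le_trans de; rewrite [leRHS]mulrDr lerD2l [d * 4]mulrC ler_pM2l.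
Qed.

End TransportDistance.

(** * The heat flow along curves *)

Section EntropyFunction.
Context {R : realType}.
Implicit Types (u v y c C : R).

Lemma norm_xlnx_le y : 0 < y -> y <= 1 -> `|y * ln y| <= 2 * Num.sqrt y.
Proof.
move=> y0 y1; have s0 : 0 < Num.sqrt y by rewrite sqrtr_gt0.
have lny0 : ln y <= 0 by exact: ln_le0.
rewrite ler0_norm; last by rewrite mulr_ge0_le0// ltW.
have lnE : ln y = 2 * ln (Num.sqrt y).
  rewrite -[in LHS](sqr_sqrtr (ltW y0)) lnXn//; ring.
have h : ln (Num.sqrt y)^-1 <= (Num.sqrt y)^-1.
  by apply: ltW; apply: ln_sublinear; rewrite invr_gt0.
rewrite lnV ?posrE// in h.
rewrite -mulrN lnE -mulrN mulrCA ler_pM2l//.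
apply: (@le_trans _ _ (y * (Num.sqrt y)^-1)); first by rewrite ler_pM2l.
by rewrite -[X in X * _](sqr_sqrtr (ltW y0)) expr2 mulfK// gt_eqF.
Qed.

Lemma continuous_xlnx : continuous (fun y : R => y * ln y).
Proof.
move=> y; case: (ltgtP y 0) => [yn|yp|->].
- rewrite /continuous_at (ln0 (ltW yn)) mulr0; apply: cvg_near_cst.
  by near=> z; rewrite ln0 ?mulr0// ltW//; near: z; exact: lt_nbhsl.
- by apply: cvgM; [exact: cvg_id|exact: continuous_ln].
- rewrite /continuous_at mul0r; apply/cvgrPdist_lt => e e0; rewrite near_simpl.
  have e20 : 0 < Num.min 1 ((e / 4) ^+ 2).
    by rewrite lt_min ltr01 exprn_gt0// divr_gt0.
  exists (Num.min 1 ((e / 4) ^+ 2)) => // z; rewrite /= !sub0r !normrN => zm.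
  have [z0|z0] := leP z 0; first by rewrite ln0// mulr0 normr0.
  move: zm; rewrite gtr0_norm// lt_min => /andP[z1 ze].
  apply: le_lt_trans (norm_xlnx_le z0 (ltW z1)) _.
  have : Num.sqrt z < e / 4.
    rewrite -[ltRHS]gtr0_norm ?divr_gt0// -sqrtr_sqr ltr_sqrt//.
    by rewrite exprn_gt0// divr_gt0.
  lra.
Unshelve. all: by end_near. Qed.

Lemma xlnx_lipschitz c C u v : 0 < c -> c <= u <= C -> c <= v <= C ->
  `|v * ln v - u * ln u| <= (`|ln c| + `|ln C| + 1) * `|v - u|.
Proof.
wlog uv : u v / u <= v.
  by move=> H c0 uI vI; have [uv|/ltW vu] := leP u v;
    [exact: H|rewrite distrC (distrC v); exact: H].
move=> c0 /andP[cu uC] /andP[cv vC].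
have u0 := lt_le_trans c0 cu; have v0 := lt_le_trans c0 cv.
have C0 := lt_le_trans u0 uC.
have -> : v * ln v - u * ln u = (v - u) * ln v + u * (ln v - ln u) by ring.
apply: le_trans (ler_normD _ _) _; rewrite [leRHS]mulrDl mul1r; apply: lerD.
- rewrite normrM mulrC ler_wpM2r//.
  have l1 : ln c <= ln v by rewrite ler_ln ?posrE.
  have l2 : ln v <= ln C by rewrite ler_ln ?posrE.
  rewrite ler_norml; apply/andP; split.
    apply: le_trans l1; rewrite lerNl (le_trans (ler_norm _))// normrN lerDl//.
  by apply: (le_trans l2); rewrite (le_trans (ler_norm _))// lerDr.
- have luv : ln u <= ln v by rewrite ler_ln ?posrE.
  rewrite !ger0_norm ?subr_ge0//; last by rewrite mulr_ge0 ?subr_ge0// ltW.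
  have h : ln v - ln u <= (v - u) / u.
    rewrite -ln_div ?posrE//.
    have -> : v / u = 1 + (v - u) / u by field; rewrite gt_eqF.
    apply: le_ln1Dx; apply: lt_le_trans (ltrN10 _) _.
    by rewrite divr_ge0 ?subr_ge0// ltW.
  rewrite mulrC -ler_pdivlMr//.
Qed.

Lemma is_derive_xlnx (f : R -> R) (df t : R) : 0 < f t -> is_derive t 1 f df ->
  is_derive t 1 (fun t => f t * ln (f t)) (df * ln (f t) + df).
Proof.
move=> ft0 hf; have hl : is_derive t 1 (fun t => ln (f t)) ((f t)^-1 * df).
  by apply: (is_derive1_comp (g := f)); exact: is_derive1_ln.
apply: (is_derive_eq (is_derive_mulr hf hl)).
by rewrite mulrA divff ?mul1r// gt_eqF.
Qed.

Lemma xlnx_convex u y : 0 < u -> 0 <= y ->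
  u * ln u - y * ln y <= (u - y) * (ln u + 1).
Proof.
move=> u0; rewrite le_eqVlt => /predU1P[<-|y0].
  by rewrite mul0r !subr0 mulrDr mulr1 lerDl ltW.
have h : ln u - ln y <= (u - y) / y.
  rewrite -ln_div ?posrE//.
  have -> : u / y = 1 + (u - y) / y by field; rewrite gt_eqF.
  apply: le_ln1Dx; rewrite mulrBl divff ?gt_eqF// ltrBDr addNr.
  by rewrite divr_gt0.
rewrite ler_pdivlMr// in h.
rewrite -subr_ge0; have -> : (u - y) * (ln u + 1) - (u * ln u - y * ln y) =
  (u - y) - (ln u - ln y) * y by ring.
by rewrite subr_ge0.
Qed.

End EntropyFunction.

Lemma ge0_integrable_scale (R : realType) (c d K A : R) (f : R -> R) : 0 <= K ->
  measurable_fun `[c, d] f -> (forall t, 0 <= f t) ->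
  (\int[@lebesgue_measure R]_(t in `[c, d]) (f t)%:E <= A%:E)%E ->
  (@lebesgue_measure R).-integrable `[c, d] (EFin \o (fun t => K * f t)) /\
  (\int[@lebesgue_measure R]_(t in `[c, d]) (K * f t)%:E =
   K%:E * \int[@lebesgue_measure R]_(t in `[c, d]) (f t)%:E)%E.
Proof.
move=> K0 mf f0 fA.
have E : (\int[@lebesgue_measure R]_(t in `[c, d]) (K * f t)%:E =
   K%:E * \int[@lebesgue_measure R]_(t in `[c, d]) (f t)%:E)%E.
  under eq_integral do rewrite EFinM; rewrite ge0_integralZl//.
  - exact/measurable_EFinP.
  - by move=> t _; rewrite lee_fin.
split; last exact: E.
apply/integrableP; split.
  by apply/measurable_EFinP; exact: measurable_funM.
under eq_integral do rewrite /= ger0_norm ?mulr_ge0//.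
rewrite E; apply: (@le_lt_trans _ _ (K%:E * A%:E)%E).
  by apply: lee_wpmul2l => //; rewrite lee_fin.
by rewrite -EFinM ltry.
Qed.

(** * Action and entropy along curves moved by the heat flow *)

Section HeatFlowAction.
Context {R : realType} {X : finType}.
Variables (Q : X -> X -> R) (pi : X -> R).
Hypothesis hQ : reversible_chain Q pi.
Notation mu := (@lebesgue_measure R).
Notation P := (semigroup Q).
Implicit Types (r : X -> R) (rho psi : R -> X -> R).

Lemma generator_sum (I : Type) (s : seq I) (c : I -> R) (f : I -> X -> R) x :
  generator Q (fun x => \sum_(i <- s) c i * f i x) x =
  \sum_(i <- s) c i * generator Q (f i) x.
Proof.
rewrite /generator; under [RHS]eq_bigr do rewrite mulr_sumr.
rewrite exchange_big/=; apply: eq_bigr => y _.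
rewrite -sumrB mulr_suml; apply: eq_bigr => i _; ring.
Qed.

(** The flow time and the curve vary together; expanded in the heat kernel this is a sum of products
    of scalar functions. *)
Lemma is_derive_heat_curve rho (v : X -> R) (a b s : R) x :
  (forall y, is_derive s 1 (fun s => rho s y) (v y)) ->
  is_derive s 1 (fun s => P (b * s + a) (rho s) x)
    (P (b * s + a) v x + b * generator Q (P (b * s + a) (rho s)) x).
Proof.
move=> drho.
have -> : (fun s => P (b * s + a) (rho s) x) =
    (fun s => \sum_y rho s y * heat_kernel Q (b * s + a) x y).
  by apply/funext => u; rewrite semigroup_heat_kernel.
have dk y : is_derive s 1 (fun s => heat_kernel Q (b * s + a) x y)
    (b * generator Q (fun x => heat_kernel Q (b * s + a) x y) x).
  apply: (is_derive_comp_affine (f := fun t => heat_kernel Q t x y)).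
  exact: is_derive_semigroup.
apply: (is_derive_eq (is_derive_fsum _ (fun y => is_derive_mulr (drho y) (dk y)))).
rewrite big_split/= -semigroup_heat_kernel; congr (_ + _).
have -> : P (b * s + a) (rho s) =
    (fun x => \sum_y rho s y * heat_kernel Q (b * s + a) x y).
  by apply/funext => z; rewrite semigroup_heat_kernel.
by rewrite generator_sum mulr_sumr; apply: eq_bigr => y _; ring.
Qed.

Lemma dotp_semigroup t (phi v : X -> R) :
  dotp pi phi (P t v) = dotp pi (P t phi) v.
Proof. exact: (semigroup_sym hQ). Qed.

Lemma generator_mean0 (phi : X -> R) : \sum_x generator Q phi x * pi x = 0.
Proof.
transitivity (\sum_x pi x * generator Q phi x); last exact: (stationaryP hQ).
by apply: eq_bigr => x _; rewrite mulrC.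
Qed.

(* The key inequality along a curve moved by the heat flow: transporting a
   tangent vector by [P t] is dual to the gradient estimate, and the extra
   velocity [b * L sigma] is minus [b] times the gradient of the entropy. *)
Lemma heat_flow_gradnorm2_le r (psi phi : X -> R) (t b K : R) :
  0 <= K -> (forall x, 0 <= r x) -> (forall x, 0 < P t r x) ->
  (forall f, gradnorm2 Q pi r (P t f) <= K * gradnorm2 Q pi (P t r) f) ->
  (forall x, onsager Q (P t r) phi x =
     P t (onsager Q r psi) x + b * generator Q (P t r) x) ->
  gradnorm2 Q pi (P t r) phi +
    2 * b * dotp pi (fun x => ln (P t r x)) (onsager Q (P t r) phi)
  <= K * gradnorm2 Q pi r psi.
Proof.
move=> K0 r0 s0 hK hphi; set s := P t r in s0 hK hphi *.
have s0' x : 0 <= s x by exact: ltW.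
(* Removing the entropy part of the velocity leaves [f] as a potential of the transported vector
   [P t (onsager Q r psi)]. *)
pose f x := 1 * phi x + b * ln (s x).
have Kf x : onsager Q s f x = P t (onsager Q r psi) x.
  by rewrite /f onsager_lin hphi (onsager_ln Q s0); ring.
have fE : gradnorm2 Q pi s f = gradform Q pi r (P t f) psi.
  rewrite gradnorm2E -(dotp_onsager hQ _ _ s0') -(dotp_onsager hQ _ _ r0).
  by rewrite -dotp_semigroup; apply: eq_bigr => x _; rewrite Kf.
(* Cauchy-Schwarz at [r] and then [hK] bound the square of the norm of [f] by [K] times that norm
   times the norm of [psi]; one factor cancels. *)
have f_le : gradnorm2 Q pi s f <= K * gradnorm2 Q pi r psi.
  have := gradform_CS hQ r (P t f) psi; rewrite -fE => CS.
  have := gradnorm2_ge0 hQ s f; rewrite le_eqVlt => /orP[/eqP f0|f0].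
    rewrite -f0; exact: mulr_ge0 K0 (gradnorm2_ge0 hQ r psi).
  rewrite -(ler_pM2l f0) -expr2; apply: le_trans CS _.
  rewrite [leRHS]mulrCA [leRHS]mulrA; apply: ler_wpM2r; last exact: hK.
  exact: gradnorm2_ge0.
(* In the expanded square the term in [b ^+ 2] is nonnegative and is dropped. *)
apply: le_trans f_le; rewrite /f gradnorm2_lin expr1n mul1r mulr1.
rewrite (dotp_onsager hQ _ _ s0') gradformC -addrA lerD2l lerDl.
by apply: mulr_ge0; [exact: sqr_ge0|exact: gradnorm2_ge0].
Qed.

Lemma continuous_entropy (r : R -> X -> R) c d :
  (forall x, {within `[c, d], continuous (fun s => r s x)}) ->
  {within `[c, d], continuous (fun s => entropy pi (r s))}.
Proof.
move=> cr; have -> : (fun s => entropy pi (r s)) =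
    (fun s => \sum_x pi x * (r s x * ln (r s x))).
  by apply/funext => s; apply: eq_bigr => x _; rewrite mulrA.
move=> s; apply: cvg_fsum => x; apply: cvgMr.
exact: (cvg_comp _ _ (cr x s) (@continuous_xlnx R (r s x))).
Qed.

Lemma ac_on_entropy (r : R -> X -> R) c d (C : R) : c <= d ->
  (forall x, ac_on c d (fun s => r s x)) ->
  (forall s x, c <= s -> s <= d -> 0 < r s x) ->
  (forall s x, c <= s -> s <= d -> r s x <= C) ->
  ac_on c d (fun s => entropy pi (r s)).
Proof.
move=> cd acr r0 rC; rewrite /entropy; apply: ac_on_sum => x.
under eq_fun do rewrite -mulrA.
apply: (@ac_onZ _ _ _ (fun t => r t x * ln (r t x))).
have [c0 c0I c0P] := EVT_min cd (ac_on_continuous (acr x)).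
have rc0 : 0 < r c0 x by move: c0I; rewrite in_itv/= => /andP[? ?]; exact: r0.
apply: (ac_on_dominated (C := `|ln (r c0 x)| + `|ln C| + 1) (acr x)) => u v cu uv vd.
have ud := le_trans uv vd; have cv := le_trans cu uv.
apply: xlnx_lipschitz => //; apply/andP; split; last first.
- exact: rC.
- by apply: c0P; rewrite in_itv/= cv vd.
- exact: rC.
- by apply: c0P; rewrite in_itv/= cu ud.
Qed.

Lemma is_derive_scale (k : R) (f : R -> R) (df t : R) : is_derive t 1 f df ->
  is_derive t 1 (fun t => k * f t) (k * df).
Proof. by move=> hf; exact: (is_deriveZ k hf). Qed.

Lemma is_derive_entropy (r : R -> X -> R) (w : X -> R) (s : R) :
  (forall x, 0 < r s x) -> \sum_x w x * pi x = 0 ->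
  (forall x, is_derive s 1 (fun s => r s x) (w x)) ->
  is_derive s 1 (fun s => entropy pi (r s)) (dotp pi (fun x => ln (r s x)) w).
Proof.
move=> r0 w0 dr; rewrite /entropy.
have dt x : is_derive s 1 (fun s => pi x * r s x * ln (r s x))
    (pi x * (w x * ln (r s x) + w x)).
  have -> : (fun s => pi x * r s x * ln (r s x)) =
      (fun s => pi x * (r s x * ln (r s x))).
    by apply/funext => u; rewrite mulrA.
  by apply: is_derive_scale; exact: is_derive_xlnx.
apply: (is_derive_eq (is_derive_fsum _ dt)).
transitivity (dotp pi (fun x => ln (r s x)) w + \sum_x w x * pi x).
  by rewrite /dotp -big_split/=; apply: eq_bigr => x _; ring.
by rewrite w0 addr0.
Qed.

Section HeatCurve.
Variables (rho psi : R -> X -> R) (A a b K : R).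
Hypothesis cv : curve_on Q pi 0 1 rho psi.
Hypothesis leA : (action_on Q pi 0 1 rho psi <= A%:E)%E.
Hypotheses (a0 : 0 <= a) (b0 : 0 <= b) (ab0 : 0 < a + b) (K0 : 0 <= K).
(** The flow time goes linearly from [a] to [b]; as [a + b] is positive it is positive inside, which
    makes the moved curve strictly positive there. *)
Let tau s := (b - a) * s + a.
Let rt s : X -> R := P (tau s) (rho s).
Hypothesis hK : forall s f, 0 <= s -> s <= 1 ->
  gradnorm2 Q pi (rho s) (P (tau s) f) <= K * gradnorm2 Q pi (rt s) f.
Let w s : X -> R := fun x =>
  P (tau s) (onsager Q (rho s) (psi s)) x + (b - a) * generator Q (rt s) x.
Let phi s : X -> R := potential Q pi (rt s) (w s).

Let rho_density s : 0 <= s -> s <= 1 -> density pi (rho s).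
Proof. by case: cv => h _ _ _; exact: h. Qed.

Let tauE s : tau s = a * (1 - s) + b * s. Proof. by rewrite /tau; ring. Qed.

Let tau_ge0 s : 0 <= s -> s <= 1 -> 0 <= tau s.
Proof. by move=> s0 s1; rewrite tauE addr_ge0// mulr_ge0// subr_ge0. Qed.

Let tau_gt0 s : 0 < s -> s < 1 -> 0 < tau s.
Proof.
move=> s0 s1; rewrite tauE; have s1' : 0 < 1 - s by rewrite subr_gt0.
move: a0; rewrite le_eqVlt => /predU1P[aE|ap].
  by move: ab0; rewrite -aE mul0r !add0r => bp; rewrite mulr_gt0.
by rewrite ltr_pwDl ?mulr_gt0// mulr_ge0// ltW.
Qed.

Let rt_density s : 0 <= s -> s <= 1 -> density pi (rt s).
Proof.
by move=> s0 s1; apply: (semigroup_density hQ); [exact: tau_ge0|exact: rho_density].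
Qed.

Let rt_gt0 s x : 0 < s -> s < 1 -> 0 < rt s x.
Proof.
move=> s0 s1; have d := rho_density (ltW s0) (ltW s1).
have [y ry] := density_gt0_ex d.
by apply: (semigroup_gt0 hQ x (tau_gt0 s0 s1) _ ry) => z; case: d.
Qed.

Let ac_rt x : ac_on 0 1 (fun s => rt s x).
Proof.
apply: (@eq_ac_on _ _ _ (fun s => \sum_y rho s y * heat_kernel Q (tau s) x y)).
  by move=> s _ _; rewrite /rt semigroup_heat_kernel.
have dirac1 z y : `|(z == y)%:R| <= 1 :> R.
  by case: (z == y); rewrite ?normr1 ?normr0.
apply: ac_on_sum => y; apply: (@ac_onM _ _ _ _ _ (density_bound pi) 1).
- by case: cv => _ h _ _; exact: h.
- apply: (@ac_on_lipschitz _ _ _ (2 * 1 * total_rate Q * `|b - a|)) => u v u0 uv v1.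
  have u1 := le_trans uv v1; have v0 := le_trans u0 uv.
  have -> : 2 * 1 * total_rate Q * `|b - a| * (v - u) =
      2 * 1 * total_rate Q * `|tau v - tau u|.
    rewrite -mulrA; congr (_ * _).
    rewrite -[v - u]ger0_norm ?subr_ge0// -normrM; congr `|_|.
    by rewrite /tau; ring.
  rewrite /heat_kernel; have [le|/ltW le] := leP (tau u) (tau v).
    rewrite [X in _ * X]ger0_norm ?subr_ge0//.
    by apply: (semigroup_lipschitz hQ) => //; exact: tau_ge0.
  rewrite distrC [X in _ * X]distrC [X in _ * X]ger0_norm ?subr_ge0//.
  by apply: (semigroup_lipschitz hQ) => //; exact: tau_ge0.
- move=> t t0 t1; rewrite ger0_norm; last by case: (rho_density t0 t1).
  exact: (density_le_bound hQ y (rho_density t0 t1)).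
- by move=> t t0 t1; apply: (semigroup_norm_le hQ) => //; exact: tau_ge0.
Qed.

Let mtau : measurable_fun (`[0, 1] : set R) tau.
Proof. by apply: measurable_funTS; exact: measurable_affine_map. Qed.

Let mkernel x y : measurable_fun (`[0, 1] : set R) (fun s => heat_kernel Q (tau s) x y).
Proof.
apply: (measurableT_comp (f := fun t => heat_kernel Q t x y)) mtau.
by apply: continuous_measurable_fun => t; exact: (continuous_semigroup).
Qed.

Let mrt x : measurable_fun (`[0, 1] : set R) (fun s => rt s x).
Proof.
by apply: subspace_continuous_measurable_fun => //; exact/ac_on_continuous/ac_rt.
Qed.

Let mw x : measurable_fun (`[0, 1] : set R) (fun s => w s x).
Proof.
rewrite /w; apply: measurable_funD.
  have -> : (fun s => P (tau s) (onsager Q (rho s) (psi s)) x) =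
      (fun s => \sum_y onsager Q (rho s) (psi s) y * heat_kernel Q (tau s) x y).
    by apply/funext => s; exact: semigroup_heat_kernel.
  apply: measurable_sum => y; apply: measurable_funM => //.
  rewrite /onsager; apply: measurableT_comp => //; apply: measurable_sum => z.
  apply: measurable_funM => //; apply: measurable_funM.
    by case: cv => _ _ m _; exact: measurable_funB.
  apply: measurable_logmean => //.
  - exact: measurable_curve cv.
  - exact: measurable_curve cv.
  - by move=> s /=; rewrite in_itv/= => /andP[s0 s1]; case: (rho_density s0 s1).
  - by move=> s /=; rewrite in_itv/= => /andP[s0 s1]; case: (rho_density s0 s1).
apply: measurable_funM => //; rewrite /generator; apply: measurable_sum => y.
by apply: measurable_funM => //; exact: measurable_funB.
Qed.

Let w_mean0 s : 0 <= s -> s <= 1 -> \sum_x w s x * pi x = 0.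
Proof.
move=> s0 s1; rewrite /w; under eq_bigr do rewrite mulrDl -[X in _ + X]mulrA.
rewrite big_split/= -mulr_sumr generator_mean0 mulr0 addr0.
transitivity (dotp pi (fun=> 1) (P (tau s) (onsager Q (rho s) (psi s)))).
  by apply: eq_bigr => x _; rewrite mul1r.
rewrite dotp_semigroup (semigroup_cst Q).
transitivity (\sum_x onsager Q (rho s) (psi s) x * pi x).
  by apply: eq_bigr => x _; rewrite mul1r.
by apply: (onsager_mean0 hQ) => x; case: (rho_density s0 s1).
Qed.

Let onsager_phi s x : 0 < s -> s < 1 -> onsager Q (rt s) (phi s) x = w s x.
Proof.
move=> s0 s1; apply: (onsager_potential hQ).
- by move=> y; exact: rt_gt0.
- by apply: w_mean0; exact: ltW.
Qed.

Let drt : {ae mu, forall s : R, 0 < s -> s < 1 -> forall x,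
  is_derive s 1 (fun s => rt s x) (w s x)}.
Proof.
case: cv => _ _ _; apply: ae_imp => s h s0 s1 x.
by apply: is_derive_heat_curve => y; exact: h.
Qed.

Let cv_rt : curve_on Q pi 0 1 rt phi.
Proof.
split.
- exact: rt_density.
- exact: ac_rt.
- move=> x; apply: measurable_potential => //.
  by move=> s y /=; rewrite in_itv/= => /andP[s0 s1]; case: (rt_density s0 s1).
- apply: ae_imp drt => s h s0 s1 x.
  by rewrite onsager_phi//; exact: h.
Qed.

Let E s := entropy pi (rt s).

(** The key inequality integrated over a compact interval of interior times: at [0] or [1] the flow
    time may vanish, the density too, and the entropy need not be absolutely continuous up to
    there. *)
Let action_interior (c d : R) : 0 < c -> c <= d -> d < 1 ->
  ((2 * (b - a) * (E d - E c))%:E + action_on Q pi c d rt phi <= (K * A)%:E)%E.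
Proof.
move=> c0 cd d1.
have c0' := ltW c0; have d1' := ltW d1.
have cvcd := curve_onW c0' d1' cv.
have cvrt := curve_onW c0' d1' cv_rt.
have mg := measurable_curve_gradnorm2 cvcd.
have leA' : (action_on Q pi c d rho psi <= A%:E)%E.
  apply: le_trans leA; apply: ge0_subset_integral => //=.
  - by apply/measurable_EFinP; exact: (measurable_curve_gradnorm2 cv).
  - by move=> s _; rewrite lee_fin; exact: gradnorm2_ge0.
  - by apply: subset_itv; rewrite bnd_simp.
have [ig igE] := ge0_integrable_scale K0 mg (fun s => gradnorm2_ge0 hQ (rho s) (psi s)) leA'.
have acE : ac_on c d (fun s => 2 * (b - a) * E s).
  apply: (@ac_onZ _ _ _ E); apply: (@ac_on_entropy _ _ _ (density_bound pi)) => //.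
  - by move=> x; exact: ac_onW (ac_rt x).
  - by move=> s x cs sd; apply: rt_gt0; [exact: lt_le_trans cs|exact: le_lt_trans d1].
  - move=> s x cs sd; apply: (density_le_bound hQ); apply: rt_density.
      exact: le_trans cs.
    exact: le_trans d1'.
have : ((2 * (b - a) * E d - 2 * (b - a) * E c)%:E + action_on Q pi c d rt phi
    <= \int[mu]_(s in `[c, d]) (K * gradnorm2 Q pi (rho s) (psi s))%:E)%E.
  apply: (ac_on_ftc_le (g2 := fun s => gradnorm2 Q pi (rt s) (phi s)) cd acE ig).
  - exact: (measurable_curve_gradnorm2 cvrt).
  - by move=> s _ _; apply: mulr_ge0 => //; exact: gradnorm2_ge0.
  - by move=> s _ _; exact: gradnorm2_ge0.
  - apply: ae_imp drt => s h cs sd.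
    have s0 := lt_trans c0 cs; have s1 := lt_trans sd d1.
    have [dE EE] := is_derive_entropy (fun x => rt_gt0 x s0 s1)
      (w_mean0 (ltW s0) (ltW s1)) (h s0 s1).
    have dE' : is_derive s 1 (fun s => 2 * (b - a) * E s)
        (2 * (b - a) * dotp pi (fun x => ln (rt s x)) (w s)).
      exact: is_derive_scale (DeriveDef dE EE).
    have [dE2 EE2] := dE'; split=> //.
    rewrite derive1E EE2 addrC.
    have -> : dotp pi (fun x => ln (rt s x)) (w s) =
        dotp pi (fun x => ln (P (tau s) (rho s) x)) (onsager Q (rt s) (phi s)).
      by apply: eq_bigr => x _; rewrite onsager_phi.
    apply: heat_flow_gradnorm2_le K0 _ _ _ _.
    + by move=> x; case: (rho_density (ltW s0) (ltW s1)).
    + by move=> x; exact: rt_gt0.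
    + by move=> f; apply: hK; exact: ltW.
    + by move=> x; exact: onsager_phi.
rewrite -mulrBr => /le_trans; apply.
rewrite igE EFinM; apply: lee_wpmul2l; last exact: leA'.
by rewrite lee_fin.
Qed.

(** The open interval is exhausted by compact ones. The action converges by monotone convergence,
    and the entropy because [y ln y] is continuous also at zero. *)
Lemma heat_flow_joinable : joinable Q pi (P a (rho 0)) (P b (rho 1))
  (K * A - 2 * (b - a) * (entropy pi (P b (rho 1)) - entropy pi (P a (rho 0)))).
Proof.
have rt0 : rt 0 = P a (rho 0) by rewrite /rt /tau mulr0 add0r.
have rt1 : rt 1 = P b (rho 1) by rewrite /rt /tau mulr1 subrK.
rewrite -rt0 -rt1 -/(E 1) -/(E 0).
exists rt, phi; split; [exact: cv_rt|by []|by []|].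
have [_ cE0 cE1] := (continuous_within_itvP _ ltr01).1
  (continuous_entropy (fun x => ac_on_continuous (ac_rt x))).
pose dl (n : nat) : R := n.+3%:R^-1.
have dl0 n : 0 < dl n by rewrite invr_gt0.
have dl_le n : dl n <= 1 - dl n.
  rewrite lerBrDr -mulr2n -mulr_natl ler_pdivrMr// mul1r ler_nat//.
have dl_cvg : dl n @[n --> \oo] --> (0 : R).
  have -> : dl = (fun n => harmonic (n + 2)%N).
    by apply/funext => n; rewrite /harmonic/= addn2.
  exact: (cvg_comp _ _ (cvg_addnr 2) (@cvg_harmonic R)).
have E0 : E (dl n) @[n --> \oo] --> E 0.
  by move/cvg_at_rightP : cE0; apply; split => // n; rewrite dl0.
have E1 : E (1 - dl n) @[n --> \oo] --> E 1.
  move/cvg_at_leftP : cE1; apply; split => [n|]; first by rewrite ltrBlDr ltrDl.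
  by rewrite -[X in _ --> X]subr0; apply: cvgB => //; exact: cvg_cst.
pose F n := `[dl n, 1 - dl n]%classic.
have FE : \bigcup_n F n = `]0, 1[%classic.
  apply/seteqP; split=> s /=.
    move=> [n _]; rewrite /F/= !in_itv/= => /andP[s0 s1].
    by rewrite (lt_le_trans (dl0 n) s0) (le_lt_trans s1)// ltrBlDr ltrDl.
  rewrite in_itv/= => /andP[s0 s1].
  have m0 : 0 < Num.min s (1 - s) by rewrite lt_min s0 subr_gt0.
  have /cvgrPdist_lt/(_ _ m0)[n _ /(_ n (leqnn n))] := dl_cvg.
  rewrite /= sub0r normrN gtr0_norm// lt_min => /andP[ns n1s].
  by exists n => //; rewrite /F/= in_itv/= (ltW ns)/=; lra.
have mg := measurable_curve_gradnorm2 cv_rt.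
have -> : action_on Q pi 0 1 rt phi =
    (\int[mu]_(s in \bigcup_n F n) (gradnorm2 Q pi (rt s) (phi s))%:E)%E.
  rewrite FE /action_on; apply: integral_itv_bndoo; apply/measurable_EFinP.
  by apply: measurable_funS mg => //; exact: subset_itv_oo_cc.
have FS n : F n `<=` `[0, 1]%classic.
  by apply: subset_itv; rewrite bnd_simp; [exact: ltW|rewrite gerBl ltW].
have bound n : (\int[mu]_(s in F n) (gradnorm2 Q pi (rt s) (phi s))%:E <=
    (K * A - 2 * (b - a) * (E (1 - dl n) - E (dl n)))%:E)%E.
  rewrite EFinB leeBrDl//; apply: action_interior => //.
  by rewrite ltrBlDr ltrDl.
have cvgR : ((K * A - 2 * (b - a) * (E (1 - dl n) - E (dl n)))%:E @[n --> \oo] -->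
    (K * A - 2 * (b - a) * (E 1 - E 0))%:E)%E.
  apply: cvg_EFin; first by near=> n.
  by apply: cvgB; [exact: cvg_cst|apply: cvgMr; exact: cvgB].
have ndF : nondecreasing_seq F.
  move=> n m nm; rewrite subsetEset; apply: subset_itv; rewrite bnd_simp.
    by rewrite lef_pV2 ?posrE// ler_nat.
  by rewrite lerD2l lerN2 lef_pV2 ?posrE// ler_nat.
have cvgI : (\int[mu]_(s in F n) (gradnorm2 Q pi (rt s) (phi s))%:E @[n --> \oo] -->
    \int[mu]_(s in \bigcup_n F n) (gradnorm2 Q pi (rt s) (phi s))%:E)%E.
  apply: ge0_nondecreasing_set_cvg_integral.
  - exact: ndF.
  - by move=> n; exact: measurable_itv.
  - by move=> n; apply/measurable_EFinP; apply: measurable_funS mg; [|exact: FS].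
  - by move=> n s _; rewrite lee_fin; exact: gradnorm2_ge0.
rewrite -(cvg_lim _ cvgR)// -(cvg_lim _ cvgI)//.
apply: lee_lim; [exact: cvgP cvgI|exact: cvgP cvgR|].
by near=> n; exact: bound.
Unshelve. all: by end_near. Qed.

End HeatCurve.

End HeatFlowAction.

(** * Upper bounds on the distance from straight segments *)

Section LinearInterpolation.
Context {R : realType} {X : finType}.
Variables (Q : X -> X -> R) (pi : X -> R).
Hypothesis hQ : reversible_chain Q pi.
Notation mu := (@lebesgue_measure R).
Implicit Types (r sigma phi : X -> R).

Lemma density_convex (r0 r1 : X -> R) (t : R) : 0 <= t -> t <= 1 ->
  density pi r0 -> density pi r1 ->
  density pi (fun x => (1 - t) * r0 x + t * r1 x).
Proof.
move=> t0 t1 [r0_ge0 r0_1] [r1_ge0 r1_1]; split.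
  by move=> x; rewrite addr_ge0// mulr_ge0// subr_ge0.
under eq_bigr do rewrite mulrDl -!mulrA.
by rewrite big_split/= -!mulr_sumr r0_1 r1_1; ring.
Qed.

(** Along the segment the velocity is constant and the density stays above [eta * sigma], so
    [dual_gradnorm2_le] bounds the action density at all times. For [sigma = r0] and [eta] close to
    [1] the bound is sharp to first order. *)
Lemma interpolation_joinable (r0 r1 sigma phi : X -> R) (eta : R) :
  density pi r0 -> density pi r1 -> 0 < eta -> (forall x, 0 < sigma x) ->
  (forall x, eta * sigma x <= r0 x) -> (forall x, eta * sigma x <= r1 x) ->
  (forall x, onsager Q sigma phi x = r1 x - r0 x) ->
  joinable Q pi r0 r1 (gradnorm2 Q pi sigma phi / eta).
Proof.
move=> d0 d1 eta0 s0 sr0 sr1 hphi.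
pose rho t : X -> R := fun x => (1 - t) * r0 x + t * r1 x.
pose psi t := potential Q pi (rho t) (fun x => r1 x - r0 x).
have lb t x : 0 <= t -> t <= 1 -> eta * sigma x <= rho t x.
  move=> t0 t1; have -> : eta * sigma x = (1 - t) * (eta * sigma x) + t * (eta * sigma x) by ring.
  by apply: lerD; apply: ler_wpM2l; rewrite ?subr_ge0.
have rho_gt0 t x : 0 <= t -> t <= 1 -> 0 < rho t x.
  by move=> t0 t1; apply: lt_le_trans (lb t x t0 t1); rewrite mulr_gt0.
have mean0 : \sum_x (r1 x - r0 x) * pi x = 0.
  under eq_bigr do rewrite mulrBl; rewrite sumrB.
  by case: d0 => _ ->; case: d1 => _ ->; rewrite subrr.
have hpsi t x : 0 <= t -> t <= 1 -> onsager Q (rho t) (psi t) x = r1 x - r0 x.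
  by move=> t0 t1; apply: (onsager_potential hQ) => // y; exact: rho_gt0.
have drho (t : R) x : is_derive t 1 (fun t => rho t x) (r1 x - r0 x).
  have -> : (fun t => rho t x) = (fun t : R => (r1 x - r0 x) * t + r0 x).
    by apply/funext => u; rewrite /rho; ring.
  by apply: is_derive_eq; rewrite /GRing.scale/=; ring.
have mrho x : measurable_fun (`[0, 1] : set R) (fun t => rho t x).
  by rewrite /rho; apply: measurable_funD; apply: measurable_funM => //; exact: measurable_funB.
have cv : curve_on Q pi 0 1 rho psi.
  split.
  - by move=> t t0 t1; exact: density_convex.
  - move=> x; apply: (@ac_on_lipschitz _ _ _ `|r1 x - r0 x|) => u v u0 uv v1.
    have -> : rho v x - rho u x = (r1 x - r0 x) * (v - u) by rewrite /rho; ring.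
    by rewrite normrM [X in _ * X]ger0_norm// subr_ge0.
  - move=> x; apply: measurable_potential => //.
    by move=> t y /=; rewrite in_itv/= => /andP[t0 t1]; exact/ltW/rho_gt0.
  - apply: (@aeW _ _ _ mu) => t t0 t1 x.
    by rewrite hpsi ?ltW//; exact: drho.
exists rho, psi; split; first exact: cv.
- by apply/funext => x; rewrite /rho; ring.
- by apply/funext => x; rewrite /rho; ring.
have gle t : 0 <= t -> t <= 1 ->
    gradnorm2 Q pi (rho t) (psi t) <= gradnorm2 Q pi sigma phi / eta.
  move=> t0 t1; rewrite ler_pdivlMr// mulrC.
  apply: (dual_gradnorm2_le hQ eta0) => [x|x|x]; first exact: ltW.
    exact: lb.
  by rewrite hpsi// hphi.
apply: (@le_trans _ _ (\int[mu]_(t in `[0%R, 1%R]) (gradnorm2 Q pi sigma phi / eta)%:E)%E).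
  apply: ge0_le_integral => //.
  - by move=> t _; rewrite lee_fin; exact: gradnorm2_ge0.
  - by apply/measurable_EFinP; exact: measurable_curve_gradnorm2 cv.
  - by move=> t; rewrite /= in_itv/= => /andP[t0 t1]; rewrite lee_fin; exact: gle.
by rewrite integral_cst//= lebesgue_measure_itv/= lte01 sube0 mule1.
Qed.

(** The segment is compared with the uniform density, whose potentials are bounded linearly by the
    velocity. *)
Lemma interior_joinable (c : R) : 0 < c -> exists2 C : R, 0 <= C &
  forall (r0 r1 : X -> R) (N : R), density pi r0 -> density pi r1 ->
  (forall x, c <= r0 x) -> (forall x, c <= r1 x) ->
  (forall x, `|r1 x - r0 x| <= N) -> joinable Q pi r0 r1 (C * N ^+ 2).
Proof.
move=> c0; pose one := fun _ : X => (1 : R).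
have [C hC] := potential_bound Q pi one.
exists (`|C| / c); first by rewrite divr_ge0// ltW.
move=> r0 r1 N d0 d1 cr0 cr1 hN.
have mean0 : \sum_x (r1 x - r0 x) * pi x = 0.
  under eq_bigr do rewrite mulrBl; rewrite sumrB.
  by case: d0 => _ ->; case: d1 => _ ->; rewrite subrr.
pose phi := potential Q pi one (fun x => r1 x - r0 x).
have hphi x : onsager Q one phi x = r1 x - r0 x.
  by apply: (onsager_potential hQ) => // y; rewrite /one.
have phi_le x : `|phi x| <= `|C| * N.
  apply: le_trans (hC _ N x hN) _; apply: ler_wpM2r; last exact: ler_norm.
  by apply: le_trans (hN x).
have g_le : gradnorm2 Q pi one phi <= `|C| * N ^+ 2.
  rewrite gradnorm2E -(dotp_onsager hQ) => [|x]; last by rewrite /one.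
  rewrite /dotp -[leRHS]mulr1 -(stationary_sum1 hQ) mulr_sumr; apply: ler_sum => x _.
  apply: ler_wpM2r; first exact: ltW (stationary_gt0 hQ x).
  rewrite hphi (le_trans (ler_norm _))// normrM expr2 mulrA.
  by apply: ler_pM.
have := interpolation_joinable d0 d1 c0 (fun x => ltr01 : 0 < one x) _ _ hphi.
move=> /(_ _ _)/joinable_weaken; apply => [|x|x]; rewrite ?mulr1//.
rewrite [leRHS]mulrAC; apply: ler_wpM2r; last exact: g_le.
by rewrite invr_ge0 ltW.
Qed.

End LinearInterpolation.

(** * From the gradient estimate to convexity *)

Section GradientEstimateImpliesConvexity.
Context {R : realType} {X : finType}.
Variables (Q : X -> X -> R) (pi : X -> R).
Hypothesis hQ : reversible_chain Q pi.
Implicit Types (r : X -> R).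
Notation P := (semigroup Q).

(** All links get the same share [1 / n.+1] of the time, hence the factor; appending one more link
    uses the weight [n.+1 / n.+2]. *)
Lemma sqdist_le_chain (z : nat -> X -> R) (A : nat -> R) (n : nat) :
  (forall k, (k <= n)%N -> sqdist_le Q pi (z k) (z k.+1) (A k)) ->
  sqdist_le Q pi (z 0%N) (z n.+1) (n.+1%:R * \sum_(k < n.+1) A k).
Proof.
elim: n => [|n ih] h.
  by rewrite mul1r big_ord1; exact: h.
have n0 : (0 : R) < n.+1%:R by rewrite ltr0n.
have l0 : 0 < n.+1%:R / n.+2%:R :> R by rewrite divr_gt0.
have l1 : n.+1%:R / n.+2%:R < 1 :> R by rewrite ltr_pdivrMr// mul1r ltr_nat.
apply: sqdist_le_weaken; last first.
  by apply: (sqdist_le_trans hQ l0 l1) (ih _) (h n.+1 _) => // k kn; apply: h; exact: leqW.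
rewrite [in leRHS]big_ord_recr/=; move: (\sum_(i < n.+1) A i) => S.
have -> : n.+2%:R = n.+1%:R + 1 :> R by rewrite natr1.
have m0 := lt0r_neq0 n0; have m1 : n.+1%:R + 1 != 0 :> R by rewrite natr1 pnatr_eq0.
rewrite le_eqVlt; apply/orP; left; apply/eqP.
move: m0 m1; move: (n.+1%:R : R) => m m0 m1.
have -> : 1 - m / (m + 1) = (m + 1)^-1 by field.
by field; rewrite m0 m1.
Qed.

Lemma expR_le_quad (x : R) : x <= 2^-1 -> expR x <= 1 + x + 2 * x ^+ 2.
Proof.
move=> x2; have x1 : 0 < 1 - x by lra.
have : 1 - x <= expR (- x) by rewrite -[1 - x]/(1 + - x); exact: expR_ge1Dx.
move=> h; have e0 := expR_gt0 x.
have : (1 - x) * expR x <= 1.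
  apply: le_trans (ler_wpM2r (ltW e0) h) _.
  by rewrite expRN mulVf// lt0r_neq0.
move=> h1; have h2 : 1 <= (1 - x) * (1 + x + 2 * x ^+ 2).
  have -> : (1 - x) * (1 + x + 2 * x ^+ 2) = 1 + x ^+ 2 * (1 - 2 * x) by ring.
  by rewrite lerDl mulr_ge0 ?sqr_ge0//; lra.
by rewrite -(ler_pM2l x1); exact: le_trans h1 h2.
Qed.

Lemma le_of_affine_bound (f : R -> R) (c D b0 : R) : 0 < b0 -> {for 0, continuous f} ->
  (forall b : R, 0 < b -> b < b0 -> f b <= c + D * b) -> f 0 <= c.
Proof.
move=> b00 fc h; rewrite leNgt; apply/negP => cf.
pose g b : R := f b - D * b.
have gc : {for 0, continuous g}.
  by apply: cvgB => //; apply: cvgM; [exact: cvg_cst|exact: cvg_id].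
have g0 : c < g 0 by rewrite /g mulr0 subr0.
have /nbhs_ballP[d /= d0 hd] : \forall b \near (0 : R), c < g b by exact: cvgr_gt gc _ g0.
pose b := Num.min d b0 / 2.
have m0 : 0 < Num.min d b0 by rewrite lt_min d0.
have bp : 0 < b by rewrite divr_gt0.
have bm : b < Num.min d b0 by rewrite /b; lra.
move: (bm); rewrite lt_min => /andP[bd bb].
have := hd b; rewrite /ball/= sub0r normrN ger0_norm ?ltW// => /(_ bd).
by have := h b bp bb; rewrite /g; lra.
Qed.

Lemma continuous_semigroup_entropy (r : X -> R) :
  continuous (fun b => entropy pi (P b r)).
Proof.
move=> b; rewrite /entropy; apply: cvg_fsum => x.
have -> : (fun b => pi x * P b r x * ln (P b r x)) = (fun b => pi x * (P b r x * ln (P b r x))).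
  by apply/funext => u; rewrite mulrA.
have -> : pi x * P b r x * ln (P b r x) = pi x * (P b r x * ln (P b r x)) by rewrite mulrA.
apply: cvgM; first exact: cvg_cst.
apply: (continuous_comp (f := fun b => P b r x) (g := fun y => y * ln y)).
  exact: continuous_semigroup.
exact: continuous_xlnx.
Qed.

Variable kappa : R.
Hypothesis hG : forall (psi rho : X -> R) (t : R), density pi rho -> 0 <= t ->
  gradnorm2 Q pi rho (P t psi) <= expR (- 2 * kappa * t) * gradnorm2 Q pi (P t rho) psi.

Lemma expR_segment_le (k a b s K : R) : 0 <= s -> s <= 1 ->
  expR (k * a) <= K -> expR (k * b) <= K -> expR (k * ((b - a) * s + a)) <= K.
Proof.
move=> s0 s1 ha hb.
have [ab|ab] := leP (k * a) (k * b).
  by apply: le_trans hb; rewrite ler_expR; nra.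
by apply: le_trans ha; rewrite ler_expR; nra.
Qed.

Lemma sqdist_le_heat_flow (r0 r1 : X -> R) (A a b K : R) :
  0 <= a -> 0 <= b -> 0 < a + b ->
  expR (- 2 * kappa * a) <= K -> expR (- 2 * kappa * b) <= K ->
  sqdist_le Q pi r0 r1 A ->
  sqdist_le Q pi (P a r0) (P b r1)
    (K * A - 2 * (b - a) * (entropy pi (P b r1) - entropy pi (P a r0))).
Proof.
move=> a0 b0 ab0 aK bK h e e0.
have K0 : 0 < K := lt_le_trans (expR_gt0 _) aK.
have [rho [psi [cv rho0 rho1 leA]]] := h (e / K) (divr_gt0 e0 K0).
have hK s f : 0 <= s -> s <= 1 -> gradnorm2 Q pi (rho s) (P ((b - a) * s + a) f) <=
    K * gradnorm2 Q pi (P ((b - a) * s + a) (rho s)) f.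
  move=> s0 s1; have t0 : 0 <= (b - a) * s + a.
    have -> : (b - a) * s + a = a * (1 - s) + b * s by ring.
    by rewrite addr_ge0// mulr_ge0// subr_ge0.
  have rs : density pi (rho s) by case: cv => hd _ _ _; exact: hd.
  apply: le_trans (hG f rs t0) _; apply: ler_wpM2r; first exact: gradnorm2_ge0.
  exact: expR_segment_le.
have := heat_flow_joinable hQ cv leA a0 b0 ab0 (ltW K0) hK.
rewrite rho0 rho1; apply: joinable_weaken; rewrite mulrDr [K * (e / K)]mulrC divfK ?lt0r_neq0//.
by rewrite addrAC.
Qed.

(* Cut [y] into n pieces and let the point at time p flow for time b p: the
   factors exp(-2 kappa b p) average to 1 - kappa b + O(b^2) as n grows. *)
Lemma heat_flow_evi (y : R -> X -> R) (W2 b : R) : 0 < b -> `|2 * kappa * b| <= 2^-1 ->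
  0 <= W2 ->
  (forall s u : R, 0 <= s -> s <= u -> u <= 1 -> sqdist_le Q pi (y s) (y u) ((u - s) ^+ 2 * W2)) ->
  sqdist_le Q pi (y 0) (P b (y 1))
    ((1 - kappa * b + 8 * (kappa * b) ^+ 2) * W2 -
      2 * b * (entropy pi (P b (y 1)) - entropy pi (y 0))).
Proof.
move=> b0 kb W20 hy.
set k := kappa * b; have kb2 : `|k| <= 4^-1.
  by move: kb; rewrite -mulrA normrM ger0_norm// -/k; lra.
have step n : sqdist_le Q pi (y 0) (P b (y 1))
    ((1 - k + 8 * k ^+ 2 + 3 * `|k| / n.+1%:R) * W2 -
      2 * b * (entropy pi (P b (y 1)) - entropy pi (y 0))).
  have n0 : (0 : R) < n.+1%:R by rewrite ltr0n.
  pose p i : R := i%:R / n.+1%:R.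
  have pS i : p i.+1 = p i + n.+1%:R^-1 by rewrite /p -natr1 mulrDl mul1r.
  have p0 : p 0%N = 0 by rewrite /p mul0r.
  have p1 : p n.+1 = 1 by rewrite /p divff// pnatr_eq0.
  have p_ge0 i : 0 <= p i by rewrite /p divr_ge0.
  have p_le1 i : (i <= n.+1)%N -> p i <= 1.
    by move=> hi; rewrite /p ler_pdivrMr// mul1r ler_nat.
  pose z i := P (b * p i) (y (p i)).
  (* For [q] in [[0, 1]] one has [exp (- 2 k q) <= 1 - 2 k q + 8 k^2]; the summand [2 |k| / n.+1]
     allows one constant for both times [p i] and [p i.+1]. *)
  pose K i := 1 - 2 * k * p i + 2 * `|k| / n.+1%:R + 8 * k ^+ 2.
  pose E i := entropy pi (z i).
  have h i : (i <= n)%N -> sqdist_le Q pi (z i) (z i.+1)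
      (K i * (n.+1%:R^-1 ^+ 2 * W2) - 2 * (b / n.+1%:R) * (E i.+1 - E i)).
    move=> i_n; have -> : b / n.+1%:R = b * p i.+1 - b * p i by rewrite pS; ring.
    have -> : n.+1%:R^-1 = p i.+1 - p i by rewrite pS; ring.
    have pi1 : 0 < p i.+1 by rewrite /p divr_gt0.
    have exq (q : R) : 0 <= q -> q <= 1 -> expR (- 2 * kappa * (b * q)) <= 1 - 2 * k * q + 8 * k ^+ 2.
      move=> q0 q1; have -> : - 2 * kappa * (b * q) = - 2 * k * q by rewrite /k; ring.
      apply: le_trans (expR_le_quad _) _.
        by have := ler_norm (- k); rewrite normrN => ?; nra.
      have -> : 2 * (- 2 * k * q) ^+ 2 = 8 * k ^+ 2 * q ^+ 2 by ring.
      have q2 : q ^+ 2 <= 1 by rewrite expr_le1.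
      by have := ler_wpM2l (_ : 0 <= 8 * k ^+ 2) q2; rewrite mulr1 mulr_ge0 ?sqr_ge0// => /(_ isT); lra.
    have kn : 0 <= 2 * `|k| / n.+1%:R by rewrite divr_ge0// mulr_ge0.
    have bp j : 0 <= b * p j by rewrite mulr_ge0// ltW.
    apply: (sqdist_le_heat_flow (bp i) (bp i.+1)).
    - by rewrite -mulrDr mulr_gt0// ltr_wpDl.
    - by apply: le_trans (exq _ (p_ge0 i) (p_le1 i (leqW i_n))) _; rewrite /K [leRHS]addrAC lerDl.
    - apply: le_trans (exq _ (p_ge0 i.+1) (p_le1 i.+1 i_n)) _; rewrite /K pS.
      have : - k / n.+1%:R <= `|k| / n.+1%:R.
        by apply: ler_wpM2r; [rewrite invr_ge0 ltW|rewrite -normrN ler_norm].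
      rewrite -subr_ge0 => h; rewrite -subr_ge0.
      have -> : forall q v a m : R, 1 - 2 * k * q + 2 * m * v + a - (1 - 2 * k * (q + v) + a) =
        2 * (m * v - (- k) * v) by move=> *; ring.
      by rewrite mulr_ge0.
    - by apply: hy => //; [rewrite pS lerDl invr_ge0 ltW|exact: p_le1].
  have := sqdist_le_chain h.
  rewrite /z p0 p1 !mulr0 mulr1 semigroup0; apply: sqdist_le_weaken.
  rewrite sumrB -mulr_suml -mulr_sumr.
  have -> : \sum_(i < n.+1) (E i.+1 - E i) = E n.+1 - E 0%N.
    by rewrite -(big_mkord predT (fun i => E i.+1 - E i)) telescope_sumr.
  rewrite /E /z p0 p1 mulr0 mulr1 semigroup0.
  (* The times are in arithmetic progression, so the mean of [K i] is [1 - k + 8 k^2] up to a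
     multiple of [1 / n.+1]. *)
  have -> : \sum_(i < n.+1) K i = n.+1%:R * (1 - k + 8 * k ^+ 2) + 2 * `|k| + k.
    have sump m : \sum_(i < m) (i%:R : R) = m%:R * (m%:R - 1) / 2.
      elim: m => [|m ih]; first by rewrite big_ord0 !mul0r.
      by rewrite big_ord_recr/= ih -natr1; field.
    rewrite /K !big_split/= !sumr_const card_ord sumrN -mulr_sumr.
    rewrite -mulr_suml sump -[_ *+ n.+1]mulr_natl -[(2 * _ / _) *+ n.+1]mulr_natl -[(8 * _) *+ n.+1]mulr_natl.
    move: (lt0r_neq0 n0); move: (n.+1%:R : R) => m m0.
    by field.
  move: (entropy pi (P b (y 1)) - entropy pi (y 0)) n0 => D; move: (n.+1%:R : R) => m m0.
  rewrite -subr_ge0.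
  have -> : (1 - k + 8 * k ^+ 2 + 3 * `|k| / m) * W2 - 2 * b * D -
      m * ((m * (1 - k + 8 * k ^+ 2) + 2 * `|k| + k) * (m^-1 ^+ 2 * W2) - 2 * (b / m) * D) =
      (`|k| - k) / m * W2 by field; exact: lt0r_neq0.
  by apply: mulr_ge0 => //; apply: divr_ge0; [rewrite subr_ge0 ler_norm|exact: ltW].
apply: sqdist_le_closed => e e0.
have kW : 0 <= 3 * `|k| * W2 by rewrite !mulr_ge0.
have [n hn] : exists n, 3 * `|k| * W2 / e < n.+1%:R.
  exists (Num.truncn (3 * `|k| * W2 / e)); exact: truncnS_gt.
apply: sqdist_le_weaken (step n); move: (entropy pi _ - _) => D.
have -> : (1 - k + 8 * k ^+ 2) * W2 - 2 * b * D + e = (1 - k + 8 * k ^+ 2) * W2 + e - 2 * b * D by ring.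
rewrite lerB// mulrDl lerD2l -mulrAC ler_pdivrMr ?ltr0n//.
by rewrite [leRHS]mulrC -ler_pdivrMr//; exact: ltW.
Qed.

(** The constant curve moved by the heat flow reaches the interior at finite cost, even from a
    boundary density. *)
Lemma heat_flow_joinable_self (r : X -> R) (b : R) : density pi r -> 0 < b ->
  exists A, sqdist_le Q pi r (P b r) A.
Proof.
move=> dr b0; have h0 := joinable_sqdist_le (joinable_refl Q dr).
have le_b : expR (- 2 * kappa * b) <= Num.max (expR (- 2 * kappa * 0)) (expR (- 2 * kappa * b)).
  by rewrite le_max lexx orbT.
have le_0 : expR (- 2 * kappa * 0) <= Num.max (expR (- 2 * kappa * 0)) (expR (- 2 * kappa * b)).
  by rewrite le_max lexx.
have b0' : 0 < 0 + b by rewrite add0r.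
have := sqdist_le_heat_flow (lexx 0) (ltW b0) b0' le_0 le_b h0.
by rewrite semigroup0 => h; eexists; exact: h.
Qed.

Lemma positive_lower_bound (r : X -> R) : (forall x, 0 < r x) ->
  exists2 c : R, 0 < c & forall x, c <= r x.
Proof.
move=> r0; have s0 : 0 <= \sum_x (r x)^-1 by apply: sumr_ge0 => x _; rewrite invr_ge0 ltW.
exists (1 + \sum_x (r x)^-1)^-1; first by rewrite invr_gt0; lra.
move=> x; rewrite -[leRHS]invrK lef_pV2 ?posrE ?invr_gt0//; last by lra.
rewrite (bigD1 x)//= addrCA lerDl addr_ge0//; apply: sumr_ge0 => y _.
by rewrite invr_ge0 ltW.
Qed.

(** The route is [r0], [P 1 r0], [P 1 r1], [r1]: heat at both ends and a straight segment between
    the two positive densities. *)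
Lemma gradient_estimate_joinable (r0 r1 : X -> R) : density pi r0 -> density pi r1 ->
  exists A, joinable Q pi r0 r1 A.
Proof.
move=> d0 d1.
have [A0 h0] := heat_flow_joinable_self d0 ltr01.
have [A1 h1] := heat_flow_joinable_self d1 ltr01.
have P_gt0 r : density pi r -> forall x, 0 < P 1 r x.
  move=> dr x; have [y ry] := density_gt0_ex dr.
  by case: (dr) => rp _; apply: (semigroup_gt0 hQ) ry.
have [c0 c00 hc0] := positive_lower_bound (P_gt0 _ d0).
have [c1 c10 hc1] := positive_lower_bound (P_gt0 _ d1).
have c_gt0 : 0 < Num.min c0 c1 by rewrite lt_min c00.
have [C _ hC] := interior_joinable hQ c_gt0.
have e0 := semigroup_density hQ ler01 d0; have e1 := semigroup_density hQ ler01 d1.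
have h01 : sqdist_le Q pi (P 1 r0) (P 1 r1) (C * density_bound pi ^+ 2).
  apply: joinable_sqdist_le; apply: hC => // x; first by rewrite ge_min hc0.
    by rewrite ge_min hc1 orbT.
  have := density_le_bound hQ x e0; have := density_le_bound hQ x e1.
  by case: e0 => /(_ x) + _; case: e1 => /(_ x) + _; rewrite ler_norml; lra.
have half0 : (0 : R) < 2^-1 by rewrite invr_gt0.
have half1 : 2^-1 < (1 : R) by lra.
have := sqdist_le_trans hQ half0 half1 (sqdist_le_trans hQ half0 half1 h0 h01) (sqdist_le_sym hQ h1).
by move=> /(_ 1 ltr01); eexists; eassumption.
Qed.


Lemma gradient_estimate_convex : entropic_Ric_ge Q pi kappa.
Proof.
move=> g [gd gg] t; rewrite in_itv/= => /andP[t0 t1].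
have in01 (s : R) : 0 <= s -> s <= 1 -> s \in `[0, 1].
  by move=> s0 s1; rewrite in_itv/= s0.
have d0 := gd 0 (in01 _ (lexx _) ler01); have d1 := gd 1 (in01 _ ler01 (lexx _)).
have [A hA] := gradient_estimate_joinable d0 d1.
have [w hw] := transport_dist_fin hQ hA.
have w0 : 0 <= w by case/(transport_dist_finP hQ): hw.
have gs (s u : R) : 0 <= s -> s <= u -> u <= 1 ->
    sqdist_le Q pi (g s) (g u) ((u - s) ^+ 2 * w ^+ 2).
  move=> s0 su u1; have := gg s u (in01 _ s0 (le_trans su u1)) (in01 _ (le_trans s0 su) u1).
  rewrite hw distrC ger0_norm ?subr_ge0// -EFinM => /(transport_dist_finP hQ)[_ + _].
  by rewrite exprMn.
rewrite hw -!EFinM -EFinB lee_fin.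
move: t0; rewrite le_eqVlt => /predU1P[<-|t0]; first by lra.
move: t1; rewrite le_eqVlt => /predU1P[->|t1]; first by lra.
have t1' : 0 < 1 - t by rewrite subr_gt0.
pose h b := entropy pi (P b (g t)).
have -> : entropy pi (g t) = h 0 by rewrite /h semigroup0.
(* Ensures [|2 kappa b| <= 1 / 2], the range of [heat_flow_evi]. *)
pose b0 := (4 * (`|kappa| + 1))^-1.
have k1 : 0 < `|kappa| + 1 by rewrite ltr_wpDl.
have b00 : 0 < b0 by rewrite invr_gt0 mulr_gt0.
apply: (@le_of_affine_bound h _ (4 * kappa ^+ 2 * w ^+ 2 * (t * (1 - t))) b0) => //.
  exact: continuous_semigroup_entropy.
move=> b bp bb; have kb : `|2 * kappa * b| <= 2^-1.
  rewrite !normrM (ger0_norm (ltW bp)) ger0_norm//.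
  have : b * (4 * (`|kappa| + 1)) <= 1.
    by rewrite -ler_pdivlMr ?mulr_gt0// div1r ltW.
  by have := normr_ge0 kappa; nra.
have W0 : 0 <= t ^+ 2 * w ^+ 2 by rewrite mulr_ge0 ?sqr_ge0.
have W1 : 0 <= (1 - t) ^+ 2 * w ^+ 2 by rewrite mulr_ge0 ?sqr_ge0.
(* Both parts of the geodesic are run towards [g t], the second one backwards, so that both
   inequalities end at the same point [P b (g t)]. *)
have e0 := @heat_flow_evi (fun s => g (t * s)) _ b bp kb W0 _.
have e1 := @heat_flow_evi (fun s => g (1 - (1 - t) * s)) _ b bp kb W1 _.
have {}e0 : sqdist_le Q pi (g 0) (P b (g t))
  ((1 - kappa * b + 8 * (kappa * b) ^+ 2) * (t ^+ 2 * w ^+ 2) - 2 * b * (h b - entropy pi (g 0))).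
  have := e0; rewrite mulr1 mulr0; apply=> s u s0 su u1.
  have -> : (u - s) ^+ 2 * (t ^+ 2 * w ^+ 2) = (t * u - t * s) ^+ 2 * w ^+ 2 by ring.
  by apply: gs; nra.
have {}e1 : sqdist_le Q pi (g 1) (P b (g t))
  ((1 - kappa * b + 8 * (kappa * b) ^+ 2) * ((1 - t) ^+ 2 * w ^+ 2) - 2 * b * (h b - entropy pi (g 1))).
  have := e1; rewrite mulr1 mulr0 subr0.
  have -> : 1 - (1 - t) = t by ring.
  apply=> s u s0 su u1; apply: sqdist_le_sym => //.
  have -> : (u - s) ^+ 2 * ((1 - t) ^+ 2 * w ^+ 2) =
    ((1 - (1 - t) * s) - (1 - (1 - t) * u)) ^+ 2 * w ^+ 2 by ring.
  by apply: gs; nra.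
(* With weights [t] and [1 - t] the terms of order zero in [b] add up to [w ^+ 2] and cancel against
   the minimality of [w]; the rest is divided by [b]. *)
have := sqdist_le_trans hQ t0 t1 e0 (sqdist_le_sym hQ e1).
case/(transport_dist_finP hQ): hw => _ _ /[apply].
set H0 := entropy _ (g 0); set H1 := entropy _ (g 1).
set V := h b; set W := w ^+ 2.
set a := _ - _ + _ => le1.
have : t * (1 - t) * W <= t * (1 - t) * (a * W) - 2 * b * (V - (1 - t) * H0 - t * H1).
  have tt : 0 <= t * (1 - t) by rewrite mulr_ge0// ltW.
  apply: le_trans (ler_wpM2l tt le1) _; rewrite le_eqVlt; apply/orP; left; apply/eqP.
  by field; rewrite !lt0r_neq0.
move=> le2; have : 2 * b * V <= 2 * b * ((1 - t) * H0 + t * H1 - kappa / 2 * t * (1 - t) * W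
    + 4 * kappa ^+ 2 * W * (t * (1 - t)) * b).
  by rewrite -subr_ge0; move: le2; rewrite -subr_ge0 /a; congr (_ <= _); field.
by rewrite ler_pM2l// mulr_gt0.
Qed.

End GradientEstimateImpliesConvexity.

(** * From convexity to the gradient estimate *)

Section Displacement.
Context {R : realType} {X : finType}.
Variables (Q : X -> X -> R) (pi : X -> R).
Hypothesis hQ : reversible_chain Q pi.
Implicit Types (r phi : X -> R) (rho psi : R -> X -> R).
Notation mu := (@lebesgue_measure R).

Lemma action_on_sub (c d c' d' : R) rho psi (A : R) : c <= c' -> d' <= d ->
  curve_on Q pi c d rho psi -> (action_on Q pi c d rho psi <= A%:E)%E ->
  (action_on Q pi c' d' rho psi <= A%:E)%E.
Proof.
move=> cc dd cv leA; apply: le_trans leA; apply: ge0_subset_integral => //=.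
- by apply/measurable_EFinP; exact: (measurable_curve_gradnorm2 cv).
- by move=> s _; rewrite lee_fin; exact: gradnorm2_ge0.
- by apply: subset_itv; rewrite bnd_simp.
Qed.

(** The derivative of [2 <phi, rho>] is twice the form of [phi] and [psi]; splitting it with a
    parameter [l] gives a linear bound that integrates directly, and [l] is chosen afterwards. *)
Let dotp_displacement_le rho psi phi (A B l : R) :
  curve_on Q pi 0 1 rho psi -> (action_on Q pi 0 1 rho psi <= A%:E)%E ->
  0 <= B -> (forall s : R, 0 <= s -> s <= 1 -> gradnorm2 Q pi (rho s) phi <= B) ->
  0 < l -> 2 * (dotp pi phi (rho 1) - dotp pi phi (rho 0)) <= l * B + l^-1 * A.
Proof.
move=> cv leA B0 hB l0.
have mg := measurable_curve_gradnorm2 cv.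
have li0 : 0 <= l^-1 by rewrite invr_ge0 ltW.
have [ig igE] := ge0_integrable_scale li0 mg (fun s => gradnorm2_ge0 hQ (rho s) (psi s)) leA.
have acF : ac_on 0 1 (fun s => 2 * dotp pi phi (rho s) + (- (l * B)) * s).
  apply: ac_onD; last exact/ac_onZ/ac_on_id.
  apply: (@ac_onZ _ _ _ (fun s => dotp pi phi (rho s))).
  rewrite /dotp; apply: ac_on_sum => x.
  have -> : (fun s => phi x * rho s x * pi x) = (fun s => phi x * pi x * rho s x).
    by apply/funext => s; rewrite mulrAC.
  by apply: (@ac_onZ _ _ _ (fun s => rho s x)); case: cv => _ h _ _.
have /(_ _ _ _ _) := ac_on_ftc_le (g2 := fun=> 0) ler01 acF ig.
rewrite integral0_eq// adde0 igE => h.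
have {}h : ((2 * dotp pi phi (rho 1) + - (l * B) * 1 - (2 * dotp pi phi (rho 0) + - (l * B) * 0))%:E
    <= (l^-1 * A)%:E)%E.
  apply: (@le_trans _ _ (l^-1%:E * action_on Q pi 0 1 rho psi)%E); last first.
    by rewrite EFinM; apply: lee_wpmul2l; rewrite ?lee_fin.
  apply: h => //.
    by move=> t _ _; apply: mulr_ge0 => //; exact: gradnorm2_ge0.
  case: (cv) => hd _ _; apply: ae_imp => s h s0 s1.
  have rs x : 0 <= rho s x by case: (hd s (ltW s0) (ltW s1)).
  have dF : is_derive s 1 (fun s => 2 * dotp pi phi (rho s) + (- (l * B)) * s)
      (2 * gradform Q pi (rho s) phi (psi s) - l * B).
    have d1 : is_derive s 1 (fun s => dotp pi phi (rho s)) (dotp pi phi (onsager Q (rho s) (psi s))).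
      apply: is_derive_fsum => x.
      have -> : (fun s => phi x * rho s x * pi x) = (fun s => phi x * pi x * rho s x).
        by apply/funext => u; rewrite mulrAC.
      by rewrite mulrAC; apply: is_derive_scale; exact: h.
    rewrite -(dotp_onsager hQ)//.
    apply: (is_derive_eq (is_deriveD (is_derive_scale 2 d1) (is_derive_scale _ (is_derive_id s 1)))).
    by rewrite mulr1.
  have [dF1 dF2] := dF; split; first exact: dF1.
  rewrite derive1E dF2 addr0 lerBlDl.
  apply: (@le_trans _ _ (l * gradnorm2 Q pi (rho s) phi + l^-1 * gradnorm2 Q pi (rho s) (psi s))).
    have := gradnorm2_ge0 hQ (rho s) (fun x => l * phi x + (-1) * psi s x).
    rewrite gradnorm2_lin => hl; rewrite -subr_ge0 -(pmulr_rge0 _ l0); apply: le_trans hl _.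
    rewrite le_eqVlt; apply/orP; left; apply/eqP; field; exact: lt0r_neq0.
  by rewrite lerD2r; apply: ler_wpM2l; [exact: ltW|exact: hB (ltW s0) (ltW s1)].
by move: h; rewrite lee_fin; lra.
Qed.

Lemma dotp_displacement rho psi phi (A B : R) :
  curve_on Q pi 0 1 rho psi -> (action_on Q pi 0 1 rho psi <= A%:E)%E ->
  0 <= B -> (forall s : R, 0 <= s -> s <= 1 -> gradnorm2 Q pi (rho s) phi <= B) ->
  (dotp pi phi (rho 1) - dotp pi phi (rho 0)) ^+ 2 <= B * A.
Proof.
move=> cv leA B0 hB; have A0 : 0 <= A.
  by rewrite -lee_fin; apply: le_trans leA; apply: integral_ge0 => t _; rewrite lee_fin; exact: gradnorm2_ge0.
have key (D : R) : (forall l, 0 < l -> 2 * D <= l * B + l^-1 * A) -> 0 <= D -> D ^+ 2 <= B * A.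
  move=> h; rewrite le_eqVlt => /predU1P[<-|D0]; first by rewrite expr0n mulr_ge0.
  have [B00|Bn0] := eqVneq B 0.
    (* With [B = 0] this large [l] turns the hypothesis into [2 D <= D A / (A + 1)], impossible for
       [D > 0]. *)
    have l0 : 0 < (A + 1) / D by rewrite divr_gt0//; lra.
    have := h _ l0; rewrite B00 mulr0 add0r invf_div.
    have : D / (A + 1) * A <= D.
      by rewrite mulrAC ler_pdivrMr; [nra|lra].
    by lra.
  have B0' : 0 < B by rewrite lt0r Bn0.
  (* The choice [l = D / B] makes the first term [D] and needs no square root. *)
  have := h _ (divr_gt0 D0 B0'); rewrite divfK// invf_div.
  have -> : B / D * A = (B * A) / D by rewrite mulrAC.
  move=> h1; have : D <= B * A / D by lra.
  by rewrite ler_pdivlMr.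
have [D0|D0] := leP 0 (dotp pi phi (rho 1) - dotp pi phi (rho 0)).
  by apply: key => // l; exact: (dotp_displacement_le cv leA B0 hB).
rewrite -sqrrN; apply: key; last by rewrite oppr_ge0 ltW.
move=> l l0; have := @dotp_displacement_le rho psi (fun x => -1 * phi x) A B l cv leA B0.
have dE r : dotp pi (fun x => -1 * phi x) r = - dotp pi phi r.
  by rewrite /dotp -sumrN; apply: eq_bigr => x _; ring.
rewrite !dE; have -> : - dotp pi phi (rho 1) - - dotp pi phi (rho 0) =
  - (dotp pi phi (rho 1) - dotp pi phi (rho 0)) by ring.
apply=> // s s0 s1; rewrite gradnorm2Z sqrrN expr1n mul1r; exact: hB.
Qed.

Lemma gradnorm2_le_bound r phi : density pi r ->
  gradnorm2 Q pi r phi <= density_bound pi * gradnorm2 Q pi (fun=> 1) phi.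
Proof.
move=> dr; have D1 := density_bound_ge1 hQ; have D0 : 0 < density_bound pi by lra.
rewrite -ler_pdivrMl//; apply: (ler_gradnorm2 hQ).
- by rewrite invr_ge0 ltW.
- by case: dr.
- by move=> x; rewrite ler_pdivrMl// mulr1; exact: (density_le_bound hQ).
Qed.

Let evaluation (x y : X) : R := (y == x)%:R / pi x.
Let bound x := density_bound pi * gradnorm2 Q pi (fun=> 1) (evaluation x).

(** Bounds the gradient norms of all the evaluation functionals at once, uniformly over densities;
    the [1] makes it positive, as it gets divided by. *)
Definition displacement_const : R := 1 + \sum_x bound x.

Let bound_ge0 x : 0 <= bound x.
Proof. by have D1 := density_bound_ge1 hQ; rewrite mulr_ge0 ?gradnorm2_ge0//; lra. Qed.

Lemma displacement_const_gt0 : 0 < displacement_const.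
Proof. by rewrite ltr_pwDl// sumr_ge0. Qed.

Lemma joinable_displacement (r0 r1 : X -> R) (A : R) x :
  joinable Q pi r0 r1 A -> (r1 x - r0 x) ^+ 2 <= displacement_const * A.
Proof.
have BS : bound x <= displacement_const.
  by rewrite /displacement_const (bigD1 x)//= addrCA lerDl addr_ge0// sumr_ge0.
have pE (r : X -> R) : dotp pi (evaluation x) r = r x.
  rewrite /dotp (bigD1 x)//= /evaluation eqxx big1 ?addr0; last first.
    by move=> y /negbTE ->; rewrite !mul0r.
  by rewrite mul1r mulrAC mulVf ?mul1r// lt0r_neq0// (stationary_gt0 hQ).
move=> h; have A0 := joinable_ge0 hQ h.
case: h => rho [psi [cv <- <- leA]].
apply: (@le_trans _ _ (bound x * A)); last exact: ler_wpM2r.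
rewrite -[rho 1 x]pE -[rho 0 x]pE; apply: (dotp_displacement cv leA) => // s s0 s1.
by apply: gradnorm2_le_bound; case: cv => hd _ _ _; exact: hd.
Qed.

(** The piece of an almost optimal curve up to time [s] has no more action than the whole curve, so
    its end is close to [r0]. This keeps curves of small action away from the boundary. *)
Lemma sqdist_le_confined (r0 r1 : X -> R) (A d e : R) : 0 < d ->
  displacement_const * A < d ^+ 2 -> sqdist_le Q pi r0 r1 A -> 0 < e ->
  exists rho psi, [/\ curve_on Q pi 0 1 rho psi, rho 0 = r0, rho 1 = r1,
    (action_on Q pi 0 1 rho psi <= (A + e)%:E)%E &
    forall (s : R) x, 0 <= s -> s <= 1 -> `|rho s x - r0 x| <= d].
Proof.
move=> d0 Ad h e0; have C0 := displacement_const_gt0.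
pose e' := Num.min e ((d ^+ 2 - displacement_const * A) / displacement_const).
have e'0 : 0 < e' by rewrite lt_min e0 divr_gt0// subr_gt0.
have [rho [psi [cv rho0 rho1 leA]]] := h _ e'0.
have A0 : 0 <= A + e' by apply: (@joinable_ge0 _ _ _ _ hQ r0 r1); exact: h.
exists rho, psi; split; [exact: cv|exact: rho0|exact: rho1| |].
  by apply: le_trans leA _; rewrite lee_fin lerD2l ge_min lexx.
move=> s x s0 s1; rewrite -rho0.
move: s0; rewrite le_eqVlt => /predU1P[<-|s0].
  by rewrite subrr normr0 ltW.
rewrite -ler_sqr ?nnegrE//; last exact: ltW.
rewrite real_normK ?num_real//; apply: (@le_trans _ _ (displacement_const * (A + e'))).
  have := joinable_sub hQ s0 (curve_onW (lexx 0) s1 cv) (action_on_sub (lexx 0) s1 cv leA).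
  move=> /(joinable_displacement x)/le_trans; apply; rewrite subr0.
  by apply: ler_wpM2l; [exact: ltW|rewrite ler_piMl].
rewrite mulrDr -lerBrDl -ler_pdivlMl// mulrC.
by rewrite ge_min lexx orbT.
Qed.

(** Almost optimal curves stay where [rho <= (1 + eta) * r0], so the norm of [phi] along them
    exceeds the one at [r0] by at most that factor. *)
Lemma sqdist_le_dual (r0 r1 phi : X -> R) (A c eta : R) : 0 < c -> 0 < eta ->
  (forall x, c <= r0 x) -> displacement_const * A < (eta * c) ^+ 2 ->
  sqdist_le Q pi r0 r1 A ->
  (dotp pi phi r1 - dotp pi phi r0) ^+ 2 <= (1 + eta) * gradnorm2 Q pi r0 phi * A.
Proof.
move=> c0 eta0 r0c Ac h; set G := _ * gradnorm2 _ _ _ _; set D := _ ^+ 2.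
have G0 : 0 <= G by rewrite mulr_ge0 ?gradnorm2_ge0//; lra.
apply: (@le_of_affine_bound _ (fun=> D) (G * A) G 1) => //; first exact: cst_continuous.
move=> e e0 _; have ec0 : 0 < eta * c by exact: mulr_gt0.
have [rho [psi [cv rho0 rho1 leA hd]]] := sqdist_le_confined ec0 Ac h e0.
rewrite /D -rho0 -rho1 -mulrDr; apply: (dotp_displacement cv leA) => // s s0 s1.
have e1 : 0 < 1 + eta by lra.
rewrite -ler_pdivrMl//; apply: (ler_gradnorm2 hQ).
- by rewrite invr_ge0 ltW.
- by case: cv => hr _ _ _ x; case: (hr s s0 s1).
- move=> x; rewrite ler_pdivrMl//.
  have := ler_wpM2l (ltW eta0) (r0c x); have := hd s x s0 s1.
  by rewrite ler_norml; lra.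
Qed.

End Displacement.

(** * The gradient estimate with a crude constant, away from the boundary *)

Section LocalGradientEstimate.
Context {R : realType} {X : finType}.
Variables (Q : X -> X -> R) (pi : X -> R).
Hypothesis hQ : reversible_chain Q pi.
Implicit Types (r phi psi f : X -> R).
Notation P := (semigroup Q).
Let one : X -> R := fun=> 1.

Let gradnorm2_one_le f : gradnorm2 Q pi one f <= 2 * total_rate Q * dotp pi f f.
Proof.
have E : \sum_x \sum_y f y ^+ 2 * Q x y * pi x = \sum_x \sum_y f x ^+ 2 * Q x y * pi x.
  rewrite exchange_big/=; apply: eq_bigr => x _; apply: eq_bigr => y _.
  by rewrite -!mulrA (detailed_balance hQ).
apply: (@le_trans _ _ (2 * \sum_x \sum_y f x ^+ 2 * Q x y * pi x)).
  apply: (@le_trans _ _ (\sum_x \sum_y (f x ^+ 2 * Q x y * pi x + f y ^+ 2 * Q x y * pi x))).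
    rewrite /gradnorm2 mulr_sumr; apply: ler_sum => x _; rewrite mulr_sumr; apply: ler_sum => y _.
    rewrite /rhohat /one logmean_refl// mulr1 /grad.
    have -> : 2^-1 * ((f y - f x) ^+ 2 * Q x y * pi x) =
      f x ^+ 2 * Q x y * pi x + f y ^+ 2 * Q x y * pi x - 2^-1 * ((f y + f x) ^+ 2 * Q x y * pi x).
      by field.
    rewrite gerBl mulr_ge0// mulr_ge0 ?(ltW (stationary_gt0 hQ _))//.
    by rewrite mulr_ge0 ?sqr_ge0 ?(rates_ge0 hQ).
  under eq_bigr do rewrite big_split/=.
  by rewrite big_split/= E mulr2n mulrDl mul1r.
rewrite -mulrA ler_pM2l// /dotp mulr_sumr; apply: ler_sum => x _.
rewrite -mulr_suml -mulr_sumr mulrA.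
apply: ler_wpM2r; first exact: ltW (stationary_gt0 hQ x).
by rewrite mulrC -expr2; apply: ler_wpM2r; [exact: sqr_ge0|exact: (sum_rate_le hQ)].
Qed.

Let onsager_one phi x : onsager Q one phi x = - generator Q phi x.
Proof.
congr (- _); apply: eq_bigr => y _.
by rewrite /rhohat /one logmean_refl// mulr1.
Qed.

(** For [f = L phi], [<f, f>] controls the norm of [f], and it is also minus the form of [f] and
    [phi]; Cauchy-Schwarz lets one factor cancel. *)
Let gradnorm2_one_generator phi :
  gradnorm2 Q pi one (generator Q phi) <= (2 * total_rate Q) ^+ 2 * gradnorm2 Q pi one phi.
Proof.
set f := generator Q phi; have M0 := total_rate_ge0 hQ.
have a0 := gradnorm2_ge0 hQ one f; have b0 := gradnorm2_ge0 hQ one phi.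
have d0 : 0 <= dotp pi f f.
  by apply: sumr_ge0 => x _; rewrite mulr_ge0 -?expr2 ?sqr_ge0// ltW// (stationary_gt0 hQ).
have le1 := gradnorm2_one_le f.
have le2 : dotp pi f f ^+ 2 <= gradnorm2 Q pi one f * gradnorm2 Q pi one phi.
  have -> : dotp pi f f = - gradform Q pi one f phi.
    rewrite -(dotp_onsager hQ) => [|x]; last exact: ler01.
    by rewrite /dotp -sumrN; apply: eq_bigr => x _; rewrite onsager_one -/f mulrN mulNr opprK.
  by rewrite sqrrN; exact: gradform_CS.
move: a0; rewrite le_eqVlt => /predU1P[<-|a0].
  by rewrite mulr_ge0 ?sqr_ge0.
rewrite -(ler_pM2l a0); apply: (@le_trans _ _ ((2 * total_rate Q * dotp pi f f) ^+ 2)).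
  rewrite expr2; have a0' := ltW a0; exact: (ler_pM a0' a0' le1 le1).
rewrite exprMn [leRHS]mulrCA; apply: ler_wpM2l => //; exact: sqr_ge0.
Qed.

Let is_derive_gradnorm2_semigroup r psi (t : R) :
  is_derive t 1 (fun t : R => gradnorm2 Q pi r (P t psi))
    (2 * gradform Q pi r (P t psi) (generator Q (P t psi))).
Proof.
have dg x y : is_derive t 1 (fun t => grad (P t psi) x y ^+ 2 * rhohat r x y * Q x y * pi x)
   ((rhohat r x y * Q x y * pi x) * (2 * (grad (P t psi) x y * grad (generator Q (P t psi)) x y))).
  have -> : (fun t => grad (P t psi) x y ^+ 2 * rhohat r x y * Q x y * pi x) =
      (fun t => (rhohat r x y * Q x y * pi x) * (grad (P t psi) x y * grad (P t psi) x y)).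
    by apply/funext => u; ring.
  apply: is_derive_scale.
  have h : is_derive t 1 (fun t => grad (P t psi) x y) (grad (generator Q (P t psi)) x y).
    by apply: is_deriveB; exact: is_derive_semigroup.
  by apply: (is_derive_eq (is_derive_mulr h h)); ring.
rewrite /gradnorm2.
have h := is_derive_scale 2^-1 (is_derive_fsum (index_enum X) (fun x => is_derive_fsum (index_enum X) (fun y => dg x y))).
apply: (is_derive_eq h); rewrite /gradform mulrCA; congr (_ * _).
rewrite mulr_sumr; apply: eq_bigr => x _; rewrite mulr_sumr; apply: eq_bigr => y _.
ring.
Qed.

(** Above [c] the norms at [r] and at the uniform density are comparable, so the generator is
    bounded with constant [K] and a Gronwall argument gives the rate [1 + K]. The summand
    [total_rate Q] pays for replacing [r] by [P t r], which is at least
    [expR (- total_rate Q * t) * r]. *)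
Lemma local_gradient_estimate (c : R) : 0 < c -> exists2 C : R, 0 <= C &
  forall r psi (t : R), density pi r -> (forall x, c <= r x) -> 0 <= t ->
  gradnorm2 Q pi r (P t psi) <= expR (C * t) * gradnorm2 Q pi (P t r) psi.
Proof.
move=> c0; have M0 := total_rate_ge0 hQ; have D1 := density_bound_ge1 hQ.
pose K := density_bound pi * ((2 * total_rate Q) ^+ 2 * c^-1).
have K0 : 0 <= K.
  apply: mulr_ge0; first by lra.
  by apply: mulr_ge0; [exact: sqr_ge0|rewrite invr_ge0 ltW].
exists (1 + K + total_rate Q); first by lra.
move=> r psi t dr rc t0.
have LK phi : gradnorm2 Q pi r (generator Q phi) <= K * gradnorm2 Q pi r phi.
  apply: le_trans (gradnorm2_le_bound hQ _ dr) _; rewrite /K -mulrA.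
  apply: ler_wpM2l; first by lra.
  apply: le_trans (gradnorm2_one_generator phi) _; rewrite -mulrA.
  apply: ler_wpM2l; first exact: sqr_ge0.
  rewrite ler_pdivlMl//; apply: (ler_gradnorm2 hQ); first exact: ltW.
    by move=> x; exact: ler01.
  by move=> x; rewrite mulr1.
pose h (s : R) := expR (- (1 + K) * s) * gradnorm2 Q pi r (P s psi).
have dh (s : R) : is_derive s 1 h (expR (- (1 + K) * s) *
    (2 * gradform Q pi r (P s psi) (generator Q (P s psi)) - (1 + K) * gradnorm2 Q pi r (P s psi))).
  have de : is_derive s 1 (fun s : R => expR (- (1 + K) * s)) (- (1 + K) * expR (- (1 + K) * s)).
    by apply: is_derive_eq; rewrite /GRing.scale/=; ring.
  apply: (is_derive_eq (is_derive_mulr de (is_derive_gradnorm2_semigroup r psi s))); ring.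
have hle : h t <= h 0.
  apply: (@ler0_derive1_nincr _ h 0 t) => //.
  - move=> s _; case: (dh s) => _; rewrite derive1E => ->.
    rewrite pmulr_rle0 ?expR_gt0// subr_le0.
    have := LK (P s psi).
    have := gradnorm2_ge0 hQ r (fun x => 1 * P s psi x + (-1) * generator Q (P s psi) x).
    by rewrite gradnorm2_lin; lra.
  - apply: derivable_within_continuous => s _; by case: (dh s).
have e1 := expR_gt0 ((1 + K) * t); have e2 := expR_gt0 (total_rate Q * t).
have {}hle : gradnorm2 Q pi r (P t psi) <= expR ((1 + K) * t) * gradnorm2 Q pi r psi.
  rewrite -(ler_pdivrMl _ _ e1) -expRN -mulNr; move: hle.
  by rewrite /h mulr0 expR0 mul1r semigroup0; apply.
apply: le_trans hle _.
have -> : expR ((1 + K + total_rate Q) * t) = expR ((1 + K) * t) * expR (total_rate Q * t).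
  by rewrite -expRD -mulrDl.
rewrite -mulrA; apply: ler_wpM2l; first exact: ltW.
rewrite -(ler_pdivrMl _ _ e2) -expRN -mulNr; apply: (ler_gradnorm2 hQ).
- exact: ltW (expR_gt0 _).
- by case: dr.
- by move=> x; apply: (semigroup_ge_expR hQ) => //; case: dr.
Qed.

(** Almost optimal curves are confined to densities above [c / 2], where the crude estimate serves
    as hypothesis of [heat_flow_joinable]. *)
Lemma local_heat_flow (c : R) : 0 < c -> exists2 C : R, 0 <= C &
  forall (r0 r1 : X -> R) (A a b t : R), (forall x, c <= r0 x) ->
  displacement_const Q pi * A < (c / 2) ^+ 2 ->
  0 <= a -> a <= t -> 0 <= b -> b <= t -> 0 < a + b ->
  sqdist_le Q pi r0 r1 A ->
  sqdist_le Q pi (P a r0) (P b r1)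
    (expR (C * t) * A - 2 * (b - a) * (entropy pi (P b r1) - entropy pi (P a r0))).
Proof.
move=> c0; have c20 : 0 < c / 2 by rewrite divr_gt0.
have [C C0 hC] := local_gradient_estimate c20; exists C => //.
move=> r0 r1 A a b t r0c Ac a0 at_ b0 bt ab h e e0.
have E0 := expR_gt0 (C * t).
have [rho [psi [cv rho0 rho1 leA hd]]] := sqdist_le_confined hQ c20 Ac h (divr_gt0 e0 E0).
have hK s f : 0 <= s -> s <= 1 -> gradnorm2 Q pi (rho s) (P ((b - a) * s + a) f) <=
    expR (C * t) * gradnorm2 Q pi (P ((b - a) * s + a) (rho s)) f.
  move=> s0 s1; have tE : (b - a) * s + a = a * (1 - s) + b * s by ring.
  have s1' : 0 <= 1 - s by rewrite subr_ge0.
  have t0 : 0 <= (b - a) * s + a by rewrite tE; apply: addr_ge0; exact: mulr_ge0.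
  have tt : (b - a) * s + a <= t by rewrite tE; nra.
  have rs : density pi (rho s) by case: cv => hr _ _ _; exact: hr.
  have rc x : c / 2 <= rho s x.
    by have := hd s x s0 s1; have := r0c x; rewrite ler_norml; lra.
  apply: le_trans (hC _ f _ rs rc t0) _; apply: ler_wpM2r; first exact: gradnorm2_ge0.
  by rewrite ler_expR; apply: ler_wpM2l.
have := heat_flow_joinable hQ cv leA a0 b0 ab (ltW E0) hK.
rewrite rho0 rho1; apply: joinable_weaken.
by rewrite mulrDr [expR _ * (e / _)]mulrC divfK ?lt0r_neq0// addrAC.
Qed.

End LocalGradientEstimate.

(** One ultrafilter gives the limit at all indices simultaneously, where a subsequence would have to
    depend on the uncountably many [t]. The limit is the supremum of the levels reached for almost
    all [n]. *)
Lemma ultralimit (R : realType) (T : Type) (u : nat -> T -> R) :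
  exists (l : T -> R) (F : set_system nat), [/\ ProperFilter F, \oo `<=` F &
    forall (t : T) (B : R), (forall n, `|u n t| <= B) ->
      forall e : R, 0 < e -> F [set n | `|u n t - l t| < e]].
Proof.
have [F [FU ooF]] := @ultraFilterLemma _ \oo _.
pose S t := [set a : R | F [set n | a <= u n t]].
exists (fun t => sup (S t)), F; split; [exact: ultra_proper|exact: ooF|].
move=> t B uB e e0.
have S_ub : ubound (S t) B.
  move=> a Sa; have [n /= an] := filter_ex Sa.
  by apply: le_trans an _; exact: le_trans (ler_norm _) (uB n).
have S_sup : has_sup (S t).
  split; last by exists B.
  exists (- B); rewrite /S/=; apply: filterS filterT => n _ /=.
  by have := uB n; rewrite ler_norml => /andP[].
have [a Sa la] := sup_adherent e0 S_sup.
have h2 : F (~` [set n | sup (S t) + e / 2 <= u n t]).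
  have [h|//] := in_ultra_setVsetC [set n | sup (S t) + e / 2 <= u n t] FU.
  have := ub_le_sup (ex_intro _ B S_ub) (h : S t _); lra.
apply: filterS (filterI Sa h2) => n /= [an /negP]; rewrite -ltNge => nu.
by rewrite ltr_norml; lra.
Qed.

(** * Existence of geodesics between close points *)

Section Geodesic.
Context {R : realType} {X : finType}.
Variables (Q : X -> X -> R) (pi : X -> R).
Hypothesis hQ : reversible_chain Q pi.
Implicit Types (r : X -> R) (rho psi : R -> X -> R).

Let sqdist_segment (c d a : R) rho psi : c <= d -> curve_on Q pi c d rho psi ->
  action_on Q pi c d rho psi = a%:E -> exists w : R,
  [/\ 0 <= a, 0 <= w, sqdist_le Q pi (rho c) (rho d) (w ^+ 2) & w ^+ 2 <= (d - c) * a].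
Proof.
move=> cd cv aE.
have h : joinable Q pi (rho c) (rho d) ((d - c) * a).
  move: cd; rewrite le_eqVlt => /predU1P[cd|cd].
    move: cv; rewrite -cd subrr mul0r => -[hd _ _ _]; apply: joinable_refl; exact: hd.
  by apply: (joinable_sub hQ cd cv); rewrite aE.
have a0 : 0 <= a.
  by rewrite -lee_fin -aE; apply: integral_ge0 => t _; rewrite lee_fin; exact: gradnorm2_ge0.
have [w hw] := transport_dist_fin hQ h; exists w.
have /(transport_dist_finP hQ)[w0 h1 h2] := hw; split; [exact: a0|exact: w0|exact: h1|].
by apply: h2; exact: joinable_sqdist_le.
Qed.

(* By the triangle inequality and convexity of the square, a curve whose action
   is almost minimal travels at almost constant speed. *)
Let almost_geodesic rho psi (w e s t : R) : 0 <= w -> 0 <= e ->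
  curve_on Q pi 0 1 rho psi -> (action_on Q pi 0 1 rho psi <= (w ^+ 2 + e ^+ 2)%:E)%E ->
  (forall A, sqdist_le Q pi (rho 0) (rho 1) A -> w ^+ 2 <= A) ->
  0 <= s -> s <= t -> t <= 1 ->
  sqdist_le Q pi (rho s) (rho t) (((t - s) * w + e) ^+ 2).
Proof.
move=> w0 e0 cv leA hw s0 st t1.
have s1 := le_trans st t1; have t0 := le_trans s0 st.
have cv1 := curve_onW (lexx 0) s1 cv; have cv23 := curve_onW s0 (lexx 1) cv.
have cv2 := curve_onW s0 t1 cv; have cv3 := curve_onW t0 (lexx 1) cv.
have [_ E1] := curve_on_glue hQ s0 s1 cv1 cv23.
have [_ E2] := curve_on_glue hQ st t1 cv2 cv3.
have fin c d : 0 <= c -> d <= 1 -> action_on Q pi c d rho psi \is a fin_num.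
  move=> c0 d1; rewrite ge0_fin_numE.
    exact: le_lt_trans (action_on_sub hQ c0 d1 cv leA) (ltry _).
  by apply: integral_ge0 => u _; rewrite lee_fin; exact: gradnorm2_ge0.
have /fineK/esym := fin 0 s (lexx _) s1; set a1 := fine _ => Ea1.
have /fineK/esym := fin s t s0 t1; set a2 := fine _ => Ea2.
have /fineK/esym := fin t 1 t0 (lexx _); set a3 := fine _ => Ea3.
have aA : a1 + (a2 + a3) <= w ^+ 2 + e ^+ 2.
  by rewrite -lee_fin !EFinD -Ea1 -Ea2 -Ea3 -E2 -E1.
have [w1 [a10 w10 h1 le1]] := sqdist_segment s0 cv1 Ea1.
have [w2 [a20 w20 h2 le2]] := sqdist_segment st cv2 Ea2.
have [w3 [a30 w30 h3 le3]] := sqdist_segment t1 cv3 Ea3.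
have ww : w <= w1 + (w2 + w3).
  have w123 : 0 <= w1 + (w2 + w3) by rewrite !addr_ge0.
  rewrite -ler_sqr ?nnegrE//; apply: hw.
  apply: (sqdist_le_triangle hQ w10 (addr_ge0 w20 w30) h1).
  exact: (sqdist_le_triangle hQ w20 w30 h2 h3).
have amgm (l a v : R) : 0 <= l -> 0 <= a -> v ^+ 2 <= l * a -> 2 * v * w <= l * w ^+ 2 + a.
  rewrite le_eqVlt => /predU1P[<-|l0] ha.
    rewrite mul0r => v0; have /eqP : v ^+ 2 = 0 by apply/eqP; rewrite eq_le v0 sqr_ge0.
    by rewrite sqrf_eq0 => /eqP ->; rewrite mulr0 !mul0r add0r.
  move=> hv; rewrite -(ler_pM2l l0) -subr_ge0.
  have -> : l * (l * w ^+ 2 + a) - l * (2 * v * w) = (l * w - v) ^+ 2 + (l * a - v ^+ 2) by ring.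
  by rewrite addr_ge0 ?sqr_ge0// subr_ge0.
apply: sqdist_le_weaken h2.
have s0' : 0 <= s - 0 by rewrite subr0.
have t1' : 0 <= 1 - t by rewrite subr_ge0.
have b1 := amgm (s - 0) a1 w1 s0' a10 le1; have b3 := amgm (1 - t) a3 w3 t1' a30 le3.
have ts : 0 <= t - s by rewrite subr_ge0.
have ts0 : 0 <= (t - s) * w by rewrite mulr_ge0.
rewrite ler_sqr ?nnegrE ?addr_ge0//.
(* The outer pieces use at least the action given by [amgm]; what is left for the middle one forces
   [(w2 - (t - s) w)^2 <= e^2]. *)
have a2le : a2 <= e ^+ 2 + 2 * w2 * w - (t - s) * w ^+ 2.
  by have := ler_wpM2r w0 ww; move: b1 b3 aA; lra.
have : (w2 - (t - s) * w) ^+ 2 <= e ^+ 2.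
  have := le_trans le2 (ler_wpM2l ts a2le).
  have : (t - s) * e ^+ 2 <= e ^+ 2 by rewrite ler_piMl ?sqr_ge0//; lra.
  by lra.
have [h|h] := leP w2 ((t - s) * w); first by lra.
by rewrite ler_sqr ?nnegrE ?subr_ge0 ?(ltW h)//; lra.
Qed.

(** Pointwise ultrafilter limit of almost minimal curves. The bounds on the pieces survive since all
    curves stay above [c / 2], where [interior_joinable] turns pointwise closeness into closeness in
    distance. *)
Lemma exists_geodesic (r0 r1 : X -> R) (c w : R) : 0 < c -> (forall x, c <= r0 x) ->
  0 <= w -> displacement_const Q pi * w ^+ 2 < (c / 2) ^+ 2 ->
  sqdist_le Q pi r0 r1 (w ^+ 2) -> (forall A, sqdist_le Q pi r0 r1 A -> w ^+ 2 <= A) ->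
  exists g : R -> X -> R, [/\ g 0 = r0, g 1 = r1,
    (forall s : R, 0 <= s -> s <= 1 -> density pi (g s)),
    (forall (s : R) x, 0 <= s -> s <= 1 -> c / 2 <= g s x) &
    forall s t : R, 0 <= s -> s <= t -> t <= 1 ->
      sqdist_le Q pi (g s) (g t) (((t - s) * w) ^+ 2)].
Proof.
move=> c0 r0c w0 wc h hmin; have c20 : 0 < c / 2 by rewrite divr_gt0.
pose eps n : R := n.+1%:R^-1.
have eps0 n : 0 < eps n by rewrite invr_gt0.
have /choice[rho hrho] n : exists rho, exists psi, [/\ curve_on Q pi 0 1 rho psi, rho 0 = r0,
    rho 1 = r1, (action_on Q pi 0 1 rho psi <= (w ^+ 2 + eps n ^+ 2)%:E)%E &
    forall (s : R) x, 0 <= s -> s <= 1 -> `|rho s x - r0 x| <= c / 2].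
  by apply: (sqdist_le_confined hQ c20 wc h); rewrite exprn_gt0.
have rd n s : 0 <= s -> s <= 1 -> density pi (rho n s).
  by move=> s0 s1; case: (hrho n) => psi [[hd _ _ _] _ _ _ _]; exact: hd.
have rc n s x : 0 <= s -> s <= 1 -> c / 2 <= rho n s x.
  move=> s0 s1; case: (hrho n) => psi [_ _ _ _ hd].
  by have := hd s x s0 s1; have := r0c x; rewrite ler_norml; lra.
have rs n s t : 0 <= s -> s <= t -> t <= 1 ->
    sqdist_le Q pi (rho n s) (rho n t) (((t - s) * w + eps n) ^+ 2).
  move=> s0 st t1; case: (hrho n) => psi [cv e0 e1 leA _].
  apply: (almost_geodesic w0 (ltW (eps0 n)) cv leA) => // A.
  by rewrite e0 e1; exact: hmin.
have [l [F [FF ooF hl]]] := ultralimit (fun n (p : R * X) => rho n p.1 p.2).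
pose g (s : R) x := l (s, x).
have near s : 0 <= s -> s <= 1 -> forall e : R, 0 < e ->
    F [set n | forall x, `|rho n s x - g s x| < e].
  move=> s0 s1 e e0; have h1 x : F [set n | `|rho n s x - g s x| < e].
    apply: (hl (s, x) (density_bound pi)) => // n /=.
    rewrite ger0_norm; last by case: (rd n s s0 s1).
    exact: (density_le_bound hQ) (rd n s s0 s1).
  exact: filter_forall.
have eq_of_close (a b : R) : (forall e : R, 0 < e -> `|a - b| < e) -> a = b.
  move=> hab; apply/eqP; rewrite -subr_eq0 -normr_le0; apply/ler_addgt0Pr => e e0.
  by rewrite add0r ltW// hab.
have gc s x : 0 <= s -> s <= 1 -> c / 2 <= g s x.
  move=> s0 s1; apply/ler_addgt0Pr => e e0.
  have [n /= /(_ x)] := filter_ex (near s s0 s1 e e0).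
  by have := rc n s x s0 s1; rewrite ltr_norml; lra.
have gd s : 0 <= s -> s <= 1 -> density pi (g s).
  move=> s0 s1; split; first by move=> x; apply: le_trans (gc s x s0 s1); exact: ltW.
  apply: eq_of_close => e e0.
  have e20 : 0 < e / 2 by rewrite divr_gt0.
  have [n /= hn] := filter_ex (near s s0 s1 _ e20).
  case: (rd n s s0 s1) => _ <-; rewrite -sumrB; apply: le_lt_trans (ler_norm_sum _ _ _) _.
  apply: (@le_lt_trans _ _ (\sum_x e / 2 * pi x)); last first.
    by rewrite -mulr_sumr (stationary_sum1 hQ) mulr1; lra.
  apply: ler_sum => x _; have px := ltW (stationary_gt0 hQ x).
  by rewrite -mulrBl normrM (ger0_norm px); apply: ler_wpM2r => //; rewrite distrC ltW.
exists g; split.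
- apply/funext => x; apply: eq_of_close => e e0.
  have [n /= /(_ x)] := filter_ex (near 0 (lexx _) ler01 e e0).
  by case: (hrho n) => psi [_ -> _ _ _]; rewrite distrC.
- apply/funext => x; apply: eq_of_close => e e0.
  have [n /= /(_ x)] := filter_ex (near 1 ler01 (lexx _) e e0).
  by case: (hrho n) => psi [_ _ -> _ _]; rewrite distrC.
- exact: gd.
- exact: gc.
move=> s t s0 st t1; have s1 := le_trans st t1; have t0 := le_trans s0 st.
have [C C0 hC] := interior_joinable hQ c20.
have close r r' d : density pi r -> density pi r' -> (forall x, c / 2 <= r x) ->
    (forall x, c / 2 <= r' x) -> (forall x, `|r' x - r x| < d) -> 0 < d ->
    sqdist_le Q pi r r' (((C + 1) * d) ^+ 2).
  move=> dr dr' cr cr' hd d0.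
  apply: (@sqdist_le_weaken _ _ _ _ _ _ (C * d ^+ 2)).
    rewrite exprMn; apply: ler_wpM2r; first exact: sqr_ge0.
    by nra.
  by apply: joinable_sqdist_le; apply: hC => // x; exact: ltW.
set a := (t - s) * w; have a0 : 0 <= a by rewrite mulr_ge0// subr_ge0.
apply: sqdist_le_closed => e e0.
have a20 : 0 < 2 * a + 1 by lra.
(* The hops from [g s] to [rho n s] and from [rho n t] to [g t] and the defect [eps n] add at most
   [d0] to the length [a], hence at most [e] to its square. *)
pose d0 := Num.min 1 (e / (2 * a + 1)).
have d00 : 0 < d0 by rewrite lt_min ltr01 divr_gt0.
pose d := d0 / (4 * (C + 1)).
have dp : 0 < d by rewrite divr_gt0// mulr_gt0//; lra.
have [N hN] : exists N, d0^-1 * 2 < N.+1%:R.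
  by exists (Num.truncn (d0^-1 * 2)); exact: truncnS_gt.
have hoo : F [set n | (N <= n)%N] by apply: ooF; exists N.
have [n /= [[Nn hs] ht]] := filter_ex (filterI (filterI hoo (near s s0 s1 d dp)) (near t t0 t1 d dp)).
have epsn : eps n <= d0 / 2.
  rewrite -[d0 / 2]invrK lef_pV2 ?posrE ?invr_gt0 ?divr_gt0// invf_div mulrC.
  by apply: le_trans (ltW hN) _; rewrite ler_nat ltnS.
have k0 : 0 <= (C + 1) * d by rewrite mulr_ge0 ?ltW//; lra.
have h1 := close _ _ d (gd s s0 s1) (rd n s s0 s1) (fun x => gc s x s0 s1) (fun x => rc n s x s0 s1) hs dp.
have h3 := close _ _ d (rd n t t0 t1) (gd t t0 t1) (fun x => rc n t x t0 t1) (fun x => gc t x t0 t1) _ dp.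
have {}h3 : sqdist_le Q pi (rho n t) (g t) (((C + 1) * d) ^+ 2).
  by apply: h3 => x; rewrite distrC.
have ae0 : 0 <= a + eps n by rewrite addr_ge0// ltW.
apply: sqdist_le_weaken (sqdist_le_triangle hQ k0 (addr_ge0 ae0 k0) h1
  (sqdist_le_triangle hQ ae0 k0 (rs n s t s0 st t1) h3)).
have kE : (C + 1) * d = d0 / 4 by rewrite /d; field; apply: lt0r_neq0; lra.
set k := (C + 1) * d in kE k0 *.
have : d0 <= 1 by rewrite ge_min lexx.
have : d0 * (2 * a + 1) <= e by rewrite -ler_pdivlMr// ge_min lexx orbT.
have -> : k + (a + eps n + k) = a + (2 * k + eps n) by ring.
have : 0 <= 2 * k + eps n by apply: addr_ge0; [exact: mulr_ge0|exact: ltW].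
have : 2 * k + eps n <= d0 by rewrite kE; lra.
move: (2 * k + eps n) => h' h'd h'0 d0e d01.
have : h' * (2 * a + 1) <= d0 * (2 * a + 1) by apply: ler_wpM2r => //; exact: ltW.
by nra.
Qed.

(** Upper bounds on all pieces force equality: a shorter piece would, by the triangle inequality,
    contradict the minimality of [w]. *)
Lemma constant_speed_geodesic_of_sqdist_le (g : R -> X -> R) (w : R) : 0 <= w ->
  (forall s : R, 0 <= s -> s <= 1 -> density pi (g s)) ->
  (forall s t : R, 0 <= s -> s <= t -> t <= 1 ->
     sqdist_le Q pi (g s) (g t) (((t - s) * w) ^+ 2)) ->
  (forall A, sqdist_le Q pi (g 0) (g 1) A -> w ^+ 2 <= A) ->
  constant_speed_geodesic Q pi g /\ transport_dist Q pi (g 0) (g 1) = w%:E.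
Proof.
move=> w0 gd gs hmin.
have key s t : 0 <= s -> s <= t -> t <= 1 ->
    transport_dist Q pi (g s) (g t) = ((t - s) * w)%:E /\
    transport_dist Q pi (g t) (g s) = ((t - s) * w)%:E.
  move=> s0 st t1; have s1 := le_trans st t1; have t0 := le_trans s0 st.
  have ts0 : 0 <= (t - s) * w by rewrite mulr_ge0// subr_ge0.
  have low A : sqdist_le Q pi (g s) (g t) A -> ((t - s) * w) ^+ 2 <= A.
    move=> hA; have A0 := sqdist_le_ge0 hQ hA.
    rewrite -[A]sqr_sqrtr// ler_sqr ?nnegrE ?sqrtr_ge0//.
    have v0 := sqrtr_ge0 A; rewrite -[A]sqr_sqrtr// in hA.
    have a0 : 0 <= (s - 0) * w by rewrite subr0 mulr_ge0.
    have b0 : 0 <= (1 - t) * w by rewrite mulr_ge0// subr_ge0.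
    have := hmin _ (sqdist_le_triangle hQ a0 (addr_ge0 v0 b0) (gs 0 s (lexx _) s0 s1)
      (sqdist_le_triangle hQ v0 b0 hA (gs t 1 t0 t1 (lexx _)))).
    by rewrite ler_sqr ?nnegrE ?addr_ge0//; lra.
  split; apply/(transport_dist_finP hQ); split.
  - exact: ts0.
  - exact: gs.
  - exact: low.
  - exact: ts0.
  - by apply: (sqdist_le_sym hQ); exact: gs.
  - by move=> A /(sqdist_le_sym hQ); exact: low.
have w01 : transport_dist Q pi (g 0) (g 1) = w%:E.
  by have [-> _] := key 0 1 (lexx _) ler01 (lexx _); rewrite subr0 mul1r.
split; last exact: w01.
split; first by move=> t; rewrite in_itv/= => /andP[t0 t1]; exact: gd.
move=> s t; rewrite !in_itv/= => /andP[s0 s1] /andP[t0 t1]; rewrite w01 -EFinM.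
have [st|/ltW ts] := leP s t.
  by have [-> _] := key s t s0 st t1; rewrite distrC ger0_norm ?subr_ge0.
by have [_ ->] := key t s t0 ts s1; rewrite ger0_norm ?subr_ge0.
Qed.

End Geodesic.

(** * Exponential contraction of the heat flow *)

Section Contraction.
Context {R : realType} {X : finType}.
Variables (Q : X -> X -> R) (pi : X -> R) (kappa : R).
Hypothesis hQ : reversible_chain Q pi.
Hypothesis hRic : entropic_Ric_ge Q pi kappa.
Implicit Types (r : X -> R).
Notation P := (semigroup Q).

(** By convexity the loss is at most the slope at [r], bounded as [r >= c], times the displacement
    under the flow, linear in [t]. *)
Let entropy_drop (c : R) : 0 < c -> exists2 C : R, 0 <= C & forall r (t : R),
  density pi r -> (forall x, c <= r x) -> 0 <= t ->
  entropy pi r - entropy pi (P t r) <= C * t.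
Proof.
move=> c0; have D1 := density_bound_ge1 hQ; have M0 := total_rate_ge0 hQ.
pose L := `|ln c| + `|ln (density_bound pi)| + 1.
have L0 : 0 <= L by rewrite !addr_ge0.
pose N := 2 * density_bound pi * total_rate Q.
have N0 : 0 <= N by rewrite mulr_ge0//; lra.
exists (N * L); first exact: mulr_ge0.
move=> r t dr rc t0; rewrite -[leRHS]mul1r -(stationary_sum1 hQ) mulr_suml /entropy -sumrB.
apply: ler_sum => x _.
have -> : pi x * r x * ln (r x) - pi x * P t r x * ln (P t r x) =
  pi x * (r x * ln (r x) - P t r x * ln (P t r x)) by rewrite mulrBr !mulrA.
apply: ler_wpM2l; first exact: ltW (stationary_gt0 hQ x).
have rx : 0 < r x by apply: lt_le_trans (rc x).
have y0 : 0 <= P t r x by apply: (semigroup_ge0 hQ) => //; case: dr.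
apply: le_trans (xlnx_convex rx y0) _; apply: le_trans (ler_norm _) _.
rewrite normrM; have -> : N * L * t = (N * t) * L by rewrite mulrAC.
apply: ler_pM => //.
  rewrite distrC.
  have hN y : `|r y| <= density_bound pi.
    by rewrite ger0_norm; [exact: (density_le_bound hQ)|case: dr].
  by have := semigroup_lipschitz hQ x hN (lexx 0) t0; rewrite semigroup0 subr0.
apply: le_trans (ler_normD _ _) _; rewrite normr1 lerD2r.
have l1 : ln c <= ln (r x) by rewrite ler_ln ?posrE.
have l2 : ln (r x) <= ln (density_bound pi).
  by rewrite ler_ln ?posrE//; [exact: (density_le_bound hQ)|lra].
rewrite ler_norml; have := ler_norm (ln (density_bound pi)); have := ler_norm (- ln c).
by rewrite normrN => ? ?; apply/andP; split;
  have := normr_ge0 (ln c); have := normr_ge0 (ln (density_bound pi)); lra.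
Qed.

(* Join P_t r0 to P_t r1 through the points of a geodesic at times s and 1 - s,
   with heat applied on the two short end pieces only: the crude local constant
   of [local_heat_flow] then costs O(s t), and the convexity of the entropy along
   the geodesic gives the factor 1 - 2 kappa t. *)
Lemma one_step_contraction (c : R) : 0 < c -> exists2 A0 : R, 0 < A0 &
  forall eta : R, 0 < eta -> exists2 d : R, 0 < d & forall (r0 r1 : X -> R) (A t : R),
    density pi r0 -> density pi r1 -> (forall x, c <= r0 x) -> (forall x, c <= r1 x) ->
    A <= A0 -> sqdist_le Q pi r0 r1 A -> 0 < t -> t <= d ->
    sqdist_le Q pi (P t r0) (P t r1) (expR (- 2 * kappa * t) * A + eta * t).
Proof.
move=> c0; have D0 := displacement_const_gt0 hQ.
pose A0 := (c / 2) ^+ 2 / (2 * displacement_const Q pi).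
have A00 : 0 < A0 by rewrite divr_gt0// ?exprn_gt0 ?divr_gt0// mulr_gt0.
have [C C0 hC] := local_heat_flow hQ c0.
have [B B0 hB] := entropy_drop c0.
exists A0 => // eta eta0.
(* Order of the constants: [s] makes the errors of order [s t] at most [eta * t / 2]; then [d] does
   the same for the entropy loss, of order [t^2 / s]. *)
pose K := (4 * C + 2 * `|kappa|) * A0 + 1.
have Ck0 : 0 <= 4 * C + 2 * `|kappa| by rewrite addr_ge0// mulr_ge0.
have K0 : 0 < K by apply: ltr_wpDl => //; apply: mulr_ge0 => //; exact: ltW.
pose s := Num.min 4^-1 (eta / (2 * K)).
have s0 : 0 < s by rewrite lt_min invr_gt0 ltr0n/= divr_gt0// mulr_gt0.
have s14 : s <= 4^-1 by rewrite ge_min lexx.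
have sK : s * (2 * K) <= eta by rewrite -ler_pdivlMr ?mulr_gt0// ge_min lexx orbT.
pose d := Num.min (2 * (C + 1))^-1 (eta * s / (8 * (B + 1))).
have C1 : 0 < 2 * (C + 1) by lra.
have B1 : 0 < 8 * (B + 1) by lra.
have d0 : 0 < d by rewrite lt_min invr_gt0 C1/= divr_gt0// mulr_gt0.
exists d => // r0 r1 A t dr0 dr1 cr0 cr1 AA0 h t0 td.
have tC : t * (2 * (C + 1)) <= 1.
  by rewrite -ler_pdivlMr// div1r (le_trans td)// ge_min lexx.
have tB : t * (8 * (B + 1)) <= eta * s.
  by rewrite -ler_pdivlMr// (le_trans td)// ge_min lexx orbT.
have [w hw] := transport_dist_fin hQ (h 1 ltr01).
have /(transport_dist_finP hQ)[w0 hw2 hmin] := hw.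
have wA : w ^+ 2 <= A := hmin _ h.
have wA0 : w ^+ 2 <= A0 := le_trans wA AA0.
have conf (u : R) : 0 <= u -> u <= 1 -> displacement_const Q pi * (u * w) ^+ 2 < (c / 2) ^+ 2.
  move=> u0 u1; have cc : 0 < (c / 2) ^+ 2 by rewrite exprn_gt0// divr_gt0.
  have : displacement_const Q pi * w ^+ 2 <= (c / 2) ^+ 2 / 2.
    rewrite -ler_pdivlMl//; apply: le_trans wA0 _; rewrite /A0 le_eqVlt; apply/orP; left.
    by apply/eqP; field; exact: lt0r_neq0.
  have : (u * w) ^+ 2 <= w ^+ 2 by rewrite exprMn ler_piMl ?sqr_ge0// expr_le1.
  move=> /(ler_wpM2l (ltW D0)); lra.
have conf1 := conf 1 ler01 (lexx _); rewrite mul1r in conf1.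
have [g [g0 g1 gd gc gs]] := exists_geodesic hQ c0 cr0 w0 conf1 hw2 hmin.
have gmin A' : sqdist_le Q pi (g 0) (g 1) A' -> w ^+ 2 <= A' by rewrite g0 g1; exact: hmin.
have [gg gw] := constant_speed_geodesic_of_sqdist_le hQ w0 gd gs gmin.
have convex u : 0 <= u -> u <= 1 -> entropy pi (g u) <=
    (1 - u) * entropy pi r0 + u * entropy pi r1 - kappa / 2 * u * (1 - u) * w ^+ 2.
  move=> u0 u1; have := hRic gg (_ : u \in `[0, 1]); rewrite in_itv/= u0 u1 => /(_ isT).
  by rewrite gw -!EFinM -EFinB lee_fin g0 g1 -expr2.
have s12 : s < 1 - s by lra.
have s1 : s <= 1 by lra.
have s1' : 1 - s <= 1 by lra.
have s0' : 0 <= 1 - s by lra.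
have tt0 : 0 < t + 0 by rewrite addr0.
have h1 : sqdist_le Q pi r0 (g s) ((s * w) ^+ 2).
  by have := gs 0 s (lexx _) (ltW s0) s1; rewrite g0 subr0.
have h2 : sqdist_le Q pi (g s) (g (1 - s)) (((1 - 2 * s) * w) ^+ 2).
  have -> : 1 - 2 * s = (1 - s) - s by ring.
  by apply: gs => //; exact: ltW.
have h3 : sqdist_le Q pi r1 (g (1 - s)) ((s * w) ^+ 2).
  apply: (sqdist_le_sym hQ); have := gs (1 - s) 1 s0' s1' (lexx _); rewrite g1.
  by have -> : 1 - (1 - s) = s by ring.
have cs := conf s (ltW s0) s1.
have {}h1 := hC _ _ _ _ _ t cr0 cs (ltW t0) (lexx _) (lexx 0) (ltW t0) tt0 h1.
have {}h3 := hC _ _ _ _ _ t cr1 cs (ltW t0) (lexx _) (lexx 0) (ltW t0) tt0 h3.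
rewrite semigroup0 in h1; rewrite semigroup0 in h3.
have ss0 : 0 < 1 - s by lra.
(* The three pieces get the shares [s], [1 - 2 s], [s] of the time, as on the geodesic; [l] is the
   share of the middle one in the last [1 - s]. *)
pose l := (1 - 2 * s) / (1 - s).
have l0 : 0 < l by rewrite divr_gt0//; lra.
have l1 : l < 1 by rewrite ltr_pdivrMr// mul1r; lra.
have ss1 : s < 1 by lra.
have := sqdist_le_trans hQ s0 ss1 h1 (sqdist_le_trans hQ l0 l1 h2 (sqdist_le_sym hQ h3)).
apply: sqdist_le_weaken.
have v1 := convex s (ltW s0) s1; have v2 := convex (1 - s) s0' s1'.
have e1 := hB r0 t dr0 cr0 (ltW t0); have e2 := hB r1 t dr1 cr1 (ltW t0).
move: v1 v2 e1 e2.
move: (entropy pi (g s)) (entropy pi (g (1 - s))) (entropy pi (P t r0)) (entropy pi (P t r1)) => Hs Hs' HP0 HP1.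
move: (entropy pi r0) (entropy pi r1) => H0 H1 v1 v2 e1 e2.
set e := expR (C * t).
have ele : e - 1 <= 2 * (C * t).
  have Ct0 : 0 <= C * t by rewrite mulr_ge0// ltW.
  by have := expR_le_quad (_ : C * t <= 2^-1); rewrite -/e => /(_ ltac:(lra)); nra.
apply: (@le_trans _ _ (w ^+ 2 * (1 + 2 * s * (e - 1)) + 2 * t / s * (Hs + Hs' - HP0 - HP1))).
  have -> : 1 - l = s / (1 - s) by rewrite /l; field; exact: lt0r_neq0.
  rewrite /l le_eqVlt; apply/orP; left; apply/eqP; field.
  by rewrite !lt0r_neq0//; lra.
have S_le : Hs + Hs' - HP0 - HP1 <= 2 * B * t - kappa * s * (1 - s) * w ^+ 2 by lra.
have ts0 : 0 <= 2 * t / s by rewrite divr_ge0// ?mulr_ge0// ltW.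
have {}S_le : 2 * t / s * (Hs + Hs' - HP0 - HP1) <=
    t * (4 * B * t / s) - 2 * t * kappa * (1 - s) * w ^+ 2.
  apply: le_trans (ler_wpM2l ts0 S_le) _; rewrite le_eqVlt; apply/orP; left; apply/eqP.
  by field; exact: lt0r_neq0.
have Bs : t * (4 * B * t / s) <= t * (eta / 2).
  by apply: ler_wpM2l; [exact: ltW|rewrite ler_pdivrMr//; lra].
have w20 : 0 <= w ^+ 2 := sqr_ge0 w.
have es : w ^+ 2 * (2 * s * (e - 1)) <= t * (w ^+ 2 * s * (4 * C)).
  have ws : 0 <= w ^+ 2 * (2 * s) by rewrite mulr_ge0// mulr_ge0// ltW.
  by have := ler_wpM2l ws ele; lra.
have wK : t * (w ^+ 2 * s * (4 * C + 2 * `|kappa|)) <= t * (eta / 2).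
  apply: ler_wpM2l; first exact: ltW.
  have : w ^+ 2 * (4 * C + 2 * `|kappa|) <= K.
    have := ler_wpM2r Ck0 wA0; rewrite /K; lra.
  by move=> /(ler_wpM2l (ltW s0)); lra.
have ks : t * (w ^+ 2 * s * (2 * kappa)) <= t * (w ^+ 2 * s * (2 * `|kappa|)).
  apply: ler_wpM2l; first exact: ltW.
  apply: ler_wpM2l; first by rewrite mulr_ge0// ltW.
  by rewrite ler_pM2l// ler_norm.
have exp1 : (1 + - 2 * kappa * t) * w ^+ 2 <= expR (- 2 * kappa * t) * A.
  apply: (@le_trans _ _ (expR (- 2 * kappa * t) * w ^+ 2)).
    by apply: ler_wpM2r => //; exact: expR_ge1Dx.
  by apply: ler_wpM2l => //; exact: expR_ge0.
move: S_le Bs es wK ks exp1.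
move: (t * (4 * B * t / s)) (2 * t / s * _) (expR _ * A) => u1 u2 u3.
lra.
Qed.

(** Iterates the short step. The lower bound [c] persists under the flow, and [E] bounds the growth
    possible for negative [kappa], so the bound on [A] keeps every step in range. The errors add up
    to at most [eta * E * E * T]. *)
Lemma contraction (c T : R) : 0 < c -> 0 < T -> exists2 A1 : R, 0 < A1 &
  forall (r0 r1 : X -> R) (A : R), density pi r0 -> density pi r1 ->
    (forall x, c <= r0 x) -> (forall x, c <= r1 x) -> A <= A1 ->
    sqdist_le Q pi r0 r1 A ->
    sqdist_le Q pi (P T r0) (P T r1) (expR (- 2 * kappa * T) * A).
Proof.
move=> c0 T0; have [A0 A00 hA0] := one_step_contraction c0.
pose E := expR (2 * `|kappa| * T).
have E0 : 0 < E := expR_gt0 _.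
have expE u : 0 <= u -> u <= T -> expR (- 2 * kappa * u) <= E.
  move=> u0 uT; rewrite ler_expR; have := ler_norm (- kappa); rewrite normrN => h.
  by have := normr_ge0 kappa; nra.
have expE' u : 0 <= u -> u <= T -> 1 <= expR (- 2 * kappa * u) * E.
  move=> u0 uT; rewrite -expRD -[leLHS]expR0 ler_expR; have := ler_norm kappa => h.
  by have := normr_ge0 kappa; nra.
exists (A0 / (2 * E)); first by rewrite divr_gt0// mulr_gt0.
move=> r0 r1 A d0 d1 cr0 cr1 AA1 h; apply: sqdist_le_closed => e e0.
have A_ge0 := sqdist_le_ge0 hQ h.
have AE : E * A <= A0 / 2.
  by move: AA1; rewrite ler_pdivlMr ?mulr_gt0//; lra.
have EET : 0 < E * E * T by rewrite !mulr_gt0.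
pose eta := Num.min (e / (E * E * T)) (A0 / 2 / (E * E * T)).
have eta0 : 0 < eta by rewrite lt_min !divr_gt0.
have etae : eta * (E * E * T) <= e by rewrite -ler_pdivlMr// ge_min lexx.
have etaA : eta * (E * E * T) <= A0 / 2 by rewrite -ler_pdivlMr// ge_min lexx orbT.
have [d dp hd] := hA0 _ eta0.
have [n hn] : exists n, T / d < n.+1%:R by exists (Num.truncn (T / d)); exact: truncnS_gt.
pose t := T / n.+1%:R.
have n0 : (0 : R) < n.+1%:R by rewrite ltr0n.
have t0 : 0 < t by rewrite divr_gt0.
have td : t <= d by rewrite ler_pdivrMr// mulrC -ler_pdivrMr// ltW.
have tn : t * n.+1%:R = T by rewrite divfK// lt0r_neq0.
have tk_le k : (k <= n.+1)%N -> t * k%:R <= T.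
  by move=> kn; rewrite -tn ler_pM2l// ler_nat.
have tk_ge0 k : 0 <= t * k%:R by rewrite mulr_ge0// ltW.
have step k : (k <= n.+1)%N -> sqdist_le Q pi (P (t * k%:R) r0) (P (t * k%:R) r1)
    (expR (- 2 * kappa * (t * k%:R)) * (A + eta * E * (t * k%:R))).
  elim: k => [_|k ih kn]; first by rewrite !mulr0 expR0 mul1r addr0 !semigroup0.
  have kn' := ltnW kn; set u := t * k%:R in ih *.
  have u0 : 0 <= u := tk_ge0 k; have uT : u <= T := tk_le k kn'.
  have uS : t * k.+1%:R = t + u by rewrite -natr1 mulrDr mulr1 addrC.
  have vT : t + u <= T by rewrite -uS; exact: tk_le.
  have v0 : 0 <= t + u by rewrite addr_ge0// ltW.
  have smallA : expR (- 2 * kappa * u) * (A + eta * E * u) <= A0.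
    have Eu : eta * E * u <= eta * E * T by apply: ler_wpM2l => //; rewrite mulr_ge0// ltW.
    have p0 : 0 <= A + eta * E * u by rewrite addr_ge0// !mulr_ge0// ltW.
    apply: le_trans (ler_wpM2r p0 (expE u u0 uT)) _.
    have := ler_wpM2l (ltW E0) Eu; lra.
  have g0 x : c <= P u r0 x by exact: (semigroup_ge hQ).
  have g1 x : c <= P u r1 x by exact: (semigroup_ge hQ).
  have := hd _ _ _ t (semigroup_density hQ u0 d0) (semigroup_density hQ u0 d1) g0 g1 smallA (ih kn') t0 td.
  rewrite uS !semigroup_add; apply: sqdist_le_weaken.
  have -> : expR (- 2 * kappa * t) * (expR (- 2 * kappa * u) * (A + eta * E * u)) =
      expR (- 2 * kappa * (t + u)) * (A + eta * E * u) by rewrite mulrA -expRD -mulrDr.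
  have := ler_wpM2l (_ : 0 <= eta * t) (expE' _ v0 vT).
  by rewrite mulr_ge0 ?(ltW eta0) ?(ltW t0)// => /(_ isT); lra.
have := step n.+1 (leqnn _); rewrite tn; apply: sqdist_le_weaken.
rewrite mulrDr lerD2l; apply: le_trans etae.
have eT0 : 0 <= eta * E * T by rewrite !mulr_ge0// ltW.
by have := ler_wpM2r eT0 (expE T (ltW T0) (lexx _)); lra.
Qed.

End Contraction.

(** [e] is the inverse of one plus all required ratios; since [e <= 1], also [e ^+ 2 <= e], which
    makes the quadratic conditions linear. *)
Lemma small_perturbation (R : realFieldType) (N G D A b : R) : 0 <= N -> 0 <= G ->
  0 <= D -> 0 < A -> 0 < b ->
  exists e : R, [/\ 0 < e, e * N <= b, e ^+ 2 * G <= A & D * (e ^+ 2 * G) < b ^+ 2].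
Proof.
move=> N0 G0 D0 A0 b0; have b20 : 0 < b ^+ 2 by rewrite exprn_gt0.
pose a1 := N / b; pose a2 := G / A; pose a3 := D * G / b ^+ 2.
have a10 : 0 <= a1 by rewrite divr_ge0// ltW.
have a20 : 0 <= a2 by rewrite divr_ge0// ltW.
have a30 : 0 <= a3 by rewrite divr_ge0 ?mulr_ge0// ltW.
pose e := (1 + a1 + a2 + a3)^-1.
have e0 : 0 < e by rewrite invr_gt0; lra.
have eS : e * (1 + a1 + a2 + a3) = 1 by rewrite mulVf// lt0r_neq0//; lra.
have e2 : e ^+ 2 <= e by rewrite expr2 ler_piMl ?(ltW e0)// invf_le1; lra.
have h1 : e * a1 <= 1 by nra.
have h2 : e * a2 <= 1 by nra.
have h3 : e * a3 < 1 by nra.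
clearbody e; exists e; split; first exact: e0.
- by move: h1; rewrite /a1 mulrA ler_pdivrMr// mul1r.
- apply: le_trans (ler_wpM2r G0 e2) _.
  by move: h2; rewrite /a2 mulrA ler_pdivrMr// mul1r.
- rewrite mulrCA; apply: (@le_lt_trans _ _ (e * (D * G))).
    by apply: ler_wpM2r => //; exact: mulr_ge0.
  by move: h3; rewrite /a3 mulrA ltr_pdivrMr// mul1r.
Qed.

Section ConvexityImpliesGradientEstimate.
Context {R : realType} {X : finType}.
Variables (Q : X -> X -> R) (pi : X -> R) (kappa : R).
Hypothesis hQ : reversible_chain Q pi.
Hypothesis hRic : entropic_Ric_ge Q pi kappa.
Implicit Types (r psi : X -> R).
Notation P := (semigroup Q).

(* Apply the contraction to r and r + e * onsager r (P_T psi), and let e -> 0. *)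
Let interior_gradient_estimate (c T : R) r psi : 0 < c -> density pi r ->
  (forall x, c <= r x) -> 0 < T ->
  gradnorm2 Q pi r (P T psi) <= expR (- 2 * kappa * T) * gradnorm2 Q pi (P T r) psi.
Proof.
move=> c0 dr rc T0; set phi := P T psi; set G := gradnorm2 _ _ r phi.
set k := expR _; set g := gradnorm2 _ _ _ psi.
have G0 : 0 <= G := gradnorm2_ge0 hQ _ _.
have g0 : 0 <= g := gradnorm2_ge0 hQ _ _.
have k0 : 0 < k := expR_gt0 _.
have r0 x : 0 <= r x by case: dr.
have rp x : 0 < r x := lt_le_trans c0 (rc x).
suff : G ^+ 2 <= k * g * G.
  move: G0; rewrite le_eqVlt => /predU1P[<- _|Gp]; first by rewrite mulr_ge0// ltW.
  by rewrite expr2 ler_pM2r.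
have -> : G ^+ 2 = G ^+ 2 * (1 - 0) by rewrite subr0 mulr1.
(* The relative error [eta] enters twice, from the segment and from the dual bound, in the form
   [G^2 (1 - eta) <= (1 + eta) k g G]. *)
apply: (@le_of_affine_bound _ (fun e : R => G ^+ 2 * (1 - e)) _ (k * g * G) 2^-1).
- by rewrite invr_gt0.
- by apply: cvgM; [exact: cvg_cst|apply: cvgB; [exact: cvg_cst|exact: cvg_id]].
move=> eta eta0 eta2 /=; have eta1 : 0 < 1 - eta by lra.
have c20 : 0 < c / 2 by rewrite divr_gt0.
have [A1 A10 hA1] := contraction hQ hRic c20 T0.
have D0 := displacement_const_gt0 hQ.
pose v := onsager Q r phi.
pose N := \sum_x `|v x|.
have N0 : 0 <= N by apply: sumr_ge0.
have vN x : `|v x| <= N by rewrite /N (bigD1 x)//= lerDl sumr_ge0.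
have ec0 : 0 < eta * c by rewrite mulr_gt0.
have G1 : 0 <= G / (1 - eta) by apply: divr_ge0; [exact: G0|exact: ltW].
have Dk : 0 <= displacement_const Q pi * k by apply: mulr_ge0; exact: ltW.
have [e [e0 ea1 AA1 Ac]] := small_perturbation N0 G1 Dk A10 ec0.
pose sigma x := r x + e * v x.
have sr x : (1 - eta) * r x <= sigma x.
  have : `|e * v x| <= eta * c.
    by rewrite normrM (gtr0_norm e0); apply: le_trans ea1; apply: ler_wpM2l => //; exact: ltW.
  rewrite ler_norml /sigma => /andP[h _].
  by have := ler_wpM2l (ltW eta0) (rc x); lra.
have sc x : c / 2 <= sigma x.
  by apply: le_trans (sr x); have := rc x; nra.
have rc2 x : c / 2 <= r x by have := rc x; lra.
have ds : density pi sigma.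
  split=> [x|]; first by apply: le_trans (sc x); exact: ltW.
  under eq_bigr do rewrite mulrDl -mulrA.
  by rewrite big_split/= -mulr_sumr (onsager_mean0 hQ)// mulr0 addr0; case: dr.
have rr x : (1 - eta) * r x <= r x by rewrite ler_piMl//; lra.
have ons x : onsager Q r (fun y => e * phi y) x = sigma x - r x.
  by rewrite onsagerZ /sigma addrC addKr.
have h := interpolation_joinable hQ dr ds eta1 rp rr sr ons.
rewrite gradnorm2Z -/G -mulrA in h.
have {}h := hA1 _ _ _ dr ds rc2 sc AA1 (joinable_sqdist_le h).
have Pc x : c <= P T r x by apply: (semigroup_ge hQ) => //; exact: ltW.
rewrite -mulrA in Ac.
have := sqdist_le_dual hQ psi c0 eta0 Pc Ac h.
rewrite !(dotp_semigroup hQ) -/phi -/g.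
(* By symmetry of the semigroup, [psi] tested on the flowed densities is [phi] tested on the
   original ones, and the perturbation has velocity [onsager Q r phi]. *)
have -> : dotp pi phi sigma - dotp pi phi r = e * G.
  rewrite /G gradnorm2E -(dotp_onsager hQ)// /dotp -sumrB mulr_sumr.
  by apply: eq_bigr => x _; rewrite /sigma /v; ring.
rewrite exprMn => {}h; have e20 : 0 < e ^+ 2 by rewrite exprn_gt0.
rewrite -(ler_pM2l e20) mulrA -ler_pdivlMr//; apply: le_trans h _.
rewrite le_eqVlt; apply/orP; left; apply/eqP; field; exact: lt0r_neq0.
Qed.

Lemma convex_gradient_estimate psi r (t : R) : density pi r -> 0 <= t ->
  gradnorm2 Q pi r (P t psi) <= expR (- 2 * kappa * t) * gradnorm2 Q pi (P t r) psi.
Proof.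
move=> dr; rewrite le_eqVlt => /predU1P[<-|t0].
  by rewrite mulr0 expR0 mul1r !semigroup0.
have r0 x : 0 <= r x by case: dr.
have Pr_gt0 x : 0 < P t r x.
  by have [y ry] := density_gt0_ex dr; apply: (semigroup_gt0 hQ) ry.
have [m m0 hm] := positive_lower_bound Pr_gt0.
set G := gradnorm2 _ _ r _; set k := expR _; set g := gradnorm2 _ _ _ psi.
have k0 : 0 < k := expR_gt0 _.
have -> : G = G * (1 - 0) by rewrite subr0 mulr1.
apply: (@le_of_affine_bound _ (fun e : R => G * (1 - e)) _ (k * g / m) 1) => //.
  by apply: cvgM; [exact: cvg_cst|apply: cvgB; [exact: cvg_cst|exact: cvg_id]].
move=> e e0 e1 /=; have e1' := ltW e1; have e0' := ltW e0.
(* Mixing with the uniform density moves [r] to the interior at small cost: [re] is at least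
   [(1 - e) r], and [P t re] is at most [(1 + e / m) P t r] because [P t r >= m]. *)
pose re x := (1 - e) * r x + e * 1.
have d1 : density pi (fun=> 1 : R).
  by split=> [x //|]; under eq_bigr do rewrite mul1r; exact: (stationary_sum1 hQ).
have dre : density pi re := density_convex e0' e1' dr d1.
have rec x : e <= re x.
  by rewrite /re mulr1 lerDr mulr_ge0// subr_ge0.
apply: (@le_trans _ _ (gradnorm2 Q pi re (P t psi))).
  rewrite mulrC; apply: (ler_gradnorm2 hQ) => // [|x]; first by rewrite subr_ge0.
  by rewrite lerDl mulr1.
apply: le_trans (interior_gradient_estimate psi e0 dre rec t0) _; rewrite -/k.
have PE : P t re = (fun x => (1 - e) * P t r x + e).
  rewrite (semigroup_lin Q t (1 - e) r (fun=> e * 1)) (semigroup_cst Q).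
  by apply/funext => x; rewrite mulr1.
have em0 : 0 < 1 + e / m by rewrite ltr_pwDl// divr_ge0// ltW.
have : (1 + e / m)^-1 * gradnorm2 Q pi (P t re) psi <= g.
  apply: (ler_gradnorm2 hQ).
  - by rewrite invr_ge0 ltW.
  - by move=> x; apply: (semigroup_ge0 hQ); [exact: ltW|case: dre].
  - move=> x; rewrite ler_pdivrMl// PE.
    have : e <= e / m * P t r x.
      by rewrite mulrAC ler_pdivlMr//; apply: ler_wpM2l.
    by have := mulr_ge0 e0' (ltW (Pr_gt0 x)); lra.
rewrite ler_pdivrMl// => /(ler_wpM2l (ltW k0)) /le_trans; apply.
by rewrite le_eqVlt; apply/orP; left; apply/eqP; field; exact: lt0r_neq0.
Qed.

End ConvexityImpliesGradientEstimate.

Theorem theorem3p1 (R : realType) (X : finType) (Q : X -> X -> R) (pi : X -> R)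
    (kappa : R) (hQ : reversible_chain Q pi) :
  entropic_Ric_ge Q pi kappa <->
  (forall (psi rho : X -> R) (t : R), density pi rho -> 0 <= t ->
     gradnorm2 Q pi rho (semigroup Q t psi) <=
       expR (- 2 * kappa * t) * gradnorm2 Q pi (semigroup Q t rho) psi).
Proof.
split => [hRic psi rho t | hG].
  exact: (convex_gradient_estimate hQ hRic).
exact: (gradient_estimate_convex hQ hG).
Qed.
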